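(* For every finite connected weighted undirected graph $G=(V,(c_{xy})_{x,y\in V})$ and all positive weights $\alpha=(\alpha_x)_{x\in V}$, the spectral gap $\mathrm{gap}(G,\alpha)$ of the harmonic process (HP) on $G$ with parameters $\alpha$ satisfies $$\big(1\wedge\gamma_{\rm HP}(G,\alpha)\big)\,\mathrm{gap}_1(G,\alpha)\le \mathrm{gap}(G,\alpha)\le \mathrm{gap}_1(G,\alpha),$$ where $$\gamma_{\rm HP}(G,\alpha)= \min_{x\neq y\,:\,c_{xy}>0}\Big\{\frac{\alpha_x}{\alpha_x+1}+\frac{\alpha_y}{\alpha_y+1}\Big\}\Big(1+\frac1{|\alpha|}\Big),\qquad |\alpha|=\sum_{x\in V}\alpha_x .$$
   Context: $a\wedge b=\min\{a,b\}$. $V$ is a finite set with $|V|=n\ge 2$; $c_{xy}=c_{yx}\ge 0$ are symmetric edge weights ($c_{xx}=0$), and $G$ is connected through the edges with $c_{xy}>0$. The state space is $\Omega=\{\eta=(\eta_x)_{x\in V}:\eta_x\ge 0,\ \sum_{x\in V}\eta_x=1\}$. Harmonic process: its generator acts on polynomial functions $f$ on $\Omega$ as $$\mathcal L f(\eta)=\sum_{x,y\in V,\,x\ne y}c_{xy}\int_0^1 u^{\alpha_x-1}(1-u)^{-1}\{f(\eta^{x\to y,u})-f(\eta)\}\,\mathrm du,$$ where the sum is over ordered pairs and $\eta^{x\to y,u}$ denotes $\eta$ with $(\eta_x,\eta_y)$ replaced by $(u\eta_x,(1-u)\eta_x+\eta_y)$, all other coordinates being unchanged. It is reversible with respect to the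 Dirichlet distribution $\mu\sim\mathrm{Dir}(\alpha)$ on $\Omega$, i.e. the probability measure with density proportional to $\prod_{x\in V}\eta_x^{\alpha_x-1}$ with respect to the uniform measure on $\Omega$; $\mathcal L$ on polynomials is essentially self-adjoint in $L^2(\mu)$, and its closure is still denoted by $\mathcal L$. Write $\mu f=\int f\,\mathrm d\mu$ and $\mathcal D(f)=\langle f,-\mathcal L f\rangle_{L^2(\mu)}$. Define $$\mathrm{gap}(G,\alpha)=\inf\{\mathcal D(f): f\in L^2(\mu),\ \|f-\mu f\|_{L^2(\mu)}=1\},\qquad \mathrm{gap}_1(G,\alpha)=\inf\{\mathcal D(f): f\in \mathscr P_1,\ \|f-\mu f\|_{L^2(\mu)}=1\},$$ where in the first infimum $f$ ranges over the domain of $\mathcal L$, and $\mathscr P_1$ is the space of polynomial functions on $\Omega$ of degree at most $1$ in the variables $(\eta_x)_{x\in V}$. *)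

(* Defs.v *)
From HB Require Import structures.
From mathcomp Require Import all_boot all_order all_algebra.
(* The notations of mpoly clash with those of the analysis library, and its
   [Measure] structure must be shadowed by the one of that library. *)
From mathcomp Require Import -(notations) mpoly.
From mathcomp Require Import all_classical all_reals all_analysis.
From mathcomp Require Import measurable_realfun.

Set Implicit Arguments.
Unset Strict Implicit.
Unset Printing Implicit Defensive.

Import Order.TTheory GRing.Theory Num.Theory.
Import numFieldNormedType.Exports.

Local Open Scope classical_set_scope.
Local Open Scope ring_scope.

(* [pushforward], with a measure structure that is inferred from [f]. *)
Section image_measure.
Context d1 d2 (T1 : measurableType d1) (T2 : measurableType d2) (R : realType).
Variables (m : {measure set T1 -> \bar R}) (f : {mfun T1 >-> T2}).

Definition image_measure := pushforward m f.

Let image_measure0 : image_measure set0 = 0%E.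
Proof. exact: measure0. Qed.

Let image_measure_ge0 A : (0 <= image_measure A)%E.
Proof. exact: measure_ge0. Qed.

Let image_measure_sigma_additive : semi_sigma_additive image_measure.
Proof. exact: measure_semi_sigma_additive. Qed.

HB.instance Definition _ := isMeasure.Build _ _ _ image_measure
  image_measure0 image_measure_ge0 image_measure_sigma_additive.

End image_measure.

Section lebesgue_tuple.
Variable R : realType.
Local Open Scope ereal_scope.

Definition tcons n (z : measurableTypeR R * n.-tuple R) : n.+1.-tuple R :=
  [tuple of z.1 :: z.2].

Lemma measurable_tcons n :
  measurable_fun [set: measurableTypeR R * n.-tuple R] (@tcons n).
Proof. exact: measurable_cons. Qed.

HB.instance Definition _ n :=
  isMeasurableFun.Build _ _ _ _ (@tcons n) (@measurable_tcons n).

Definition lebesgue_cons n (m : {sigma_finite_measure set (n.-tuple R) -> \bar R})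
    : set (n.+1.-tuple R) -> \bar R :=
  image_measure (@lebesgue_measure R \x m) (@tcons n).

HB.instance Definition _ n m := Measure.on (@lebesgue_cons n m).

Lemma lebesgue_cons_sigma_finite n m :
  sigma_finite [set: n.+1.-tuple R] (@lebesgue_cons n m).
Proof.
have /sigma_finiteP[F [UF ndF mF]] := sigma_finiteT (@lebesgue_measure R).
have /sigma_finiteP[G [UG ndG mG]] := sigma_finiteT m.
pose uncons (t : n.+1.-tuple R) : measurableTypeR R * n.-tuple R :=
  (thead t, [tuple of behead t]).
have unconsK z : uncons (@tcons n z) = z.
  by case: z => x t; congr pair; apply: val_inj.
have muncons : measurable_fun setT uncons.
  apply/measurable_fun_pairP; split; last exact: measurable_behead.
  exact: (@measurable_tnth _ R).
exists (fun k => uncons @^-1` (F k `*` G k)).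
  rewrite -preimage_bigcup (_ : \bigcup_k _ = setT) ?preimage_setT//.
  rewrite -subTset => -[x t] _.
  have [i _ Fx] : (\bigcup_i F i) x by rewrite -UF.
  have [j _ Gt] : (\bigcup_i G i) t by rewrite -UG.
  exists (maxn i j) => //; split.
    by move: x Fx; exact/subsetPset/ndF/leq_maxl.
  by move: t Gt; exact/subsetPset/ndG/leq_maxr.
move=> k; have [mFk Fk] := mF k; have [mGk Gk] := mG k; split.
  by rewrite -[X in measurable X]setTI; apply: muncons => //; exact: measurableX.
rewrite /lebesgue_cons /image_measure /pushforward -comp_preimage.
rewrite (_ : uncons \o @tcons n = id); last by apply/funext.
rewrite preimage_id.
have /= -> := product_measure1E (@lebesgue_measure R) m mFk mGk.
by rewrite lte_mul_pinfty// ge0_fin_numE.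
Qed.

HB.instance Definition _ n m := Measure_isSigmaFinite.Build _ _ _
  (@lebesgue_cons n m) (@lebesgue_cons_sigma_finite n m).

(* n-dimensional Lebesgue measure; the library only has binary products *)
Fixpoint lebesgue_tuple n : {sigma_finite_measure set (n.-tuple R) -> \bar R} :=
  match n with
  | 0 => \d_([tuple] : 0.-tuple R)
  | n'.+1 => lebesgue_cons (lebesgue_tuple n')
  end.

End lebesgue_tuple.

Section harmonic_process.
Variables (R : realType) (V : finType).

(* R^V, with the product sigma-algebra; all functions below are defined on R^V,
   and the measures on it are carried by the simplex [Omega]. *)
Definition state := #|V|.-tuple R.

Definition coord (eta : state) (x : V) : R := tnth eta (enum_rank x).

Definition mk_state (h : V -> R) : state := [tuple h (enum_val i) | i < #|V|].

Definition Omega : set state :=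
  [set eta | (forall x, 0 <= coord eta x) /\ \sum_(x : V) coord eta x = 1].

Lemma measurable_coord x : measurable_fun [set: state] (coord^~ x).
Proof. exact: (@measurable_tnth _ R). Qed.

Lemma measurable_Omega : measurable Omega.
Proof.
have -> : Omega = \bigcap_(x in [set: V]) (coord^~ x @^-1` `[0, +oo[)
    `&` (fun eta => \sum_(x : V) coord eta x) @^-1` [set 1].
  apply/seteqP; split=> eta /= [eta_ge0 eta1]; split=> // x.
    by move=> _ /=; rewrite in_itv/= andbT.
  by have := eta_ge0 x I; rewrite /= in_itv/= andbT.
apply: measurableI.
  apply: fin_bigcap_measurable => // x _; rewrite -[X in measurable X]setTI.
  exact: measurable_coord.
rewrite -[X in measurable X]setTI.
by apply: measurable_sum => // x; exact: measurable_coord.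
Qed.

(* Affine chart of the hyperplane [\sum_x eta_x = 1]: all the coordinates but
   the first one are free. *)
Definition simplex_chart (t : #|V|.-1.-tuple R) : state :=
  [tuple nth 0 (1 - \sum_(j < #|V|.-1) tnth t j :: t) i | i < #|V|].

Lemma measurable_simplex_chart : measurable_fun [set: _] simplex_chart.
Proof.
apply/measurable_fun_tnthP => i /=.
have msum : measurable_fun [set: #|V|.-1.-tuple R]
    (fun t => 1 - \sum_(j < #|V|.-1) tnth t j).
  apply: measurable_funB => //; apply: measurable_sum => j.
  exact: (@measurable_tnth _ R).
have [i0|i_gt0] := posnP i.
  rewrite (_ : _ \o _ = fun t => 1 - \sum_(j < #|V|.-1) tnth t j) //.
  by apply/funext => t /=; rewrite tnth_mktuple i0.
have ltin : (i.-1 < #|V|.-1)%N by rewrite -ltnS !prednK// (leq_trans _ (ltn_ord i)).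
rewrite (_ : _ \o _ = (@tnth _ R)^~ (Ordinal ltin)).
  exact: (@measurable_tnth _ R).
apply/funext => t /=; rewrite tnth_mktuple (tnth_nth 0) /=.
by rewrite -[X in nth _ _ X](prednK i_gt0).
Qed.

HB.instance Definition _ :=
  isMeasurableFun.Build _ _ _ _ simplex_chart measurable_simplex_chart.

(* Uniform measure on [Omega]. Its total mass is 1/(n-1)!, n = #|V|; constant
   factors do not matter, since [dirichlet] is normalized. *)
Definition simplex_measure : set state -> \bar R :=
  mrestr (image_measure (lebesgue_tuple R #|V|.-1) simplex_chart)
    measurable_Omega.

HB.instance Definition _ := Measure.on simplex_measure.

Variables (c : V -> V -> R) (alpha : V -> R).

Definition dirichlet_weight (eta : state) : R :=
  \prod_(x : V) coord eta x `^ (alpha x - 1).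

Definition dirichlet_density (A : set state) : \bar R :=
  (\int[simplex_measure]_(eta in A) (dirichlet_weight eta)%:E)%E.

Let dirichlet_weight_ge0 eta : (0 <= (dirichlet_weight eta)%:E)%E.
Proof. by rewrite lee_fin prodr_ge0// => x _; exact: powR_ge0. Qed.

Let dirichlet_density0 : dirichlet_density set0 = 0%E.
Proof. exact: integral_set0. Qed.

Let dirichlet_density_ge0 A : (0 <= dirichlet_density A)%E.
Proof. exact: integral_ge0. Qed.

Let dirichlet_density_sigma_additive : semi_sigma_additive dirichlet_density.
Proof.
apply: semi_sigma_additive_nng_induced => //; apply/measurable_EFinP.
apply: measurable_prod => x _.
exact: (measurableT_comp (measurable_powR _) (measurable_coord x)).
Qed.

HB.instance Definition _ := isMeasure.Build _ _ _ dirichlet_density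
  dirichlet_density0 dirichlet_density_ge0 dirichlet_density_sigma_additive.

(* [mnormalize] falls back on its second argument if the total mass is 0 or
   infinite, which does not happen for positive weights [alpha]. *)
Definition dirichlet : probability state R :=
  mnormalize dirichlet_density \d_(mk_state (fun=> 0)).

Definition polyfun (f : state -> R) : Prop :=
  exists p : mpoly #|V| R, f = fun eta => meval (tnth eta) p.

(* [mmeasure mdeg] is 1 + the total degree (0 for the zero polynomial). *)
Definition polyfun1 (f : state -> R) : Prop :=
  exists2 p : mpoly #|V| R, (mmeasure mdeg p <= 2)%N
    & f = fun eta => meval (tnth eta) p.

(* [eta^{x -> y, u}] *)
Definition jump (x y : V) (u : R) (eta : state) : state :=
  mk_state (fun z => if z == x then u * coord eta x
                     else if z == y then (1 - u) * coord eta x + coord eta y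
                     else coord eta z).

Definition hp_generator (f : state -> R) (eta : state) : R :=
  \sum_(e : V * V | e.1 != e.2) c e.1 e.2 *
    \int[lebesgue_measure]_(u in `[0, 1])
      (u `^ (alpha e.1 - 1) * (1 - u)^-1 * (f (jump e.1 e.2 u eta) - f eta)).

(* Graph of the closure in L^2 of the generator on polynomial functions:
   [f] is in the domain and is mapped to [g]. *)
Definition hp_closure (f g : state -> R) : Prop :=
  [/\ f \in Lfun dirichlet 2%:E, g \in Lfun dirichlet 2%:E &
    exists p : nat -> state -> R,
      [/\ forall k, polyfun (p k),
          (fun k => 'N[dirichlet]_2%:E[EFin \o (p k \- f)%R])%E @ \oo --> 0%E &
          (fun k => 'N[dirichlet]_2%:E[EFin \o (hp_generator (p k) \- g)%R])%E
            @ \oo --> 0%E]].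

Definition hp_mean (f : state -> R) : R := \int[dirichlet]_eta f eta.

(* Infimum of the Dirichlet form [<f, - L f>] over the [f] in the domain of the
   closed generator that satisfy [P] and have variance 1. *)
Definition hp_inf (P : (state -> R) -> Prop) : \bar R :=
  ereal_inf [set r | exists f g, [/\ P f, hp_closure f g,
    'N[dirichlet]_2%:E[EFin \o (fun eta => f eta - hp_mean f)%R] = 1 &
    r = (\int[dirichlet]_eta (f eta * - g eta))%R%:E]]%E.

Definition gap : \bar R := hp_inf (fun=> True).

Definition gap1 : \bar R := hp_inf polyfun1.

Definition gamma_hp : \bar R :=
  ((\big[mine/+oo]_(e : V * V | (e.1 != e.2) && (0 < c e.1 e.2)%R)
     (alpha e.1 / (alpha e.1 + 1) + alpha e.2 / (alpha e.2 + 1))%:E)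
   * (1 + (\sum_(x : V) alpha x)^-1)%:E)%E.

End harmonic_process.

(* Main.v *)
(* Write [L] for the generator, [s] for the sum of the weights alpha, and split a
   polynomial as p = p1 + q with p1 affine and q orthogonal to the affine functions.
   Since [L] is symmetric and preserves degree 1, D(p) = D(p1) + D(q), and
   D(p1) >= gap1 Var(p1); it remains to show D(q) >= gamma gap1 E(q^2).
   For this, measure a function f by a quadratic form psi, nonnegative on the tangent space
   of the simplex, such that for all states a, b and t in [0, 1]
     |(1 - t) f(a) + t f(b) - f((1 - t) a + t b)| <= psi(a - b).
   As the jumps are affine in the state, an Euler step f |-> f + h L f is controlled in the
   same way by psi + h L psi, up to an error that is negligible compared with h. The size of
   psi is the linear functional [ell]; ell(L psi) is a combination of the numbers
   psi(e_x - e_y) over the edges, and comparing it with ell(psi) edge by edge gives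
   ell(L psi) <= - gamma gap1 ell(psi), where gap1 enters through the duality between
   positive semidefinite forms. So the Euler iterates of q approach affine functions, to
   which q is orthogonal, at the rate gamma gap1, and the power method for symmetric
   operators turns this into the bound on D(q).
   Symmetry of [L] and the moments of the Dirichlet law come from the explicit integrals
   of monomials; the bound passes from polynomials to the domain of the closure by L^2
   continuity of both sides. *)
Require Import Defs.
From HB Require Import structures.
From mathcomp Require Import all_boot all_order all_algebra.
From mathcomp Require Import -(notations) mpoly.
From mathcomp Require Import all_classical all_reals all_analysis.
From mathcomp Require Import measurable_realfun.
From mathcomp Require Import ring lra.

Set Implicit Arguments.
Unset Strict Implicit.
Unset Printing Implicit Defensive.

Import Order.TTheory GRing.Theory Num.Theory.
Import numFieldNormedType.Exports.

Local Open Scope classical_set_scope.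
Local Open Scope ring_scope.
(* Again, since [vector.coord] has shadowed [coord]. *)
Require Import Defs.

(** The obstacle is that the jump kernel u^(alpha_x - 1) / (1 - u) du has infinite mass near u = 1:
    for no h > 0 is f + h L f an average of f over jumps, so the domination by psi does not pass to
    the next Euler step for free. On polynomials of bounded degree, however, a bound on the values
    over [0, 1] also bounds the slope at u = 1. Jumps with u close to 1 can then be cut off at a
    cost C / m, where C depends on the degree only, and the cut kernel has mass of order m. For each
    m one admissible step h is fixed; the power method gives a bound that is affine in h, so h
    cancels exactly, and m tends to infinity last. As [L] preserves the degree, one constant C
    serves all iterates. Chord defects take the place of second derivatives because they commute
    exactly with affine jumps. In the constant gamma, each end of an edge contributes alpha / (alpha
    + 1) through the second moment of its jump kernel, and 1 + 1 / |alpha| appears because the two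
    halves of [ell] produce the same edge sum, the second one divided by |alpha|. *)

(** * One-dimensional integrals: affine substitution and powers *)

Section affine_change.
Variable R : realType.
Local Notation mu := (@lebesgue_measure R).

(** Scaled by [|k|], the image of Lebesgue measure under the affine map gives every interval its
    length, and this characterizes Lebesgue measure. *)
Lemma ge0_integral_affine (k b : R) (f : R -> \bar R) : k != 0 ->
  measurable_fun [set: R] f -> (forall t, (0 <= f t)%E) ->
  (\int[mu]_t f t = `|k|%:E * \int[mu]_t f (k * t + b)%R)%E.
Proof.
move=> k0 mf f0.
pose phi : measurableTypeR R -> measurableTypeR R := fun t => k * t + b.
have mphi : measurable_fun setT phi.
  by apply: measurable_funD => //; exact: measurable_funM.
pose phiM : {mfun measurableTypeR R >-> measurableTypeR R} :=
  HB.pack phi (isMeasurableFun.Build _ _ _ _ phi mphi).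
have -> : (\int[mu]_t f (k * t + b)%R = \int[pushforward mu phi]_t f t)%E.
  by rewrite ge0_integral_pushforward.
have kp : 0 <= `|k| by [].
rewrite -[RHS](ge0_integral_mscale (pushforward mu phiM) measurableT (NngNum kp))//.
apply: eq_measure_integral => //= A mA _.
apply: lebesgue_measure_unique => //= _ [[c d]] _ <-.
rewrite /mscale/= /pushforward/=.
have [k_gt0|k_lt0] : 0 < k \/ k < 0 by apply/orP; rewrite orbC -neq_lt.
  have -> : phi @^-1` `]c, d] = `]((c - b) / k), ((d - b) / k)]%classic.
    apply/seteqP; split=> t /=; rewrite !in_itv/= /phi.
      by rewrite ltr_pdivrMr// ler_pdivlMr// ltrBlDr lerBrDr mulrC.
    by rewrite ltr_pdivrMr// ler_pdivlMr// ltrBlDr lerBrDr mulrC.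
  rewrite !lebesgue_measure_itv/= !lte_fin ltr_pM2r ?invr_gt0// ltrD2r.
  case: ifP => _; last by rewrite mule0.
  by rewrite -EFinB -EFinM gtr0_norm//; congr EFin; field.
(* A negative slope exchanges the open and the closed end. *)
have -> : phi @^-1` `]c, d] = `[((d - b) / k), ((c - b) / k)[%classic.
  apply/seteqP; split=> t /=; rewrite !in_itv/= /phi.
    by rewrite ltr_ndivlMr// ler_ndivrMr// ltrBlDr lerBrDr mulrC andbC.
  by rewrite ltr_ndivlMr// ler_ndivrMr// ltrBlDr lerBrDr mulrC andbC.
rewrite !lebesgue_measure_itv/= !lte_fin ltr_nM2r ?invr_lt0// ltrD2r.
case: ifP => _; last by rewrite mule0.
by rewrite -EFinB -EFinM ltr0_norm//; congr EFin; field; rewrite lt_eqF.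
Qed.

(** For [a < 1] the integrand is unbounded at 0, so the fundamental theorem is applied away from 0
    and followed by a monotone limit. *)
Lemma integral_oo0_powRB1 (a r : R) : 0 < a -> 0 < r ->
  (\int[mu]_(t in `]0%R, r[) (t `^ (a - 1))%:E = (r `^ a / a)%:E)%E.
Proof.
move=> a0 r0.
(* The shift by 2 keeps the left end strictly below [r] already for [n = 0]. *)
pose F (n : nat) : set R := `[r / n.+2%:R, r]%classic.
pose f t : \bar R := (t `^ (a - 1))%:E.
have mf D : measurable_fun D f.
  by apply/measurable_EFinP; apply: measurable_funTS; exact: measurable_powR.
have rn n : 0 < r / n.+2%:R by rewrite divr_gt0.
have UF : \bigcup_n F n = `]0, r]%classic.
  apply/seteqP; split=> [t [n _]|t]; rewrite /F/= !in_itv/=.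
    by move=> /andP[rt ->]; rewrite (lt_le_trans _ rt).
  move=> /andP[t0 tr]; exists (Num.truncn (r / t)) => //=.
  rewrite in_itv/= tr andbT ler_pdivrMr//.
  have := truncnS_gt (r / t); rewrite ltr_pdivrMr// mulrC => /ltW/le_trans->//.
  by rewrite ler_pM2l// ler_nat.
have ndF : nondecreasing_seq F.
  move=> m n mn; rewrite subsetEset => t; rewrite /F/= !in_itv/= => /andP[+ ->].
  rewrite andbT; apply: le_trans.
  by rewrite ler_pM2l// lef_pV2 ?posrE// ler_nat !ltnS.
rewrite -(@integral_itv_bndoo R 0 r f false false)//.
rewrite -UF.
have h1 : (\int[mu]_(x in F n) f x)%E @[n --> \oo] --> (\int[mu]_(x in \bigcup_n F n) f x)%E.
  apply: ge0_nondecreasing_set_cvg_integral => // [n|n|n t _].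
  - exact: measurable_itv.
  - exact: mf.
  - by rewrite lee_fin powR_ge0.
have h2 : (\int[mu]_(x in F n) f x)%E @[n --> \oo] --> (r `^ a / a)%:E.
  have intF n : (\int[mu]_(x in F n) f x = (r `^ a / a - (r / n.+2%:R) `^ a / a)%:E)%E.
    rewrite (@continuous_FTC2 _ _ (fun t => t `^ a / a))//.
    - rewrite ltr_pdivrMr// ltr_pMr// ltr1n//.
    - apply: derivable_within_continuous => t; rewrite in_itv/= => /andP[rt _].
      by apply: derivable_powR; rewrite in_itv/= andbT (lt_le_trans _ rt).
    - have dF t : 0 < t -> derivable (fun t : R => t `^ a / a) t 1.
        move=> t0; apply: derivableM => //.
        by apply: derivable_powR; rewrite in_itv/= andbT.
      split.
      + move=> t; rewrite in_itv/= => /andP[rt _]; apply: dF.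
        exact: lt_trans rt.
      + apply: cvg_at_right_filter.
        by move/derivable1_diffP/differentiable_continuous: (dF _ (rn n)).
      + apply: cvg_at_left_filter.
        by move/derivable1_diffP/differentiable_continuous: (dF _ r0).
    - move=> t; rewrite in_itv/= => /andP[rt _].
      have t0 : 0 < t by exact: lt_trans rt.
      rewrite derive1Mr; last by apply: derivable_powR; rewrite in_itv/= andbT.
      by rewrite powR_derive1 ?in_itv/= ?t0// mulrC mulKf// gt_eqF.
  under eq_fun do rewrite intF.
  apply: cvg_EFin; first by near=> n.
  rewrite -[X in _ --> X]subr0.
  apply: cvgB; first exact: cvg_cst.
  rewrite -[X in _ --> X](mul0r a^-1); apply: cvgM; last exact: cvg_cst.
  have c0 : r / n.+2%:R @[n --> \oo] --> (0 : R).
    rewrite -(mulr0 r); apply: cvgM; first exact: cvg_cst.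
    have := @cvg_harmonic R; rewrite -(cvg_shiftS); apply: cvg_trans.
    by apply: near_eq_cvg; near=> n; rewrite /harmonic.
  have cR : r / n.+2%:R @[n --> \oo] --> (0 : R)^'+.
    by move=> A A0; have [N NN NA] := c0 _ A0; exists N => // n /NA; apply; exact: rn.
  exact: (cvg_comp _ _ cR (powR_cvg0 a0)).
by rewrite (cvg_unique _ h1 h2).
Unshelve. all: by end_near.
Qed.
End affine_change.

(** * Convolution of powers and the beta function *)

Section convolution.
Variable R : realType.
Implicit Types a b r t : R.
Local Notation mu := (@lebesgue_measure R).

(* [t ^ (a - 1)] extended by 0 to the half-line [t <= 0], where [`^] has other values. *)
Definition pw (a t : R) : R := if 0 < t then t `^ (a - 1) else 0.

Lemma pw_ge0 a t : 0 <= pw a t.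
Proof. by rewrite /pw; case: ifP => // _; exact: powR_ge0. Qed.

Lemma pw_eq0 a t : t <= 0 -> pw a t = 0.
Proof. by rewrite /pw ltNge => ->. Qed.

Lemma pw_at1 a : pw a 1 = 1.
Proof. by rewrite /pw ltr01 powR1. Qed.

Lemma measurable_pw a : measurable_fun [set: R] (pw a).
Proof.
apply: measurable_fun_ifT => //.
  exact: measurable_fun_ltr.
Qed.

Lemma pwM a r t : 0 < r -> pw a (r * t) = r `^ (a - 1) * pw a t.
Proof.
move=> r0; rewrite /pw pmulr_rgt0//; case: ifPn => [t0|]; last by rewrite mulr0.
by rewrite powRM ?ltW.
Qed.

Lemma pwX a t k : pw a t * t ^+ k = pw (a + k%:R) t.
Proof.
rewrite /pw; case: ifPn => [t0|]; last by rewrite mul0r.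
rewrite -powR_mulrn ?ltW// -powRD; last by rewrite (gt_eqF t0) implybT.
by congr (_ `^ _); ring.
Qed.

Definition convol (f g : R -> R) (r : R) : \bar R :=
  (\int[mu]_t (f t * g (r - t))%:E)%E.

Lemma measurable_convol_integrand (f g : R -> R) r : measurable_fun setT f ->
  measurable_fun setT g -> measurable_fun setT (fun t => (f t * g (r - t))%:E).
Proof.
move=> mf mg; apply/measurable_EFinP; apply: measurable_funM => //.
by apply: measurableT_comp => //; exact: measurable_funB.
Qed.

Lemma convolC (f g : R -> R) r : measurable_fun setT f -> measurable_fun setT g ->
  (forall t, 0 <= f t) -> (forall t, 0 <= g t) -> convol f g r = convol g f r.
Proof.
move=> mf mg f0 g0; rewrite /convol (@ge0_integral_affine _ (-1) r)//.
- rewrite normrN1 mul1e; apply: eq_integral => t _.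
  by rewrite mulN1r [X in r - X]addrC opprB addrCA subrr addr0 addrC mulrC.
- exact: measurable_convol_integrand.
- by move=> t; rewrite lee_fin mulr_ge0.
Qed.

End convolution.

(** Euler's beta function. It is extended-real because finiteness is only obtained in [ebeta_lty],
    after its recursion. *)
HB.lock Definition ebeta (R : realType) (a b : R) : \bar R :=
  convol (pw a) (pw b) 1.

Section beta.
Variable R : realType.
Implicit Types a b c r : R.
Local Notation mu := (@lebesgue_measure R).

(** By homogeneity of [pw], the substitution of [r * t] for [t] reduces the case [r > 0] to [r = 1];
    for [r <= 0] the two supports are disjoint. *)
Lemma convol_pw a b r : convol (pw a) (pw b) r = (ebeta a b * (pw (a + b) r)%:E)%E.
Proof.
have mab c := measurable_convol_integrand c (measurable_pw a) (measurable_pw b).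
have [r0|r0] := leP r 0.
  rewrite (pw_eq0 _ r0) mule0; apply: integral0_eq => t _.
  have [t0|t0] := leP t 0; first by rewrite (pw_eq0 _ t0) mul0r.
  by rewrite (@pw_eq0 _ b) ?mulr0// subr_le0 (le_trans r0)// ltW.
rewrite /convol (@ge0_integral_affine _ r 0) ?gt_eqF//.
have -> : (\int[mu]_t (pw a (r * t + 0) * pw b (r - (r * t + 0)))%:E =
    \int[mu]_t ((r `^ (a - 1) * r `^ (b - 1))%:E * (pw a t * pw b (1 - t))%:E))%E.
  apply: eq_integral => t _; rewrite addr0 -[X in X - _](mulr1 r) -mulrBr !pwM//.
  by rewrite -EFinM mulrACA.
rewrite ge0_integralZl//; last 3 first.
- exact: mab.
- by move=> t _; rewrite lee_fin mulr_ge0// pw_ge0.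
- by rewrite lee_fin mulr_ge0// powR_ge0.
rewrite ebeta.unlock muleA muleC -EFinM; congr (_ * _%:E)%E.
rewrite gtr0_norm// /pw r0.
rewrite -{1}(@powRr1 _ r) ?ltW// -!powRD ?(gt_eqF r0) ?implybT//.
by congr (_ `^ _); ring.
by move=> t; rewrite lee_fin mulr_ge0// pw_ge0.
Qed.

(** [pw 1] is the indicator of the positive half-line, so convolution with it takes the
    primitive. *)
Lemma convol_pw1 a r : 0 < a -> convol (pw 1) (pw a) r = (pw (a + 1) r / a)%:E.
Proof.
move=> a0; have [r0|r0] := leP r 0.
  rewrite convol_pw (pw_eq0 _ r0) mule0 addrC.
  by rewrite (pw_eq0 _ r0) mul0r.
rewrite convolC; [|exact: measurable_pw|exact: measurable_pw|exact: pw_ge0|exact: pw_ge0].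
have -> : pw (a + 1) r = r `^ a by rewrite /pw r0 addrK.
rewrite -integral_oo0_powRB1// [RHS]integral_mkcond.
apply: eq_integral => t _; rewrite patchE mem_setE in_itv/= /pw subr_gt0.
by case: ifPn => t0; case: ifPn => tr; rewrite ?mul0r ?mulr0 // subrr powRr0 mulr1.
Qed.

(** Tonelli, after the translation of the inner variable by [s]. *)
Lemma convolA (f g h : R -> R) r :
  measurable_fun setT f -> measurable_fun setT g -> measurable_fun setT h ->
  (forall t, 0 <= f t) -> (forall t, 0 <= g t) -> (forall t, 0 <= h t) ->
  (\int[mu]_s ((f s)%:E * convol g h (r - s)) =
   \int[mu]_t (convol f g t * (h (r - t))%:E))%E.
Proof.
move=> mf mg mh f0 g0 h0.
pose F (z : measurableTypeR R * measurableTypeR R) : \bar R :=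
  (f z.1 * g (z.2 - z.1) * h (r - z.2))%:E.
have mF : measurable_fun setT F.
  apply/measurable_EFinP; apply: measurable_funM; first apply: measurable_funM.
  - exact: measurableT_comp.
  - by apply: measurableT_comp => //; exact: measurable_funB.
  - by apply: measurableT_comp => //; exact: measurable_funB.
have F0 z : (0 <= F z)%E by rewrite lee_fin !mulr_ge0.
transitivity (\int[mu]_s \int[mu]_t F (s, t))%E.
  apply: eq_integral => s _.
  rewrite /convol -ge0_integralZl//; last 3 first.
  - exact: measurable_convol_integrand.
  - by move=> t _; rewrite lee_fin mulr_ge0.
  - by rewrite lee_fin.
  rewrite [LHS](@ge0_integral_affine _ 1 (-s)) ?oner_neq0//; last 2 first.
  - by apply: measurable_funeM; exact: measurable_convol_integrand.
  - by move=> t; rewrite -EFinM lee_fin !mulr_ge0.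
  rewrite normr1 mul1e; apply: eq_integral => t _.
  by rewrite -EFinM /F/= mul1r mulrA; congr ((_ * h _)%:E); ring.
rewrite fubini_tonelli//; apply: eq_integral => t _.
rewrite muleC -ge0_integralZl//; last 3 first.
- exact: measurable_convol_integrand.
- by move=> s _; rewrite lee_fin mulr_ge0.
- by rewrite lee_fin.
by apply: eq_integral => s _; rewrite -EFinM /F/= mulrC.
Qed.

Lemma ebeta_ge0 a b : (0 <= ebeta a b)%E.
Proof. by rewrite ebeta.unlock; apply: integral_ge0 => t _; rewrite lee_fin mulr_ge0// pw_ge0. Qed.

Lemma ebetaC a b : ebeta a b = ebeta b a.
Proof.
by rewrite ebeta.unlock; apply: convolC; [exact: measurable_pw|exact: measurable_pw|exact: pw_ge0|exact: pw_ge0].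
Qed.

Lemma ebeta1 a : 0 < a -> ebeta 1 a = a^-1%:E.
Proof. by move=> a0; rewrite ebeta.unlock convol_pw1// pw_at1 mul1r. Qed.

(* Associativity of the convolution of [pw 1], [pw a] and [pw b]. *)
Lemma ebetaS a b : 0 < a -> 0 < b ->
  (ebeta a b * (a + b)^-1%:E = a^-1%:E * ebeta (a + 1) b)%E.
Proof.
move=> a0 b0.
have mp c := @measurable_pw R c.
have := convolA 1 (mp 1) (mp a) (mp b) (pw_ge0 1) (pw_ge0 a) (pw_ge0 b).
have -> : (\int[mu]_s ((pw 1 s)%:E * convol (pw a) (pw b) (1 - s)) =
    \int[mu]_s (ebeta a b * (pw 1 s * pw (a + b) (1 - s))%:E))%E.
  by apply: eq_integral => s _; rewrite convol_pw muleCA EFinM.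
rewrite ge0_integralZl//; last 3 first.
- exact: measurable_convol_integrand.
- by move=> s _; rewrite lee_fin mulr_ge0// pw_ge0.
- exact: ebeta_ge0.
have := ebeta1 (addr_gt0 a0 b0); rewrite {1}ebeta.unlock /convol => -> ->.
have -> : (\int[mu]_t (convol (pw 1) (pw a) t * (pw b (1 - t))%:E) =
    \int[mu]_t (a^-1%:E * (pw (a + 1) t * pw b (1 - t))%:E))%E.
  apply: eq_integral => t _; rewrite convol_pw1// -!EFinM; congr EFin.
  by rewrite mulrA (mulrC a^-1).
rewrite ge0_integralZl//; first by rewrite ebeta.unlock.
- exact: measurable_convol_integrand.
- by move=> s _; rewrite lee_fin mulr_ge0// pw_ge0.
- by rewrite lee_fin invr_ge0 ltW.
Qed.

Lemma ebetaSE a b : 0 < a -> 0 < b ->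
  ebeta (a + 1) b = ((a / (a + b))%:E * ebeta a b)%E.
Proof.
move=> a0 b0; have := ebetaS a0 b0; move/(congr1 (fun x => a%:E * x)%E).
rewrite [in RHS]muleA -EFinM divff ?gt_eqF// mul1e => <-.
by rewrite muleA muleC muleA -EFinM mulrC.
Qed.

(** With both parameters raised by 1 the integrand is at most 1 on the unit interval; the recursion
    [ebetaSE] then carries finiteness down to [a] and [b]. *)
Lemma ebeta_lty a b : 0 < a -> 0 < b -> (ebeta a b < +oo)%E.
Proof.
move=> a0 b0.
have fin1 : (ebeta (a + 1) (b + 1) < +oo)%E.
  have -> : ebeta (a + 1) (b + 1) =
      (\int[mu]_(t in `[0%R, 1%R]) (pw (a + 1) t * pw (b + 1) (1 - t))%:E)%E.
    rewrite ebeta.unlock [RHS]integral_mkcond; apply: eq_integral => t _; rewrite patchE.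
    case: ifPn => //; rewrite mem_setE in_itv/= negb_and -!ltNge => /orP[t0|t1].
      by rewrite pw_eq0 ?mul0r// ltW.
    by rewrite (@pw_eq0 _ (b + 1)) ?mulr0// subr_le0 ltW.
  apply: (@le_lt_trans _ _ (\int[mu]_(t in `[0%R, 1%R]) (cst 1 t))%E).
    apply: ge0_le_integral => //=.
    - by move=> t _; rewrite lee_fin mulr_ge0// pw_ge0.
    - apply: measurable_funTS; apply: measurable_convol_integrand; exact: measurable_pw.
    - move=> t; rewrite in_itv/= => /andP[t0 t1]; rewrite lee_fin.
      have le1 c u : 0 < c -> 0 <= u <= 1 -> pw (c + 1) u <= 1.
        move=> c0 /andP[u0 u1]; rewrite /pw; case: ifP => // up.
        by rewrite addrK -(powRr0 u) ger_powR ?up// ltW.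
      by rewrite mulr_ile1 ?pw_ge0// le1// ?t0 ?t1// subr_ge0 t1 lerBlDr lerDl.
  by rewrite integral_cst//= lebesgue_measure_itv/= lte_fin ltr01 mul1e ltry.
have step c d : 0 < c -> 0 < d -> (ebeta (c + 1) d < +oo -> ebeta c d < +oo)%E.
  move=> c0 d0; rewrite ebetaSE//.
  case: (ebeta c d) => [x _||//]; first by rewrite ltry.
  by rewrite gt0_muley// lte_fin divr_gt0// addr_gt0.
apply: (step a b) => //; rewrite ebetaC; apply: (step b (a + 1)) => //.
  by rewrite addr_gt0.
by rewrite ebetaC.
Qed.

(** For an integer first parameter this follows from [ebeta1] by the recursion; in general, [pw a]
    dominates [pw n.+1] on the unit interval once [n.+1 > a]. *)
Lemma ebeta_gt0 a b : 0 < a -> 0 < b -> (0 < ebeta a b)%E.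
Proof.
move=> a0 b0.
have natb n : (0 < ebeta n.+1%:R b)%E.
  elim: n => [|n IHn]; first by rewrite ebeta1// lte_fin invr_gt0.
  rewrite -natr1 ebetaSE// mule_gt0// lte_fin divr_gt0// addr_gt0//.
pose n := Num.truncn a.
apply: (lt_le_trans (natb n)); rewrite ebeta.unlock; apply: ge0_le_integral => //=.
- by move=> t _; rewrite lee_fin mulr_ge0// pw_ge0.
- apply: measurable_convol_integrand; exact: measurable_pw.
- apply: measurable_convol_integrand; exact: measurable_pw.
- move=> t _; rewrite lee_fin.
  have [t1|t1] := ltP t 1; last by rewrite !(@pw_eq0 _ b) ?mulr0// subr_le0.
  rewrite ler_wpM2r ?pw_ge0// /pw; case: ifPn => // t0.
  apply: ger_powR; first by rewrite t0 ltW.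
  by rewrite lerD2r ltW// truncnS_gt.
Qed.

Definition beta a b : R := fine (ebeta a b).

Lemma ebetaE a b : 0 < a -> 0 < b -> ebeta a b = (beta a b)%:E.
Proof. by move=> a0 b0; rewrite fineK// ge0_fin_numE ?ebeta_ge0 ?ebeta_lty. Qed.

Lemma beta_gt0 a b : 0 < a -> 0 < b -> 0 < beta a b.
Proof. by move=> a0 b0; rewrite -lte_fin -ebetaE// ebeta_gt0. Qed.

Lemma betaC a b : beta a b = beta b a.
Proof. by rewrite /beta ebetaC. Qed.

Lemma betaSl a b : 0 < a -> 0 < b -> beta (a + 1) b = a / (a + b) * beta a b.
Proof.
move=> a0 b0; apply/EFin_inj; rewrite EFinM -!ebetaE ?addr_gt0//.
exact: ebetaSE.
Qed.

Lemma betaSr a b : 0 < a -> 0 < b -> beta a (b + 1) = b / (a + b) * beta a b.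
Proof. by move=> a0 b0; rewrite betaC betaSl// addrC (betaC b). Qed.

End beta.

(** * Integration against a measure given by a density *)

Section density.
Context d (T : measurableType d) (R : realType).
Variables (m nu : {measure set T -> \bar R}) (w : T -> R).
Hypotheses (mw : measurable_fun setT w) (w0 : forall x, 0 <= w x).
Hypothesis nuE : forall A, measurable A -> nu A = (\int[m]_(x in A) (w x)%:E)%E.
Local Open Scope ereal_scope.
Import HBNNSimple.

(** Monotone convergence reduces the claim to simple functions, and linearity to indicators, where
    it is [nuE]. *)
Lemma ge0_integral_density (f : T -> \bar R) :
  measurable_fun setT f -> (forall x, 0 <= f x) ->
  \int[nu]_x f x = \int[m]_x (f x * (w x)%:E).
Proof.
move=> mf f0; pose h := nnsfun_approx measurableT mf.
have -> : \int[nu]_x f x = limn (fun n => \int[nu]_x (EFin \o h n) x).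
  have fE x : f x = lim ((EFin \o h n) x @[n --> \oo]).
    by apply/esym/cvg_lim => //; exact: cvg_nnsfun_approx.
  under eq_integral do rewrite fE.
  apply: monotone_convergence => //.
  - by move=> n; apply/measurable_EFinP; exact/measurable_funP.
  - by move=> n x _ //=; rewrite lee_fin.
  - by move=> x _ a b ab; rewrite lee_fin; exact/lefP/nd_nnsfun_approx.
have -> : \int[m]_x (f x * (w x)%:E) = limn (fun n => \int[m]_x ((h n x)%:E * (w x)%:E)).
  have fE x : f x * (w x)%:E = lim (((h n x)%:E * (w x)%:E) @[n --> \oo]).
    apply/esym/cvg_lim => //; apply: cvgeZr => //.
    exact: cvg_nnsfun_approx.
  under eq_integral do rewrite fE.
  apply: monotone_convergence => //.
  - by move=> n; apply: emeasurable_funM; apply/measurable_EFinP => //; exact/measurable_funP.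
  - by move=> n x _ //=; rewrite mule_ge0// lee_fin.
  - move=> x _ a b ab; rewrite lee_wpmul2r ?lee_fin//.
    exact/lefP/nd_nnsfun_approx.
congr (limn _); apply/funext => n.
transitivity (\int[nu]_x (\sum_(y \in range (h n)) (y * \1_(h n @^-1` [set y]) x)%:E)).
  by apply: eq_integral => t tE; rewrite /= fimfunE -fsumEFin.
rewrite ge0_integral_fsum//; last 2 first.
- move=> r; apply/measurable_EFinP; exact: measurable_funM.
- by move=> r x _; exact: nnfun_muleindic_ge0.
transitivity (\int[m]_x (\sum_(y \in range (h n)) (y * \1_(h n @^-1` [set y]) x)%:E * (w x)%:E)); last first.
  apply: eq_integral => x _.
  rewrite -ge0_mule_fsuml => [|y]; last exact: nnfun_muleindic_ge0.
  by rewrite fsumEFin // -(fimfunE _ x).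
rewrite ge0_integral_fsum//; last 2 first.
- move=> r; apply: emeasurable_funM; apply/measurable_EFinP => //.
  exact: measurable_funM.
- move=> r x _; apply: mule_ge0; last by rewrite lee_fin.
  exact: nnfun_muleindic_ge0.
apply: eq_fsbigr => r rhn.
under eq_integral do rewrite EFinM.
under [RHS]eq_integral do rewrite EFinM -muleA.
have r0 : (0 <= r)%R by move: rhn; rewrite inE => -[x _ <-].
have mew : measurable_fun setT (EFin \o w) by exact/measurable_EFinP.
have mhr : measurable (h n @^-1` [set r]) by [].
rewrite !ge0_integralZl//.
- congr (_ * _); rewrite integral_indic// setIT nuE//.
  rewrite [LHS]integral_mkcond; apply: eq_integral => x _.
  by rewrite patchE indicE; case: ifP => _; rewrite ?mul1e ?mul0e.
- by apply: emeasurable_funM; exact/measurable_EFinP.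
- by move=> x _; rewrite mule_ge0// lee_fin.
- exact/measurable_EFinP.
Qed.

End density.

(** * Dirichlet's integral over the simplex *)

Section tuple_integral.
Variable R : realType.
Local Notation mu := (@lebesgue_measure R).

Lemma lebesgue_tupleS n (f : n.+1.-tuple R -> \bar R) :
  measurable_fun setT f -> (forall t, (0 <= f t)%E) ->
  (\int[lebesgue_tuple R n.+1]_t f t =
   \int[mu]_x \int[lebesgue_tuple R n]_t f (tcons (x, t)))%E.
Proof.
move=> mf f0.
rewrite [LHS]ge0_integral_pushforward//.
rewrite preimage_setT (fubini_tonelli1 (f \o @tcons R n))//.
  by apply: measurableT_comp => //; exact: measurable_tcons.
by move=> z; exact: f0.
Qed.

Lemma eq_ge0_integral_off2 (f g : R -> \bar R) (a b : R) :
  measurable_fun setT f -> measurable_fun setT g ->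
  (forall x, x != a -> x != b -> f x = g x) ->
  (\int[mu]_x f x = \int[mu]_x g x)%E.
Proof.
move=> mf mg fg.
have mD : measurable ([set: R] `\ a `\ b).
  by apply: measurableD => //; apply: measurableD.
have mD' : measurable ([set: R] `\ a) by apply: measurableD.
have off (h : R -> \bar R) : measurable_fun setT h ->
    (\int[mu]_x h x = \int[mu]_(x in [set: R] `\ a `\ b) h x)%E.
  move=> mh; rewrite integral_setD1//; last exact: measurable_funTS.
  by rewrite integral_setD1//; exact: measurable_funTS.
rewrite (off f)// (off g)//; apply: eq_integral => x.
by rewrite inE/= => -[[_ xa] xb]; apply: fg; exact/eqP.
Qed.

(** Dirichlet's constant Gamma(b0) prod_j Gamma(b j) / Gamma(b0 + sum_j b j), as a telescoping
    product of beta values. *)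
Fixpoint dconst n : R -> ('I_n -> R) -> R :=
  match n with
  | 0 => fun _ _ => 1
  | n'.+1 => fun b0 b => beta (b ord0) (b0 + \sum_(j < n') b (lift ord0 j)) *
                         dconst b0 (fun j => b (lift ord0 j))
  end.

Lemma dconst_gt0 n b0 (b : 'I_n -> R) : 0 < b0 -> (forall j, 0 < b j) ->
  0 < dconst b0 b.
Proof.
elim: n b => //= n IHn b b00 bp; rewrite mulr_gt0 ?IHn//.
by rewrite beta_gt0// ltr_wpDr// sumr_ge0// => j _; rewrite ltW.
Qed.

Lemma eq_dconst n b0 (b b' : 'I_n -> R) : b =1 b' -> dconst b0 b = dconst b0 b'.
Proof.
elim: n b b' => //= n IHn b b' bb'; congr (beta _ (_ + _) * _) => //.
  by apply: eq_bigr.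
by apply: IHn => j.
Qed.

Lemma dconst_incr0 n b0 (b : 'I_n -> R) : 0 < b0 -> (forall j, 0 < b j) ->
  dconst (b0 + 1) b = b0 / (b0 + \sum_j b j) * dconst b0 b.
Proof.
elim: n b => [|n IHn] b b00 bp /=; first by rewrite big_ord0 addr0 divff ?gt_eqF// mul1r.
set S := \sum_(j < n) _.
have S0 : 0 < b0 + S by rewrite ltr_wpDr// sumr_ge0// => j _; rewrite ltW.
rewrite IHn// -/S big_ord_recl -/S addrAC betaSr//.
have := bp ord0 => b1; rewrite [b0 + (_ + _)]addrCA; field.
by rewrite !gt_eqF// addr_gt0.
Qed.

Lemma dconst_incr n b0 (b : 'I_n -> R) i : 0 < b0 -> (forall j, 0 < b j) ->
  dconst b0 (fun j => b j + (j == i)%:R) =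
  b i / (b0 + \sum_j b j) * dconst b0 b.
Proof.
elim: n b i => [|n IHn] b i b00 bp /=; first by case: i.
have S0 (S : R) : S = \sum_(j < n) b (lift ord0 j) -> 0 < b0 + S.
  by move=> ->; rewrite ltr_wpDr// sumr_ge0// => j _; rewrite ltW.
rewrite big_ord_recl; have := bp ord0 => b1.
case: (unliftP ord0 i) => [k|] ->{i}.
  have -> : dconst b0 (fun j => b (lift ord0 j) + (lift ord0 j == lift ord0 k)%:R) =
     dconst b0 (fun j => b (lift ord0 j) + (j == k)%:R).
    by apply: eq_dconst => j; rewrite (inj_eq lift_inj).
  rewrite IHn//.
  have -> : \sum_(j < n) (b (lift ord0 j) + (lift ord0 j == lift ord0 k)%:R) =
      \sum_(j < n) b (lift ord0 j) + 1.
    rewrite big_split/=; congr (_ + _).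
    rewrite (bigD1 k)//= eqxx big1 ?addr0// => j jk.
    by rewrite (inj_eq lift_inj) (negPf jk).
  set S := \sum_(j < n) _; have {}S0 := S0 _ (erefl S).
  rewrite addr0 [b0 + (S + 1)]addrA betaSr// [b0 + (_ + _)]addrCA; field.
  by rewrite !gt_eqF// addr_gt0.
have -> : dconst b0 (fun j => b (lift ord0 j) + (lift ord0 j == ord0)%:R) =
   dconst b0 (fun j => b (lift ord0 j)).
  by apply: eq_dconst => j; rewrite addr0.
have -> : \sum_(j < n) (b (lift ord0 j) + (lift ord0 j == ord0)%:R) =
    \sum_(j < n) b (lift ord0 j).
  by apply: eq_bigr => j _; rewrite addr0.
set S := \sum_(j < n) _; have {}S0 := S0 _ (erefl S).
by rewrite eqxx betaSl// [b0 + (_ + _)]addrCA mulrA.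
Qed.

(** Fixing the first coordinate at [x] leaves the same integral with one coordinate fewer and total
    mass [r - x], so each step of the induction is one convolution. The factors are only required to
    agree with [pw] off 0, since real powers may take another value at 0. *)
Lemma integral_simplex n (b0 : R) (b : 'I_n -> R) (g0 : R -> R) (g : 'I_n -> R -> R) r :
  0 < b0 -> (forall j, 0 < b j) ->
  measurable_fun setT g0 -> (forall j, measurable_fun setT (g j)) ->
  (forall t, 0 <= g0 t) -> (forall j t, 0 <= g j t) ->
  (forall t, t != 0 -> g0 t = pw b0 t) ->
  (forall j t, t != 0 -> g j t = pw (b j) t) -> r != 0 ->
  (\int[lebesgue_tuple R n]_t
     (g0 (r - \sum_(j < n) tnth t j) * \prod_(j < n) g j (tnth t j))%:E =
   (dconst b0 b * pw (b0 + \sum_j b j) r)%:E)%E.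
Proof.
move=> b00 bp mg0 mg g00 gp g0E gE r0.
have mS k (h : R -> R) r' : measurable_fun setT h -> measurable_fun setT
    (fun t : k.-tuple R => h (r' - \sum_(j < k) tnth t j)).
  move=> mh; apply: measurableT_comp => //; apply: measurable_funB => //.
  by apply: measurable_sum => j; exact: measurable_tnth.
elim: n b g bp mg gp gE r r0 => [|n IHn] b g bp mg gp gE r r0.
  rewrite integral_dirac//.
    by rewrite diracE mem_set// mul1e/= !big_ord0 subr0 mulr1 mul1r addr0 g0E.
  apply/measurable_EFinP; apply: measurable_funM; first exact: mS.
  by apply: measurable_prod => j _; apply: measurableT_comp => //; exact: measurable_tnth.
pose F (t : n.+1.-tuple R) : \bar R :=
  (g0 (r - \sum_(j < n.+1) tnth t j) * \prod_(j < n.+1) g j (tnth t j))%:E.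
have mF : measurable_fun setT F.
  apply/measurable_EFinP; apply: measurable_funM; first exact: mS.
  apply: measurable_prod => j _; apply: measurableT_comp => //.
  exact: measurable_tnth.
have F0 t : (0 <= F t)%E by rewrite lee_fin mulr_ge0// prodr_ge0.
rewrite (lebesgue_tupleS mF F0).
set b' := fun j => b (lift ord0 j).
transitivity (\int[mu]_x ((dconst b0 b')%:E *
   (pw (b ord0) x * pw (b0 + \sum_j b' j) (r - x))%:E))%E.
  (* At [x = 0] the factor may differ from [pw], and at [x = r] the induction hypothesis would be
     applied at total mass 0. *)
  apply: (@eq_ge0_integral_off2 _ _ 0 r).
  - apply: (measurable_fun_fubini_tonelli_F (F \o @tcons R n)).
      by apply: measurableT_comp => //; exact: measurable_tcons.
    by move=> z; exact: F0.
  - apply: emeasurable_funM => //.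
    apply: measurable_convol_integrand; exact: measurable_pw.
  - move=> x x0 xr.
    have rx : r - x != 0 by rewrite subr_eq0 eq_sym.
    transitivity (\int[lebesgue_tuple R n]_t ((g ord0 x)%:E *
      (g0 (r - x - \sum_(j < n) tnth t j) *
       \prod_(j < n) g (lift ord0 j) (tnth t j))%:E))%E.
      apply: eq_integral => t _; rewrite -EFinM /F !big_ord_recl/=.
      rewrite (tnth_nth 0)/=; congr EFin.
      have tE j : tnth (tcons (x, t)) (lift ord0 j) = tnth t j.
        by rewrite !(tnth_nth 0).
      under eq_bigr do rewrite tE; under [X in _ * (_ * X)]eq_bigr do rewrite tE.
      by rewrite opprD addrA mulrCA.
    rewrite ge0_integralZl//; last 3 first.
    - apply/measurable_EFinP; apply: measurable_funM; first exact: mS.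
      apply: measurable_prod => j _; apply: measurableT_comp => //.
      exact: measurable_tnth.
    - by move=> t _; rewrite lee_fin mulr_ge0// prodr_ge0.
    - by rewrite lee_fin.
    have -> := IHn b' (fun j => g (lift ord0 j)) (fun j => bp _) (fun j => mg _)
      (fun j => gp _) (fun j => gE _) _ rx.
    by rewrite -!EFinM gE// mulrCA.
rewrite ge0_integralZl//; last 3 first.
- apply: measurable_convol_integrand; exact: measurable_pw.
- by move=> x _; rewrite lee_fin mulr_ge0// pw_ge0.
- by rewrite lee_fin ltW// dconst_gt0// => j; exact: bp.
have := convol_pw (b ord0) (b0 + \sum_j b' j) r; rewrite /convol => ->.
have S0 : 0 < b0 + \sum_j b' j.
  by rewrite ltr_wpDr// sumr_ge0// => j _; rewrite ltW// bp.
rewrite ebetaE// -!EFinM /= big_ord_recl -/b' mulrA; congr (_ * pw _ _)%:E.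
  by rewrite mulrC.
by rewrite addrCA.
Qed.

End tuple_integral.

(** * Moments of the Dirichlet law *)

Section dirichlet_moments.
Variables (R : realType) (V : finType).
Hypothesis V_gt0 : (0 < #|V|)%N.
Implicit Types (eta : state R V) (f g : state R V -> R) (b : V -> R) (m : V -> nat).

Definition mono m eta : R := \prod_x coord eta x ^+ m x.

Let eN : #|V|.-1.+1 = #|V| := prednK V_gt0.
Let e (i : 'I_#|V|.-1.+1) : V := enum_val (cast_ord eN i).

Let e_bij : bijective e.
Proof.
exists (fun x => cast_ord (esym eN) (enum_rank x)) => x.
  by rewrite enum_valK cast_ordK.
by rewrite /e cast_ordKV enum_rankK.
Qed.

Let big_e (T : Type) (idx : T) (op : Monoid.com_law idx) (F : V -> T) :
  \big[op/idx]_x F x = op (F (e ord0)) (\big[op/idx]_(j < #|V|.-1) F (e (lift ord0 j))).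
Proof. by rewrite (reindex e) ?big_ord_recl//; exact: onW_bij. Qed.

(** The total mass of the unnormalized Dirichlet density with parameters [b]; the vertex [e ord0] is
    the coordinate that [simplex_chart] expresses through the others. *)
Definition dir_mass b : R :=
  dconst (b (e ord0)) (fun j => b (e (lift ord0 j))).

Lemma dir_mass_gt0 b : (forall x, 0 < b x) -> 0 < dir_mass b.
Proof. by move=> b0; exact: dconst_gt0. Qed.

Lemma eq_dir_mass b b' : b =1 b' -> dir_mass b = dir_mass b'.
Proof. by move=> bb'; rewrite /dir_mass bb'; apply: eq_dconst => j. Qed.

Lemma dir_mass_incr b x : (forall x, 0 < b x) ->
  dir_mass (fun y => b y + (y == x)%:R) = b x / (\sum_y b y) * dir_mass b.
Proof.
move=> b0; rewrite (big_e _ b) /= /dir_mass.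
have [i ->] : exists i, x = e i.
  by have [e' _ e'K] := e_bij; exists (e' x); rewrite e'K.
have ei j k : (e j == e k) = (j == k) by rewrite (inj_eq (bij_inj e_bij)).
rewrite ei; case: (unliftP ord0 i) => [k|] ->{i}.
  rewrite addr0 -dconst_incr//; apply: eq_dconst => j.
  by rewrite ei (inj_eq lift_inj).
rewrite eqxx -dconst_incr0//; apply: eq_dconst => j.
by rewrite ei addr0.
Qed.

Lemma coord_chart t i : coord (simplex_chart t : state R V) (e i) =
  nth 0 (1 - \sum_(j < #|V|.-1) tnth t j :: t) i.
Proof. by rewrite /coord tnth_mktuple /e enum_valK. Qed.

Lemma sum_coord_chart t : \sum_x coord (simplex_chart t : state R V) x = 1.
Proof.
rewrite (big_e _ (coord _)) /= coord_chart/=.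
have -> : \sum_(j < #|V|.-1) coord (simplex_chart t) (e (lift ord0 j)) =
    \sum_(j < #|V|.-1) tnth t j.
  by apply: eq_bigr => j _; rewrite coord_chart/= -tnth_nth.
by rewrite subrK.
Qed.

(** The indicator of the simplex is absorbed into the factors: [G] cuts each [phi x] off at negative
    arguments, while the coordinates of the chart sum to 1 automatically. *)
Lemma integral_simplex_measure b (phi : V -> R -> R) : (forall x, 0 < b x) ->
  (forall x, measurable_fun setT (phi x)) -> (forall x t, 0 <= phi x t) ->
  (forall x t, 0 < t -> phi x t = pw (b x) t) ->
  (\int[@simplex_measure R V]_eta (\prod_x phi x (coord eta x))%:E =
   (dir_mass b)%:E)%E.
Proof.
move=> b0 mphi phi0 phiE.
have mprod : measurable_fun setT (fun eta => \prod_x phi x (coord eta x)).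
  apply: measurable_prod => x _; apply: measurableT_comp => //.
  exact: measurable_coord.
pose w eta : R := \1_(@Omega R V) eta.
have mw : measurable_fun setT w by apply: measurable_indic; exact: measurable_Omega.
rewrite (@ge0_integral_density _ _ _
   (image_measure (lebesgue_tuple R #|V|.-1) (@simplex_chart R V)) _ w)//; first last.
- by move=> eta; rewrite lee_fin prodr_ge0.
- exact/measurable_EFinP.
- move=> A mA; transitivity (\int[image_measure (lebesgue_tuple R #|V|.-1)
      (@simplex_chart R V)]_x (\1_(A `&` @Omega R V) x)%:E)%E.
    rewrite integral_indic ?setIT//.
    by apply: measurableI => //; exact: measurable_Omega.
  rewrite [RHS]integral_mkcond; apply: eq_integral => eta _.
  by rewrite patchE /w !indicE in_setI; case: (eta \in A).
rewrite ge0_integral_pushforward//; last 2 first.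
- by apply: emeasurable_funM; exact/measurable_EFinP.
- by move=> eta _; rewrite -EFinM lee_fin mulr_ge0// prodr_ge0.
rewrite preimage_setT.
pose G x t : R := if 0 <= t then phi x t else 0.
have mG x : measurable_fun setT (G x).
  by apply: measurable_fun_ifT => //; exact: measurable_fun_ler.
have G0 x t : 0 <= G x t by rewrite /G; case: ifP.
have GE x t : t != 0 -> G x t = pw (b x) t.
  move=> tn0; case: (ltgtP 0 t) => [t0|t0|t0].
  - by rewrite /G ltW// phiE.
  - by rewrite /G leNgt t0/= pw_eq0// ltW.
  - by move: tn0; rewrite -t0 eqxx.
have := @integral_simplex R #|V|.-1 (b (e ord0)) (fun j => b (e (lift ord0 j)))
   (G (e ord0)) (fun j => G (e (lift ord0 j))) 1 (b0 _) (fun j => b0 _) (mG _)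
   (fun j => mG _) (G0 _) (fun j => G0 _) (GE _) (fun j => GE _) (oner_neq0 _).
rewrite pw_at1 mulr1 => <-; apply: eq_integral => t _ /=.
rewrite -EFinM; congr EFin.
transitivity (\prod_x G x (coord (simplex_chart t : state R V) x)).
  rewrite /w indicE; have [etaO|nO] := boolP (simplex_chart t \in @Omega R V).
    move: etaO; rewrite inE => -[eta0 _].
    by rewrite mulr1; apply: eq_bigr => x _; rewrite /G eta0.
  rewrite mulr0; apply/esym/eqP/prodf_eq0.
  have [x xlt] : exists x, ~~ (0 <= coord (simplex_chart t : state R V) x).
    apply/existsP; rewrite -negb_forall; apply/negP => /forallP ge0.
    by move: nO; rewrite notin_setE; apply; split=> //; exact: sum_coord_chart.
  by exists x => //; rewrite /G (negPf xlt).
rewrite (big_e _ (fun x => G x _)) /= coord_chart/=.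
by congr (_ * _); apply: eq_bigr => j _; rewrite coord_chart/= -tnth_nth.
Qed.

Variable alpha : V -> R.
Hypothesis alpha_gt0 : forall x, 0 < alpha x.

Lemma measurable_dirichlet_weight : measurable_fun setT (@dirichlet_weight R V alpha).
Proof.
apply: measurable_prod => x _.
exact: (measurableT_comp (measurable_powR _) (measurable_coord x)).
Qed.

Lemma dirichlet_weight_ge0 eta : 0 <= dirichlet_weight alpha eta.
Proof. by rewrite prodr_ge0// => x _; exact: powR_ge0. Qed.

Lemma measurable_mono m : measurable_fun setT (mono m).
Proof.
by apply: measurable_prod => x _; apply: measurable_funX; exact: measurable_coord.
Qed.

(** The absolute value makes the integrand nonnegative on the whole ambient space, as the preceding
    integration lemmas demand; on the simplex it changes nothing. *)
Lemma integral_density_mono m :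
  (\int[dirichlet_density alpha]_eta `|mono m eta|%:E =
   (dir_mass (fun x => alpha x + (m x)%:R))%:E)%E.
Proof.
rewrite (@ge0_integral_density _ _ _ (@simplex_measure R V) _ (dirichlet_weight alpha))//.
- rewrite -(@integral_simplex_measure _ (fun x t => t `^ (alpha x - 1) * `|t| ^+ m x)).
  + apply: eq_integral => eta _; rewrite -EFinM /mono normr_prod mulrC -big_split.
    by congr EFin; apply: eq_bigr => x _; rewrite normrX.
  + by move=> x; rewrite ltr_wpDr.
  + move=> x; apply: measurable_funM; first exact: measurable_powR.
    by apply: measurable_funX; exact: normr_measurable.
  + by move=> x t; rewrite mulr_ge0 ?powR_ge0// exprn_ge0.
  + by move=> x t t0; rewrite gtr0_norm// -pwX /pw t0.
- exact: measurable_dirichlet_weight.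
- exact: dirichlet_weight_ge0.
- apply/measurable_EFinP; apply: measurableT_comp => //; exact: measurable_mono.
Qed.

Lemma dirichlet_density_total :
  dirichlet_density alpha setT = (dir_mass alpha)%:E.
Proof.
have := integral_density_mono (fun=> 0%N).
have -> : (\int[dirichlet_density alpha]_eta `|mono (fun=> 0%N) eta|%:E =
    \int[dirichlet_density alpha]_eta (cst 1 eta))%E.
  by apply: eq_integral => eta _; rewrite /mono big1// normr1.
rewrite integral_cst// mul1e => ->.
by congr EFin; apply: eq_dir_mass => x; rewrite addr0.
Qed.

Lemma ge0_integral_dirichlet (f : state R V -> \bar R) :
  measurable_fun setT f -> (forall eta, (0 <= f eta)%E) ->
  (\int[dirichlet alpha]_eta f eta =
   (dir_mass alpha)^-1%:E * \int[dirichlet_density alpha]_eta f eta)%E.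
Proof.
move=> mf f0; have Z0 := dir_mass_gt0 alpha_gt0.
have Z0' : 0 <= (dir_mass alpha)^-1 by rewrite invr_ge0 ltW.
rewrite -(ge0_integral_mscale (dirichlet_density alpha) measurableT (NngNum Z0'))//.
apply: eq_measure_integral => A mA _ /=.
rewrite /dirichlet/= /mnormalize /= dirichlet_density_total/= eqe gt_eqF//=.
by rewrite /mscale/= muleC.
Qed.

Lemma dirichlet_Omega : dirichlet alpha (~` @Omega R V) = 0%E.
Proof.
have mO := @measurable_Omega R V.
have dO : dirichlet_density alpha (~` @Omega R V) = 0%E.
  rewrite /dirichlet_density null_set_integral//.
  - exact: measurableC.
  - apply: measurable_funTS; apply/measurable_EFinP.
    exact: measurable_dirichlet_weight.
  - transitivity (image_measure (lebesgue_tuple R #|V|.-1) (@simplex_chart R V)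
      (~` @Omega R V `&` @Omega R V)); first by [].
    by rewrite setICl measure0.
have mC : measurable (~` @Omega R V) by exact: measurableC.
have := @ge0_integral_dirichlet (EFin \o \1_(~` @Omega R V)).
rewrite !integral_indic ?setIT// => ->.
- by rewrite [X in (_ * X)%E]dO mule0.
- by apply/measurable_EFinP/measurable_indic.
- by move=> eta; rewrite lee_fin.
Qed.

Lemma integral_dirichlet_mono m :
  (\int[dirichlet alpha]_eta `|mono m eta|%:E =
   (dir_mass (fun x => alpha x + (m x)%:R) / dir_mass alpha)%:E)%E.
Proof.
rewrite ge0_integral_dirichlet//; last first.
  by apply/measurable_EFinP; apply: measurableT_comp => //; exact: measurable_mono.
by rewrite integral_density_mono -EFinM mulrC.
Qed.

End dirichlet_moments.

(** * Integrals against the jump kernel *)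

Section weighted_integral.
Variable R : realType.
Implicit Types (a u : R) (f g : R -> R) (q F : {poly R}).
Local Notation mu := (@lebesgue_measure R).
Local Notation I := (`[0, 1[%classic : set R).

(** The end [u = 1] is left out because the integrands of interest carry the factor [(1 - u)^-1]. *)
Definition wint a f : R := \int[mu]_(u in I) (u `^ (a - 1) * f u).

Definition bounded01 f :=
  measurable_fun I f /\ exists C, forall u, 0 <= u < 1 -> `|f u| <= C.

Lemma bounded01D f g : bounded01 f -> bounded01 g -> bounded01 (fun u => f u + g u).
Proof.
move=> [mf [C fC]] [mg [D gD]]; split; first exact: measurable_funD.
by exists (C + D) => u u01; rewrite (le_trans (ler_normD _ _))// lerD ?fC ?gD.
Qed.

Lemma bounded01Z k f : bounded01 f -> bounded01 (fun u => k * f u).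
Proof.
move=> [mf [C fC]]; split; first exact: measurable_funM.
by exists (`|k| * C) => u u01; rewrite normrM ler_wpM2l// fC.
Qed.

Lemma eq_bounded01 f g : (forall u, 0 <= u < 1 -> f u = g u) ->
  bounded01 f -> bounded01 g.
Proof.
move=> fg [mf [C fC]]; split; last by exists C => u u01; rewrite -fg// fC.
by apply: eq_measurable_fun mf => u; rewrite inE/= in_itv/= => /fg.
Qed.

Lemma bounded01_horner q : bounded01 (fun u => q.[u]).
Proof.
split.
  apply: measurable_funTS; apply: continuous_measurable_fun => u.
  exact: continuous_horner.
exists (\sum_(i < size q) `|q`_i|) => u /andP[u0 u1].
rewrite horner_coef (le_trans (ler_norm_sum _ _ _))// ler_sum// => i _.
by rewrite normrM ler_piMr// normrX exprn_ile1// ger0_norm// ltW.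
Qed.

Lemma integrable_powRB1 a : 0 < a -> mu.-integrable I (fun u => (u `^ (a - 1))%:E).
Proof.
move=> a0.
have mp : measurable_fun I (fun u => (u `^ (a - 1))%:E).
  by apply/measurable_EFinP; apply: measurable_funTS; exact: measurable_powR.
apply/integrableP; split => //.
under eq_integral do rewrite gee0_abs ?lee_fin ?powR_ge0//.
have := @integral_itv_bndoo R 0 1 (fun u => (u `^ (a - 1))%:E) true true.
move=> ->; last by apply: measurable_funS mp => // u /=; rewrite !in_itv/= => /andP[/ltW -> ->].
by rewrite integral_oo0_powRB1// ltry.
Qed.

Lemma integrable_wint a f : 0 < a -> bounded01 f ->
  mu.-integrable I (EFin \o (fun u => u `^ (a - 1) * f u)).
Proof.
move=> a0 [mf [C fC]].
have mp : measurable_fun I (fun u => u `^ (a - 1)).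
  by apply: measurable_funTS; exact: measurable_powR.
have mI : measurable (I : set (measurableTypeR R)) by exact: measurable_itv.
have iC := integrableZr mI C (integrable_powRB1 a0).
apply: le_integrable iC => //.
  by apply/measurable_EFinP; exact: measurable_funM.
move=> u /=; rewrite in_itv/= => u01; rewrite lee_fin !normrM ler_wpM2l//.
by rewrite (le_trans (fC _ u01))// ler_norm.
Qed.

Lemma wintD a f g : 0 < a -> bounded01 f -> bounded01 g ->
  wint a (fun u => f u + g u) = wint a f + wint a g.
Proof.
move=> a0 bf bg; rewrite /wint -RintegralD//; try exact: integrable_wint.
by apply: eq_Rintegral => u _; rewrite mulrDr.
Qed.

Lemma wintZ a k f : 0 < a -> bounded01 f ->
  wint a (fun u => k * f u) = k * wint a f.
Proof.
move=> a0 bf; rewrite /wint -RintegralZl//; last exact: integrable_wint.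
by apply: eq_Rintegral => u _; rewrite mulrCA.
Qed.

Lemma eq_wint a f g : (forall u, 0 <= u < 1 -> f u = g u) -> wint a f = wint a g.
Proof.
by move=> fg; apply: eq_Rintegral => u; rewrite inE/= in_itv/= => /fg ->.
Qed.

Lemma le_wint a f g : 0 < a -> bounded01 f -> bounded01 g ->
  (forall u, 0 <= u < 1 -> f u <= g u) -> wint a f <= wint a g.
Proof.
move=> a0 bf bg fg; apply: le_Rintegral => //; try exact: integrable_wint.
by move=> u /=; rewrite in_itv/= => u01; rewrite ler_wpM2l ?powR_ge0// fg.
Qed.

Lemma wint_powR a : 0 < a -> wint a (fun=> 1) = a^-1.
Proof.
move=> a0; rewrite /wint /Rintegral.
under eq_integral do rewrite mulr1.
rewrite (@integral_itv_bndoo R 0 1 (fun u => (u `^ (a - 1))%:E) true true).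
  by rewrite integral_oo0_powRB1//= powR1 mul1r.
by apply/measurable_EFinP; apply: measurable_funTS; exact: measurable_powR.
Qed.

Lemma wintX a k f : 0 < a -> bounded01 f ->
  wint a (fun u => u ^+ k * f u) = wint (a + k%:R) f.
Proof.
move=> a0 [mf _]; rewrite /wint /Rintegral; congr fine.
have moo (g : R -> R) : measurable_fun I g -> measurable_fun (`]0, 1[%classic : set R) g.
  by apply: measurable_funS => // u /=; rewrite !in_itv/= => /andP[/ltW -> ->].
have mp b : measurable_fun (`]0, 1[%classic : set R) (fun u => u `^ (b - 1)).
  by apply: measurable_funTS; exact: measurable_powR.
(* The powers combine only for [u != 0], so the point 0 is removed on both sides. *)
rewrite [LHS](@integral_itv_bndoo R 0 1 _ true true); last first.
  apply/measurable_EFinP; apply: measurable_funM => //.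
  by apply: measurable_funM; [exact: measurable_funX|exact: moo].
rewrite [RHS](@integral_itv_bndoo R 0 1 _ true true); last first.
  by apply/measurable_EFinP; apply: measurable_funM => //; exact: moo.
apply: eq_integral => u; rewrite inE/= in_itv/= => /andP[u0 _].
congr EFin; rewrite mulrA -powR_mulrn ?ltW// -powRD; last first.
  by rewrite (gt_eqF u0) implybT.
by congr (_ `^ _ * _); ring.
Qed.

Definition rising a n : R := \prod_(i < n) (a + i%:R).

Lemma rising_gt0 a n : 0 < a -> 0 < rising a n.
Proof. by move=> a0; rewrite prodr_gt0// => i _; rewrite ltr_wpDr. Qed.

Lemma risingS a n : rising a n.+1 = rising a n * (a + n%:R).
Proof. by rewrite /rising big_ord_recr. Qed.

Lemma risingSl a n : rising a n.+1 = a * rising (a + 1) n.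
Proof.
rewrite /rising big_ord_recl addr0; congr (_ * _); apply: eq_bigr => i _.
by rewrite -addrA nat1r.
Qed.

Lemma bounded01_onem j : bounded01 (fun u => (1 - u) ^+ j).
Proof.
apply: eq_bounded01 (bounded01_horner ((1 - 'X) ^+ j)) => u _.
by rewrite horner_exp !hornerE.
Qed.

(** A beta integral with one integer parameter; the induction uses (1 - u)^(j+1) = (1 - u)^j - u (1
    - u)^j, the factor [u] being absorbed by [wintX]. *)
Lemma wint_onem a j : 0 < a -> wint a (fun u => (1 - u) ^+ j) = j`!%:R / rising a j.+1.
Proof.
elim: j a => [|j IHj] a a0.
  by rewrite wint_powR// risingS /rising big_ord0 !mul1r addr0.
have b1 := bounded01_onem j.
have bX : bounded01 (fun u => u ^+ 1 * (1 - u) ^+ j).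
  apply: eq_bounded01 (bounded01_horner ('X * (1 - 'X) ^+ j)) => u _.
  by rewrite !hornerE expr1.
transitivity (wint a (fun u => (1 - u) ^+ j + -1 * (u ^+ 1 * (1 - u) ^+ j))).
  by apply: eq_wint => u _; rewrite expr1 exprS; ring.
rewrite wintD//; last exact: bounded01Z.
rewrite wintZ// wintX// !IHj ?addr_gt0// factS natrM.
rewrite [rising a j.+2]risingSl [rising a j.+1]risingSl ![rising (a + 1) j.+1]risingS.
have r0 : rising (a + 1) j != 0 by rewrite gt_eqF// rising_gt0// addr_gt0.
have := a0; rewrite -natr1 => {}a0; field.
by rewrite r0 !gt_eqF// -?addrA ltr_wpDr// addr_ge0.
Qed.

Lemma diff_quotient q : exists p, forall u, q.[u] - q.[1] = p.[u] * (u - 1).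
Proof.
have /factor_theorem[p pE] : root (q - q.[1]%:P) 1.
  by rewrite /root hornerD hornerN hornerC subrr.
by exists p => u; have := congr1 (horner^~ u) pE; rewrite !hornerE.
Qed.

(* Integral against the jump kernel; dividing out [1 - u] makes it converge. *)
Definition gint a q : R := wint a (fun u => (1 - u)^-1 * (q.[u] - q.[1])).

Lemma bounded01_gint q : bounded01 (fun u => (1 - u)^-1 * (q.[u] - q.[1])).
Proof.
have [p pE] := diff_quotient q.
apply: eq_bounded01 (bounded01_horner (- p)) => u /andP[_ u1].
rewrite pE hornerN -(opprB 1 u) !mulrN mulrCA mulVf ?mulr1//.
by rewrite subr_eq0 gt_eqF.
Qed.

Lemma gintE a q : 0 < a ->
  \int[mu]_(u in `[0, 1]) (u `^ (a - 1) * (1 - u)^-1 * (q.[u] - q.[1])) = gint a q.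
Proof.
move=> a0; rewrite -Rintegral_itv_bndo_bndc.
  by apply: eq_Rintegral => u _; rewrite mulrA.
apply: eq_integrable (integrable_wint a0 (bounded01_gint q)) => // u _ /=.
by rewrite mulrA.
Qed.

Lemma gintD a p q : 0 < a -> gint a (p + q) = gint a p + gint a q.
Proof.
move=> a0; rewrite /gint -wintD//; try exact: bounded01_gint.
by apply: eq_wint => u _; rewrite !hornerD -mulrDr; congr (_ * _); ring.
Qed.

Lemma gintZ a k q : 0 < a -> gint a (k *: q) = k * gint a q.
Proof.
move=> a0; rewrite /gint -wintZ//; last exact: bounded01_gint.
by apply: eq_wint => u _; rewrite !hornerZ; ring.
Qed.

Lemma gintC a k : 0 < a -> gint a k%:P = 0.
Proof.
move=> a0; have := @gintZ a 0 k%:P a0; rewrite mul0r => <-.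
by apply: eq_wint => u _; rewrite !hornerZ !hornerC !subrr.
Qed.

(** Equivalence of norms on polynomials of size at most [K]: inverting a Vandermonde matrix recovers
    the coefficients from the values at [K] equally spaced nodes of the unit interval, so [C]
    depends on [K] only. *)
Lemma poly_coef_bound K : exists2 C : R, 0 <= C & forall F B, (size F <= K)%N ->
  (forall u, 0 <= u <= 1 -> `|F.[u]| <= B) -> forall i, `|F`_i| <= C * B.
Proof.
case: K => [|K].
  exists 0 => // F B; rewrite leqn0 size_poly_eq0 => /eqP -> _ i.
  by rewrite coef0 normr0 mul0r.
pose t : 'rV[R]_K.+1 := \row_j (j%:R / K.+1%:R).
pose W := Vandermonde K.+1 t.
have Wu : W \in unitmx.
  rewrite unitmxE det_Vandermonde unitfE; apply/prodf_neq0 => i _.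
  apply/prodf_neq0 => j ij; rewrite !mxE -mulrBl mulf_neq0 ?invr_eq0 ?pnatr_eq0//.
  by rewrite subr_eq0 eqr_nat gtn_eqF.
pose C := \sum_i \sum_j `|invmx W i j|.
have C0 : 0 <= C by apply: sumr_ge0 => i _; apply: sumr_ge0.
exists C => // F B sF FB i.
have B0 : 0 <= B by apply: le_trans (FB 0 _); rewrite ?lexx ?ler01.
have [iK|iK] := leqP K.+1 i.
  by rewrite nth_default ?normr0 ?mulr_ge0// (leq_trans sF).
pose v : 'rV[R]_K.+1 := \row_j F`_j.
have vW j : (v *m W) 0 j = F.[t 0 j].
  by rewrite (horner_coef_wide _ sF) mxE; apply: eq_bigr => k _; rewrite !mxE.
have -> : F`_i = (v *m W *m invmx W) 0 (Ordinal iK) by rewrite mulmxK// mxE.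
rewrite mxE (le_trans (ler_norm_sum _ _ _))// /C mulr_suml ler_sum// => j _.
rewrite normrM mulrC ler_pM//.
  by rewrite (bigD1 (Ordinal iK))//= lerDl sumr_ge0.
rewrite vW FB// mxE divr_ge0//= ler_pdivrMr// mul1r ler_nat ltnW//.
Qed.

Lemma subr1_expr_le u j : 0 <= u <= 1 -> 0 <= 1 - u ^+ j <= j%:R * (1 - u).
Proof.
move=> /andP[u0 u1]; rewrite subr_ge0 exprn_ile1//=.
elim: j => [|j IHj]; first by rewrite expr0 subrr mul0r.
have uj : 0 <= u ^+ j <= 1 by rewrite exprn_ge0// exprn_ile1.
rewrite exprS -natr1; nra.
Qed.

(** This cuts the singularity of the kernel. Split F(1) - F(u) with the weights u^m and 1 - u^m. In
    the first part the coefficient bound gives a Lipschitz estimate, at the cost [C * B / (a + m)],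
    small for large [m]. In the second part F(u) >= 0 and 1 - u^m <= m (1 - u) leave a multiple of
    F(1), as for a kernel of mass at most m / a. *)
Lemma gint_ge K : exists2 C : R, 0 <= C & forall a m F B, 0 < a ->
  (size F <= K)%N -> (forall u, 0 <= u <= 1 -> 0 <= F.[u] <= B) ->
  - (C * B / (a + m%:R) + m%:R * F.[1] / a) <= gint a F.
Proof.
have [C C0 CP] := poly_coef_bound K.
exists (C * \sum_(i < K) i%:R).
  by rewrite mulr_ge0// sumr_ge0.
move=> a m F B a0 sF FB.
have FB' u : 0 <= u <= 1 -> `|F.[u]| <= B.
  by move=> u01; have /andP[F0 F1] := FB _ u01; rewrite ger0_norm.
have B0 : 0 <= B by apply: le_trans (FB' 0 _); rewrite ?lexx ?ler01.
have cF := CP F B sF FB'.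
set A := C * (\sum_(i < K) i%:R) * B.
have A0 : 0 <= A by rewrite /A !mulr_ge0// sumr_ge0.
have lip u : 0 <= u <= 1 -> F.[1] - F.[u] <= A * (1 - u).
  move=> u01; rewrite !(horner_coef_wide _ sF) -sumrB.
  have -> : A * (1 - u) = \sum_(i < K) C * B * (i%:R * (1 - u)).
    by rewrite -mulr_sumr -mulr_suml /A; ring.
  rewrite ler_sum// => i _.
  rewrite expr1n -mulrBr.
  have /andP[h1 h2] := subr1_expr_le i u01.
  have := cF i => hi.
  have h3 : F`_i <= C * B by rewrite (le_trans (ler_norm _)).
  have CB0 : 0 <= C * B by rewrite mulr_ge0.
  nra.
have b1 : bounded01 (fun=> 1) by apply: eq_bounded01 (bounded01_horner 1) => u _; rewrite hornerC.
have bXm : bounded01 (fun u => u ^+ m * 1).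
  by apply: eq_bounded01 (bounded01_horner ('X^m)) => u _; rewrite hornerXn mulr1.
have -> : - (A / (a + m%:R) + m%:R * F.[1] / a) =
    wint a (fun u => - A * (u ^+ m * 1) + (- (m%:R * F.[1])) * 1).
  rewrite wintD//; try exact: bounded01Z.
  rewrite !wintZ// wintX// !wint_powR ?ltr_wpDr//.
  by rewrite opprD !mulNr.
apply: le_wint => //.
- by apply: bounded01D; exact: bounded01Z.
- exact: bounded01_gint.
move=> u /andP[u0 u1].
have u01 : 0 <= u <= 1 by rewrite u0 ltW.
have := lip u u01 => l1.
have /andP[Fu _] := FB _ u01.
have /andP[h1 h2] := subr1_expr_le m u01.
have /andP[F10 _] : 0 <= F.[1] <= B by apply: FB; rewrite ler01 lexx.
have um : 0 <= u ^+ m by rewrite exprn_ge0.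
rewrite [leRHS]mulrC ler_pdivlMr ?subr_gt0//.
have m0 : 0 <= (m%:R : R) by [].
move: (u ^+ m) (m%:R : R) F.[1] F.[u] h1 h2 F10 um m0 l1 Fu => w n b c h1 h2 b0 w0 n0 l1 c0.
rewrite !mulr1.
have v0 : 0 < 1 - u by rewrite subr_gt0.
(* If F(u) >= F(1) the integrand is nonnegative and nothing has to be cut. *)
have [X0|X0] := leP (b - c) 0.
  have := mulr_ge0 (mulr_ge0 A0 w0) (ltW v0).
  have := mulr_ge0 (mulr_ge0 n0 b0) (ltW v0).
  nra.
have i1 : w * (b - c) <= w * (A * (1 - u)) by rewrite ler_wpM2l.
have i2 : (1 - w) * (b - c) <= (1 - w) * b by rewrite ler_wpM2l// lerBlDr lerDl.
have i3 : (1 - w) * b <= n * (1 - u) * b by rewrite ler_wpM2r.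
lra.
Qed.

End weighted_integral.

(** * Quadratic forms *)

Section quadratic_forms.
Variables (R : realType) (V : finType).
Implicit Types (psi A B : V -> V -> R) (xi zeta phi : V -> R).

Definition symm psi := forall x y, psi x y = psi y x.

Definition bil psi xi zeta : R := \sum_x \sum_y psi x y * xi x * zeta y.

Definition quad psi xi : R := bil psi xi xi.

Definition psd psi := forall xi, 0 <= quad psi xi.

Definition delta (x y : V) : R := (x == y)%:R.

Lemma sum_delta x (f : V -> R) : \sum_y f y * delta x y = f x.
Proof.
rewrite (bigD1 x)//= /delta eqxx mulr1 big1 ?addr0// => y yx.
by rewrite eq_sym (negPf yx) mulr0.
Qed.

Lemma bilDl psi xi xi' zeta :
  bil psi (fun x => xi x + xi' x) zeta = bil psi xi zeta + bil psi xi' zeta.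
Proof.
rewrite /bil -big_split; apply: eq_bigr => x _; rewrite -big_split.
by apply: eq_bigr => y _; rewrite mulrDr mulrDl.
Qed.

Lemma bilZl psi k xi zeta : bil psi (fun x => k * xi x) zeta = k * bil psi xi zeta.
Proof.
rewrite /bil mulr_sumr; apply: eq_bigr => x _; rewrite mulr_sumr.
by apply: eq_bigr => y _; ring.
Qed.

Lemma bilC psi xi zeta : symm psi -> bil psi xi zeta = bil psi zeta xi.
Proof.
move=> s; rewrite /bil exchange_big; apply: eq_bigr => x _; apply: eq_bigr => y _.
by rewrite s mulrAC.
Qed.

Lemma bil_deltal psi x zeta : bil psi (delta x) zeta = \sum_y psi x y * zeta y.
Proof.
rewrite /bil exchange_big; apply: eq_bigr => y _.
under eq_bigr do rewrite mulrAC.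
by rewrite sum_delta.
Qed.

Lemma quadD psi xi zeta : symm psi -> quad psi (fun x => xi x + zeta x) =
  quad psi xi + 2 * bil psi zeta xi + quad psi zeta.
Proof.
move=> s; rewrite /quad bilDl (bilC xi)// (bilC zeta)// !bilDl.
by rewrite (bilC xi zeta)//; ring.
Qed.

Lemma quadZ psi k xi : symm psi -> quad psi (fun x => k * xi x) = k ^+ 2 * quad psi xi.
Proof. by move=> s; rewrite /quad bilZl bilC// bilZl mulrA. Qed.

Lemma eq_quad psi xi zeta : xi =1 zeta -> quad psi xi = quad psi zeta.
Proof. by move=> e; apply: eq_bigr => x _; apply: eq_bigr => y _; rewrite !e. Qed.

Lemma quad_delta psi x : quad psi (delta x) = psi x x.
Proof. by rewrite /quad bil_deltal sum_delta. Qed.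

Lemma quad_addm psi psi' xi :
  quad (fun x y => psi x y + psi' x y) xi = quad psi xi + quad psi' xi.
Proof.
rewrite /quad /bil -big_split; apply: eq_bigr => x _; rewrite -big_split.
by apply: eq_bigr => y _; rewrite !mulrDl.
Qed.

Lemma quad_scalem psi k xi : quad (fun x y => k * psi x y) xi = k * quad psi xi.
Proof.
rewrite /quad /bil mulr_sumr; apply: eq_bigr => x _; rewrite mulr_sumr.
by apply: eq_bigr => y _; rewrite !mulrA.
Qed.

(* Symmetric Gaussian elimination on [B]: each step splits off a rank-one square. *)
Lemma psd_trace_ge0 A B : symm A -> symm B -> psd A -> psd B ->
  0 <= \sum_x \sum_y A x y * B x y.
Proof.
move=> sA sB pA pB.
suff H (s : seq V) : forall B, symm B -> psd B ->
    (forall x y, x \notin s -> B x y = 0) -> 0 <= \sum_x \sum_y A x y * B x y.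
  by apply: (H (enum V)) => // x y; rewrite mem_enum.
elim: s => [|x s IHs] {sB pB}B sB pB B0.
  by rewrite big1// => x _; rewrite big1// => y _; rewrite B0// mulr0.
have Bxx : 0 <= B x x by rewrite -quad_delta.
have [Bxx0|Bxx0] := eqVneq (B x x) 0.
  apply: IHs => // z y zs; have [zx|zx] := eqVneq z x; last first.
    by apply: B0; rewrite inE negb_or zx.
  rewrite zx; apply/eqP; apply: contraT => Bxy.
  (* If [B x y] were nonzero, this test vector would give [B] the value -1. *)
  have := pB (fun z => delta y z + (- (B y y + 1) / (2 * B x y)) * delta x z).
  rewrite quadD// quadZ// bilZl !quad_delta bil_deltal sum_delta Bxx0 mulr0 addr0.
  have -> : B y y + 2 * (- (B y y + 1) / (2 * B x y) * B x y) = -1 by field.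
  by rewrite lerNr oppr0 ler10.
pose B' y z := B y z - B x y * B x z / B x x.
have -> : \sum_y \sum_z A y z * B y z =
    \sum_y \sum_z A y z * B' y z + quad A (B x) / B x x.
  rewrite /quad /bil mulr_suml -big_split; apply: eq_bigr => y _.
  rewrite mulr_suml -big_split; apply: eq_bigr => z _ /=.
  by rewrite /B'; ring.
rewrite addr_ge0 ?mulr_ge0 ?invr_ge0//; apply: IHs.
- by move=> y z; rewrite /B' (sB y z) (mulrC (B x y)).
(* The Schur complement at [xi] is the minimum of [B] along the line [xi + t * delta x], attained at
   this [t]. *)
- move=> xi; set t := - (\sum_y B x y * xi y) / B x x.
  have := pB (fun y => xi y + t * delta x y).
  rewrite quadD// quadZ// bilZl quad_delta bil_deltal.
  suff -> : quad B' xi = quad B xi + 2 * (t * (\sum_y B x y * xi y)) + t ^+ 2 * B x x by [].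
  have -> : quad B' xi = quad B xi - (\sum_y B x y * xi y) ^+ 2 / B x x.
    rewrite /quad /bil expr2 mulr_suml mulr_suml -sumrB.
    apply: eq_bigr => y _; rewrite mulr_sumr mulr_suml -sumrB.
    by apply: eq_bigr => z _; rewrite /B'; ring.
  by rewrite /t; field.
- move=> y z; rewrite /B'; have [->|yx] := eqVneq y x.
    by move=> _; rewrite mulrAC divff// mul1r subrr.
  move=> ys; have yxs : y \notin x :: s by rewrite inE negb_or yx.
  by rewrite (B0 y z yxs) (sB x y) (B0 y x yxs) !mul0r subrr.
Qed.

(** The form at e_x - e_y ([dd_quad]). These numbers determine the form on the tangent space
    ([quad_dd]). *)
Definition dd psi x y : R := psi x x + psi y y - psi x y - psi y x.

Lemma dd_quad psi x y : symm psi ->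
  dd psi x y = quad psi (fun z => delta x z + -1 * delta y z).
Proof.
move=> s; rewrite quadD// quadZ// bilZl !quad_delta bil_deltal sum_delta /dd.
by rewrite (s x y); ring.
Qed.

Lemma quad_dd psi xi : symm psi -> \sum_x xi x = 0 ->
  quad psi xi = - (\sum_x \sum_y xi x * xi y * dd psi x y) / 2.
Proof.
move=> s xi0.
have e1 : \sum_x \sum_y xi x * xi y * psi x x = 0.
  apply: big1 => x _; under eq_bigr do rewrite mulrAC.
  by rewrite -mulr_sumr xi0 mulr0.
have e2 : \sum_x \sum_y xi x * xi y * psi y y = 0.
  rewrite exchange_big; apply: big1 => y _ /=.
  under eq_bigr do rewrite -mulrA; by rewrite -mulr_suml xi0 mul0r.
have -> : \sum_x \sum_y xi x * xi y * dd psi x y = - (2 * quad psi xi).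
  transitivity (\sum_x \sum_y xi x * xi y * psi x x +
      \sum_x \sum_y xi x * xi y * psi y y - 2 * quad psi xi).
    rewrite /quad /bil mulr_sumr -big_split -sumrB; apply: eq_bigr => x _ /=.
    rewrite mulr_sumr -big_split -sumrB; apply: eq_bigr => y _ /=.
    by rewrite /dd (s y x); ring.
  by rewrite e1 e2; ring.
by field.
Qed.

(* Positivity on the tangent space of the simplex. *)
Definition psdT psi := forall xi, \sum_x xi x = 0 -> 0 <= quad psi xi.

Lemma dd_ge0 psi x y : symm psi -> psdT psi -> 0 <= dd psi x y.
Proof.
move=> s p; rewrite dd_quad//; apply: p; rewrite big_split/= -mulr_sumr.
have sd z : \sum_w delta z w = 1.
  by have := sum_delta z (fun=> 1); under eq_bigr do rewrite mul1r.
by rewrite !sd; ring.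
Qed.

Variables (c : V -> V -> R) (alpha : V -> R).
Hypotheses (c_sym : forall x y, c x y = c y x) (c_ge0 : forall x y, 0 <= c x y).
Hypothesis alpha_gt0 : forall x, 0 < alpha x.
Local Notation s := (\sum_x alpha x).
Hypothesis s_gt0 : 0 < s.

(** Up to the common factor s (s + 1), this is the variance of [lin phi] under Dir(alpha)
    ([var_lin]), and [energy] is its Dirichlet form ([energy_lin]). An inequality
    [g * var_alpha phi <= energy phi] is thus a spectral gap on affine functions. *)
Definition var_alpha phi : R :=
  \sum_x alpha x * phi x ^+ 2 - (\sum_x alpha x * phi x) ^+ 2 / s.

Definition energy phi : R := (\sum_x \sum_y c x y * (phi x - phi y) ^+ 2) / 2.

(* Pairing of [psi] with a multiple of the covariance matrix of Dir(alpha). *)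
Definition ell psi : R :=
  \sum_x alpha x * psi x x - (\sum_x \sum_y alpha x * alpha y * psi x y) / s.

Lemma ell_dd psi : symm psi ->
  ell psi = (\sum_x \sum_y alpha x * alpha y * dd psi x y) / (2 * s).
Proof.
move=> sp; have s0 : s != 0 by rewrite gt_eqF.
have e1 : \sum_x \sum_y alpha x * alpha y * psi x x = s * \sum_x alpha x * psi x x.
  rewrite mulr_sumr; apply: eq_bigr => x _.
  by under eq_bigr do rewrite mulrAC; rewrite -mulr_sumr mulrC.
have e2 : \sum_x \sum_y alpha x * alpha y * psi y y = s * \sum_x alpha x * psi x x.
  rewrite exchange_big mulr_sumr; apply: eq_bigr => y _ /=.
  by under eq_bigr do rewrite -mulrA; rewrite -mulr_suml.
have -> : \sum_x \sum_y alpha x * alpha y * dd psi x y =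
    \sum_x \sum_y alpha x * alpha y * psi x x +
    \sum_x \sum_y alpha x * alpha y * psi y y -
    2 * \sum_x \sum_y alpha x * alpha y * psi x y.
  rewrite mulr_sumr -big_split -sumrB; apply: eq_bigr => x _ /=.
  rewrite mulr_sumr -big_split -sumrB; apply: eq_bigr => y _ /=.
  by rewrite /dd (sp y x); ring.
by rewrite e1 e2 /ell; field.
Qed.

Lemma ell_ge0 psi : symm psi -> psdT psi -> 0 <= ell psi.
Proof.
move=> sp p; rewrite ell_dd//; apply: divr_ge0; last by rewrite mulr_ge0// ltW.
apply: sumr_ge0 => x _; apply: sumr_ge0 => y _.
by rewrite !mulr_ge0 ?dd_ge0// ltW.
Qed.

(** [ell] is a combination of all the [dd psi x y] with positive weights, so it dominates each of
    them, and by [quad_dd] the whole form on the tangent space. *)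
Lemma quad_le_ell : exists2 C : R, 0 <= C & forall psi xi, symm psi -> psdT psi ->
  \sum_x xi x = 0 -> quad psi xi <= C * ell psi * \sum_x xi x ^+ 2.
Proof.
pose k := 2 * s.
have k0 : 0 <= k by rewrite mulr_ge0// ltW.
pose D := \sum_x \sum_y k / (alpha x * alpha y).
have D0 x y : 0 <= k / (alpha x * alpha y) by rewrite divr_ge0// mulr_ge0// ltW.
exists (D * #|V|%:R).
  by rewrite mulr_ge0// sumr_ge0// => x _; rewrite sumr_ge0.
move=> psi xi sp p xi0.
have ddD x y : dd psi x y <= D * ell psi.
  apply: (@le_trans _ _ (k / (alpha x * alpha y) * ell psi)).
    rewrite ell_dd//.
    have -> : k / (alpha x * alpha y) *
        ((\sum_x \sum_y alpha x * alpha y * dd psi x y) / (2 * s)) =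
        (\sum_x \sum_y alpha x * alpha y * dd psi x y) / (alpha x * alpha y).
      by rewrite /k; field; rewrite !gt_eqF.
    rewrite ler_pdivlMr ?mulr_gt0// mulrC (bigD1 x)//= (bigD1 y)//= -addrA lerDl.
    rewrite addr_ge0// sumr_ge0// => z _; rewrite ?sumr_ge0// => *;
    by rewrite !mulr_ge0 ?dd_ge0// ltW.
  rewrite ler_wpM2r ?ell_ge0// /D (bigD1 x)//= (bigD1 y)//= -addrA lerDl.
  by rewrite addr_ge0// sumr_ge0// => z _; rewrite ?sumr_ge0.
have l0 := ell_ge0 sp p.
have DD : 0 <= D by rewrite /D sumr_ge0// => x _; rewrite sumr_ge0.
rewrite quad_dd//.
apply: (@le_trans _ _ ((\sum_x \sum_y (xi x ^+ 2 + xi y ^+ 2) / 2 * (D * ell psi)) / 2)).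
  rewrite ler_pM2r// -sumrN ler_sum// => x _; rewrite -sumrN ler_sum// => y _.
  have d0 := dd_ge0 x y sp p; have d1 := ddD x y.
  have h : 0 <= (xi x + xi y) ^+ 2 by rewrite sqr_ge0.
  have h1 : - (xi x * xi y) <= (xi x ^+ 2 + xi y ^+ 2) / 2.
    by rewrite ler_pdivlMr//; lra.
  apply: (@le_trans _ _ ((xi x ^+ 2 + xi y ^+ 2) / 2 * dd psi x y)).
    by rewrite -mulNr ler_wpM2r.
  by rewrite ler_wpM2l// divr_ge0// addr_ge0// sqr_ge0.
set S := \sum_x xi x ^+ 2; set N : R := #|V|%:R; set K := D * ell psi.
have S0 : 0 <= S by apply: sumr_ge0 => x _; exact: sqr_ge0.
have n0 : 0 <= N by [].
have -> : \sum_x \sum_y (xi x ^+ 2 + xi y ^+ 2) / 2 * K = N * S * K.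
  transitivity (\sum_x (N * xi x ^+ 2 + S) / 2 * K).
    apply: eq_bigr => x _; rewrite -!mulr_suml big_split/= sumr_const.
    by rewrite -[X in X + _]mulr_natl.
  rewrite -!mulr_suml big_split/= -mulr_sumr sumr_const -[X in _ + X]mulr_natl.
  by rewrite -/S -/N; field.
have := mulr_ge0 (mulr_ge0 DD n0) (mulr_ge0 l0 S0).
have -> : N * S * K / 2 = D * N * (ell psi * S) / 2 by rewrite /K; field.
rewrite -mulrA; move: (D * N * (ell psi * S)) => z z0; lra.
Qed.

(** Duality: the hypothesis says that [A], the graph Laplacian minus [g] times the matrix of
    [var_alpha], is positive semidefinite, and the claim is that its trace pairing with [psi] is
    nonnegative. As [psi] is only nonnegative on the tangent space, it is first replaced by a form
    [B] nonnegative everywhere; the pairing is unchanged because the rows of [A] sum to 0. *)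
Lemma energy_ge_ell g psi : symm psi -> psdT psi ->
  (forall phi, g * var_alpha phi <= energy phi) ->
  g * ell psi <= (\sum_x \sum_y c x y * dd psi x y) / 2.
Proof.
move=> sp p gP; have s0 : s != 0 by rewrite gt_eqF.
pose A x y := delta x y * (\sum_z c x z) - c x y -
  g * (delta x y * alpha x - alpha x * alpha y / s).
have dC x y : delta x y = delta y x by rewrite /delta eq_sym.
have sA : symm A.
  move=> x y; rewrite /A (c_sym x y) (mulrC (alpha x)) (dC x y) /delta.
  by case: eqVneq => [->//|_]; rewrite !mul0r.
have AE (B : V -> V -> R) : symm B -> \sum_x \sum_y A x y * B x y =
    (\sum_x \sum_y c x y * dd B x y) / 2 - g * ell B.
  move=> sB.
  transitivity (\sum_x (\sum_z c x z) * B x x - \sum_x \sum_y c x y * B x y - g * ell B).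
    have rowE x : \sum_y A x y * B x y = (\sum_z c x z) * B x x -
        \sum_y c x y * B x y - g * (alpha x * B x x - \sum_y alpha x * alpha y * B x y / s).
      rewrite -(sum_delta x (fun y => (\sum_z c x z) * B x y)).
      rewrite -(sum_delta x (fun y => alpha x * B x y)).
      rewrite -[X in g * X]sumrB mulr_sumr -!sumrB; apply: eq_bigr => y _.
      by rewrite /A; ring.
    under eq_bigr do rewrite rowE.
    rewrite !sumrB -mulr_sumr sumrB; congr (_ - _ * (_ - _)).
    by rewrite mulr_suml; apply: eq_bigr => x _; rewrite mulr_suml.
  congr (_ - _).
  have e1 : \sum_x \sum_y c x y * B x x = \sum_x (\sum_z c x z) * B x x.
    by apply: eq_bigr => x _; rewrite mulr_suml.
  have e2 : \sum_x \sum_y c x y * B y y = \sum_x (\sum_z c x z) * B x x.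
    rewrite -e1 exchange_big; apply: eq_bigr => x _; apply: eq_bigr => y _.
    by rewrite c_sym.
  have -> : \sum_x \sum_y c x y * dd B x y = \sum_x \sum_y c x y * B x x +
     \sum_x \sum_y c x y * B y y - 2 * \sum_x \sum_y c x y * B x y.
    rewrite mulr_sumr -big_split -sumrB; apply: eq_bigr => x _ /=.
    rewrite mulr_sumr -big_split -sumrB; apply: eq_bigr => y _ /=.
    by rewrite /dd (sB y x); ring.
  by rewrite e1 e2; field.
have rA x : \sum_y A x y = 0.
  rewrite /A 2!sumrB -mulr_sumr sumrB.
  have -> : \sum_y delta x y * (\sum_z c x z) = \sum_z c x z.
    by under eq_bigr do rewrite mulrC; rewrite sum_delta.
  have -> : \sum_y delta x y * alpha x = alpha x.
    by under eq_bigr do rewrite mulrC; rewrite (sum_delta x (fun=> alpha x)).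
  rewrite -mulr_suml -mulr_sumr; field.
  exact: s0.
have pA : psd A.
  move=> phi; have sphi : symm (fun x y => phi x * phi y) by move=> x y; rewrite mulrC.
  have -> : quad A phi = \sum_x \sum_y A x y * (phi x * phi y).
    by apply: eq_bigr => x _; apply: eq_bigr => y _; rewrite mulrA.
  rewrite AE// subr_ge0; have := gP phi; rewrite /energy /var_alpha /ell.
  have -> : \sum_x \sum_y c x y * (phi x - phi y) ^+ 2 =
      \sum_x \sum_y c x y * dd (fun x y => phi x * phi y) x y.
    by apply: eq_bigr => x _; apply: eq_bigr => y _; rewrite /dd; ring.
  have -> : (\sum_x alpha x * phi x) ^+ 2 =
      \sum_x \sum_y alpha x * alpha y * (phi x * phi y).
    rewrite expr2 mulr_suml; apply: eq_bigr => x _; rewrite mulr_sumr.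
    by apply: eq_bigr => y _; ring.
  by [].
pose pi_ x := alpha x / s.
have pi1 : \sum_x pi_ x = 1 by rewrite -mulr_suml divff.
pose m x := \sum_y psi x y * pi_ y.
(* [B] is [psi] composed with the projection of [xi] to the tangent space along [pi_]. *)
pose B x y := psi x y - m x - m y + \sum_z m z * pi_ z.
have sB : symm B by move=> x y; rewrite /B (sp x y); ring.
have pB : psd B.
  move=> xi; pose xi' x := xi x + (- \sum_z xi z) * pi_ x.
  have -> : quad B xi = quad psi xi'.
    rewrite /xi' quadD// quadZ// bilZl.
    have -> : quad psi pi_ = \sum_z m z * pi_ z.
      rewrite /quad /bil; apply: eq_bigr => x _; rewrite /m mulr_suml.
      by apply: eq_bigr => y _; ring.
    have -> : bil psi pi_ xi = \sum_x m x * xi x.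
      rewrite bilC// /bil; apply: eq_bigr => x _; rewrite /m mulr_suml.
      by apply: eq_bigr => y _; ring.
    set M := \sum_z m z * pi_ z; set X := \sum_z xi z.
    have e1 : \sum_x \sum_y m x * xi x * xi y = (\sum_x m x * xi x) * X.
      by rewrite mulr_suml; apply: eq_bigr => x _; rewrite mulr_sumr.
    have e2 : \sum_x \sum_y m y * xi x * xi y = (\sum_x m x * xi x) * X.
      rewrite mulrC /X mulr_suml; apply: eq_bigr => x _; rewrite mulr_sumr.
      by apply: eq_bigr => y _; ring.
    have e3 : \sum_x \sum_y M * xi x * xi y = M * X ^+ 2.
      transitivity (\sum_x M * X * xi x); last by rewrite -mulr_sumr expr2 mulrA.
      by apply: eq_bigr => x _; rewrite -mulr_sumr mulrAC.
    transitivity (quad psi xi - \sum_x \sum_y m x * xi x * xi y -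
      \sum_x \sum_y m y * xi x * xi y + \sum_x \sum_y M * xi x * xi y).
      rewrite /quad /bil -2!sumrB -big_split; apply: eq_bigr => x _ /=.
      rewrite -2!sumrB -big_split; apply: eq_bigr => y _ /=.
      by rewrite /B -/M; ring.
    by rewrite e1 e2 e3; ring.
  by apply: p; rewrite big_split/= -mulr_sumr pi1 mulr1 subrr.
have := psd_trace_ge0 sA sB pA pB.
suff -> : \sum_x \sum_y A x y * B x y = \sum_x \sum_y A x y * psi x y.
  by rewrite AE// subr_ge0.
have e1 : \sum_x \sum_y A x y * m x = 0.
  by apply: big1 => x _; rewrite -mulr_suml rA mul0r.
have e2 : \sum_x \sum_y A x y * m y = 0.
  rewrite exchange_big; apply: big1 => y _ /=; rewrite -mulr_suml.
  by under eq_bigr do rewrite sA; rewrite rA mul0r.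
have e3 : \sum_x \sum_y A x y * (\sum_z m z * pi_ z) = 0.
  by apply: big1 => x _; rewrite -mulr_suml rA mul0r.
transitivity (\sum_x \sum_y A x y * psi x y - \sum_x \sum_y A x y * m x -
   \sum_x \sum_y A x y * m y + \sum_x \sum_y A x y * (\sum_z m z * pi_ z)).
  rewrite -2!sumrB -big_split; apply: eq_bigr => x _ /=.
  rewrite -2!sumrB -big_split; apply: eq_bigr => y _ /=.
  by rewrite /B; ring.
by rewrite e1 e2 e3; ring.
Qed.

(* [gen_quad psi] is the image of [fun xi => quad psi xi] under the generator, the jumps
   acting linearly on [xi]; see [quad_gen_quad]. *)
Definition gen_half psi x y : R := (\sum_z c x z * (psi y z - psi y x)) / alpha x.

Definition gen_quad psi x y : R := gen_half psi x y + gen_half psi y x +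
  delta x y * ((\sum_z c x z * dd psi x z) / (alpha x * (alpha x + 1))).

Lemma symm_gen_quad psi : symm (gen_quad psi).
Proof.
move=> x y; rewrite /gen_quad addrC [in RHS]addrC; congr (_ + _); last by rewrite addrC.
by rewrite /delta eq_sym; case: eqVneq => [->//|_]; rewrite !mul0r.
Qed.

(** The factors 1 / alpha_x and 1 / (alpha_x (alpha_x + 1)) are the integrals of 1 - u and (1 - u)^2
    against the jump kernel at [x]; compare [gint_qpoly]. *)
Lemma quad_gen_quad psi xi : symm psi -> quad (gen_quad psi) xi =
  \sum_x \sum_y c x y * (2 * xi x * (\sum_z xi z * (psi z y - psi z x)) / alpha x +
     xi x ^+ 2 * dd psi x y / (alpha x * (alpha x + 1))).
Proof.
move=> sp; have a0 x : alpha x != 0 by rewrite gt_eqF.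
have a1 x : alpha x + 1 != 0 by rewrite gt_eqF// addr_gt0.
have half : bil (gen_half psi) xi xi =
    \sum_x \sum_y c x y * (xi x * (\sum_z xi z * (psi z y - psi z x)) / alpha x).
  rewrite /bil; apply: eq_bigr => x _.
  transitivity (\sum_z \sum_y c x y * (xi x * (xi z * (psi z y - psi z x)) / alpha x)).
    apply: eq_bigr => z _; rewrite /gen_half !mulr_suml; apply: eq_bigr => y _.
    by ring.
  rewrite exchange_big; apply: eq_bigr => y _ /=.
  by rewrite mulr_sumr mulr_suml mulr_sumr; apply: eq_bigr.
have half' : bil (fun x y => gen_half psi y x) xi xi = bil (gen_half psi) xi xi.
  rewrite /bil exchange_big; apply: eq_bigr => x _; apply: eq_bigr => y _.
  by rewrite mulrAC.
have diag : bil (fun x y => delta x y * ((\sum_z c x z * dd psi x z) /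
    (alpha x * (alpha x + 1)))) xi xi =
    \sum_x \sum_y c x y * (xi x ^+ 2 * dd psi x y / (alpha x * (alpha x + 1))).
  rewrite /bil; apply: eq_bigr => x _.
  transitivity (\sum_y ((\sum_z c x z * dd psi x z) / (alpha x * (alpha x + 1)) *
     xi x * xi y) * delta x y); first by apply: eq_bigr => y _; ring.
  rewrite sum_delta !mulr_suml; apply: eq_bigr => y _; field.
  by rewrite a0 a1.
transitivity (bil (gen_half psi) xi xi + bil (fun x y => gen_half psi y x) xi xi +
  bil (fun x y => delta x y * ((\sum_z c x z * dd psi x z) /
    (alpha x * (alpha x + 1)))) xi xi).
  rewrite /quad /bil -2!big_split; apply: eq_bigr => x _ /=.
  rewrite -2!big_split; apply: eq_bigr => y _ /=.
  by rewrite /gen_quad; ring.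
rewrite half' half diag -2!big_split; apply: eq_bigr => x _ /=.
rewrite -2!big_split; apply: eq_bigr => y _ /=.
by field; rewrite a0 a1.
Qed.

(** The diagonal part of [ell] yields - K and the double sum yields K, for the same edge sum K,
    whence the factor 1 + 1 / s. In the double sum the first-order terms cancel by antisymmetry of
    each edge. *)
Lemma ell_gen_quad psi : symm psi -> ell (gen_quad psi) =
  - ((1 + s^-1) * \sum_x \sum_y c x y * (alpha x / (alpha x + 1)) * dd psi x y).
Proof.
move=> sp; have s0 : s != 0 by rewrite gt_eqF.
have a0 x : alpha x != 0 by rewrite gt_eqF.
have a1 x : alpha x + 1 != 0 by rewrite gt_eqF// addr_gt0.
have anti (f : V -> R) : \sum_x \sum_z c x z * (f z - f x) = 0.
  have e : \sum_x \sum_z c x z * (f z - f x) = - \sum_x \sum_z c x z * (f z - f x).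
    rewrite [LHS]exchange_big -sumrN; apply: eq_bigr => x _; rewrite -sumrN.
    by apply: eq_bigr => y _; rewrite (c_sym y); ring.
  by apply/eqP; rewrite -[_ == _](@mulrn_eq0 _ _ 2) mulr2n {2}e subrr.
have h0 : \sum_x \sum_y alpha x * alpha y * gen_half psi x y = 0.
  rewrite exchange_big; apply: big1 => y _ /=.
  transitivity (alpha y * \sum_x \sum_z c x z * (psi y z - psi y x)).
    rewrite mulr_sumr; apply: eq_bigr => x _; rewrite /gen_half; field.
    exact: a0.
  by rewrite (anti (psi y)) mulr0.
set K := \sum_x \sum_y c x y * (alpha x / (alpha x + 1)) * dd psi x y.
have e1 : \sum_x \sum_y alpha x * alpha y * gen_quad psi x y = K.
  transitivity (\sum_x \sum_y alpha x * alpha y * gen_half psi x y +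
    \sum_x \sum_y alpha x * alpha y * gen_half psi y x + K); last first.
    rewrite h0 [X in _ + X + _]exchange_big /=.
    have -> : \sum_j \sum_i alpha i * alpha j * gen_half psi j i =
       \sum_x \sum_y alpha x * alpha y * gen_half psi x y.
      by apply: eq_bigr => x _; apply: eq_bigr => y _; rewrite (mulrC (alpha x)).
    by rewrite h0 !add0r.
  rewrite /K -2!big_split; apply: eq_bigr => x _ /=.
  have -> : \sum_y c x y * (alpha x / (alpha x + 1)) * dd psi x y =
    \sum_y (alpha x * alpha y * ((\sum_z c x z * dd psi x z) /
       (alpha x * (alpha x + 1)))) * delta x y.
    rewrite sum_delta.
    transitivity ((\sum_y c x y * dd psi x y) * (alpha x / (alpha x + 1))).
      by rewrite mulr_suml; apply: eq_bigr => y _; ring.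
    by field; rewrite a0 a1.
  by rewrite -2!big_split; apply: eq_bigr => y _ /=; rewrite /gen_quad; ring.
have e2 : \sum_x alpha x * gen_quad psi x x = - K.
  have e3 : \sum_x \sum_y c x y * (2 * (psi x y - psi x x)) =
      - \sum_x \sum_y c x y * dd psi x y.
    have := anti (fun x => psi x x).
    have -> : \sum_x \sum_y c x y * (2 * (psi x y - psi x x)) =
        \sum_x \sum_z c x z * (psi z z - psi x x) - \sum_x \sum_y c x y * dd psi x y.
      rewrite -sumrB; apply: eq_bigr => x _; rewrite -sumrB; apply: eq_bigr => y _.
      by rewrite /dd (sp y x); ring.
    by move=> ->; rewrite sub0r.
  transitivity (\sum_x \sum_y c x y * (2 * (psi x y - psi x x)) +
     \sum_x \sum_y c x y * dd psi x y / (alpha x + 1)).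
    rewrite -big_split; apply: eq_bigr => x _ /=.
    rewrite /gen_quad /gen_half /delta eqxx mul1r -mulr_suml.
    have -> : \sum_y c x y * (2 * (psi x y - psi x x)) =
      2 * \sum_y c x y * (psi x y - psi x x).
      by rewrite mulr_sumr; apply: eq_bigr => y _; ring.
    by field; rewrite a0 a1.
  rewrite e3 -sumrN -sumrN -big_split; apply: eq_bigr => x _ /=.
  rewrite -!sumrN -big_split; apply: eq_bigr => y _ /=.
  by field; exact: a1.
by rewrite /ell e1 e2; field; exact: s0.
Qed.

(** Averaging the edge sum over the two orientations replaces alpha_x / (alpha_x + 1) by half the
    sum over both ends, which is bounded below on each edge; [energy_ge_ell] bounds the rest. *)
Lemma ell_gen_quad_le g gm psi : symm psi -> psdT psi -> 0 <= gm ->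
  (forall phi, g * var_alpha phi <= energy phi) ->
  (forall x y, 0 < c x y ->
     gm <= alpha x / (alpha x + 1) + alpha y / (alpha y + 1)) ->
  ell (gen_quad psi) <= - ((1 + s^-1) * gm * g * ell psi).
Proof.
move=> sp p gm0 gP gmP; rewrite ell_gen_quad// lerN2 -!mulrA ler_wpM2l//.
  by rewrite addr_ge0// invr_ge0 ltW.
apply: (@le_trans _ _ (gm * ((\sum_x \sum_y c x y * dd psi x y) / 2))).
  by rewrite ler_wpM2l// energy_ge_ell.
have -> : \sum_x \sum_y c x y * (alpha x / (alpha x + 1)) * dd psi x y =
  (\sum_x \sum_y c x y * (alpha x / (alpha x + 1) + alpha y / (alpha y + 1)) * dd psi x y) / 2.
  set K := LHS; have K' : \sum_x \sum_y c x y * (alpha y / (alpha y + 1)) * dd psi x y = K.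
    rewrite exchange_big; apply: eq_bigr => x _; apply: eq_bigr => y _.
    by rewrite c_sym /dd; congr (_ * _); ring.
  have -> : \sum_x \sum_y c x y * (alpha x / (alpha x + 1) + alpha y / (alpha y + 1)) * dd psi x y = K + K.
    rewrite -{2}K' /K -big_split; apply: eq_bigr => x _; rewrite -big_split.
    by apply: eq_bigr => y _ /=; ring.
  by field.
rewrite mulrA ler_pM2r// mulr_sumr ler_sum// => x _; rewrite mulr_sumr ler_sum// => y _.
have := c_ge0 x y; rewrite le_eqVlt => /predU1P[<-|cxy]; first by rewrite !mul0r mulr0.
have d0 := dd_ge0 x y sp p.
by rewrite mulrCA -[leRHS]mulrA ler_wpM2l// ler_wpM2r// gmP.
Qed.

End quadratic_forms.

(** * The generator on polynomials *)

Section polynomial_functions.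
Variables (R : realType) (V : finType).
Implicit Types (eta : state R V) (f g : state R V -> R) (F G : R -> state R V -> R).
Implicit Types (m : V -> nat) (t : R * nat * (V -> nat)) (r : seq (R * nat * (V -> nat))).

Lemma coord_mk (h : V -> R) x : coord (mk_state h) x = h x.
Proof. by rewrite /coord tnth_mktuple enum_rankK. Qed.

Lemma state_eq eta eta' : coord eta =1 coord eta' -> eta = eta'.
Proof.
move=> e; apply: eq_from_tnth => i.
by have := e (enum_val i); rewrite /coord enum_valK.
Qed.

(* A term [(k, i, m)] stands for [k * u ^+ i * mono m eta]. *)
Definition polyu_eval r (u : R) eta : R :=
  \sum_(t <- r) t.1.1 * u ^+ t.1.2 * mono t.2 eta.

(** Explicit lists of terms allow the jump parameter [u] as an extra variable. The two degree bounds
    are kept because the constants of the Euler step depend on the degree. *)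
Definition polyu (a b : nat) F := exists2 r,
  all (fun t => (t.1.2 <= a) && (\sum_x t.2 x <= b))%N r & F =2 polyu_eval r.

Definition polyk (b : nat) f := polyu 0 b (fun=> f).

Lemma eq_polyu a b F G : F =2 G -> polyu a b F -> polyu a b G.
Proof. by move=> FG [r rP rE]; exists r => // u eta; rewrite -FG. Qed.

Lemma polyu_leq a a' b b' F : (a <= a')%N -> (b <= b')%N -> polyu a b F -> polyu a' b' F.
Proof.
move=> aa bb [r rP rE]; exists r => //; apply: sub_all rP => t /andP[h1 h2].
by rewrite (leq_trans h1)// (leq_trans h2).
Qed.

Lemma polyuD a b F G : polyu a b F -> polyu a b G ->
  polyu a b (fun u eta => F u eta + G u eta).
Proof.
move=> [r rP rE] [r' rP' rE']; exists (r ++ r'); first by rewrite all_cat rP.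
by move=> u eta; rewrite /polyu_eval big_cat rE rE'.
Qed.

Lemma polyuZ a b k F : polyu a b F -> polyu a b (fun u eta => k * F u eta).
Proof.
move=> [r rP rE]; exists [seq (k * t.1.1, t.1.2, t.2) | t <- r].
  by rewrite all_map; exact: sub_all rP.
move=> u eta; rewrite rE /polyu_eval big_map mulr_sumr; apply: eq_bigr => t _.
by rewrite /= !mulrA.
Qed.

Lemma polyuB a b F G : polyu a b F -> polyu a b G ->
  polyu a b (fun u eta => F u eta - G u eta).
Proof.
move=> pF pG; apply: eq_polyu (polyuD pF (polyuZ (-1) pG)) => u eta.
by rewrite mulN1r.
Qed.

Lemma monoM m m' eta : mono (fun x => m x + m' x)%N eta = mono m eta * mono m' eta.
Proof. by rewrite /mono -big_split; apply: eq_bigr => x _; rewrite exprD. Qed.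

Lemma polyuM a b a' b' F G : polyu a b F -> polyu a' b' G ->
  polyu (a + a') (b + b') (fun u eta => F u eta * G u eta).
Proof.
move=> [r rP rE] [r' rP' rE'].
exists (flatten [seq [seq (t.1.1 * t'.1.1, (t.1.2 + t'.1.2)%N,
    (fun x => t.2 x + t'.2 x)%N) | t' <- r'] | t <- r]).
  elim: r rP {rE} => //= t r IHr /andP[/andP[h1 h2] rP]; rewrite all_cat IHr// andbT.
  rewrite all_map; apply: sub_all rP' => t' /= /andP[h3 h4].
  by rewrite leq_add// big_split/= leq_add.
move=> u eta; rewrite rE rE' /polyu_eval big_flatten big_map mulr_suml.
apply: eq_bigr => t _; rewrite big_map mulr_sumr; apply: eq_bigr => t' _ /=.
by rewrite monoM exprD; ring.
Qed.

Lemma mono0 eta : mono (fun=> 0%N) eta = 1.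
Proof. by rewrite /mono big1. Qed.

Lemma polyu_cst a b k : polyu a b (fun _ _ => k).
Proof.
exists [:: (k, 0%N, fun=> 0%N)]; first by rewrite /= big1.
by move=> u eta; rewrite /polyu_eval big_seq1 /= mono0 !mulr1.
Qed.

Lemma polyu_mono m : polyu 0 (\sum_x m x) (fun _ => mono m).
Proof.
exists [:: (1, 0%N, m)]; first by rewrite /= leqnn.
by move=> u eta; rewrite /polyu_eval big_seq1 /= !mul1r.
Qed.

Lemma mono_delta x eta : mono (fun y => (y == x) : nat) eta = coord eta x.
Proof.
rewrite /mono (bigD1 x)//= eqxx expr1 big1 ?mulr1// => y yx.
by rewrite (negPf yx).
Qed.

Lemma polyu_coord x : polyu 0 1 (fun _ eta => coord eta x).
Proof.
have := polyu_mono (fun y => (y == x) : nat).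
rewrite (bigD1 x)//= eqxx big1 => [|y yx]; last by rewrite (negPf yx).
by apply: eq_polyu => _ eta; rewrite mono_delta.
Qed.

Lemma polyu_var : polyu 1 0 (fun u _ => u).
Proof.
exists [:: (1, 1%N, fun=> 0%N)]; first by rewrite /= big1.
by move=> u eta; rewrite /polyu_eval big_seq1 /= mono0 expr1 mul1r mulr1.
Qed.

Lemma polyu_sum (I : Type) (s : seq I) a b (F : I -> R -> state R V -> R) :
  (forall i, polyu a b (F i)) -> polyu a b (fun u eta => \sum_(i <- s) F i u eta).
Proof.
move=> pF; elim: s => [|i s IHs].
  by apply: eq_polyu (polyu_cst a b 0) => u eta; rewrite big_nil.
by apply: eq_polyu (polyuD (pF i) IHs) => u eta; rewrite big_cons.
Qed.

Lemma polyuX a b n F : polyu a b F -> polyu (n * a) (n * b) (fun u eta => F u eta ^+ n).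
Proof.
move=> pF; elim: n => [|n IHn].
  by apply: eq_polyu (polyu_cst _ _ 1) => u eta; rewrite expr0.
by rewrite !mulSn; apply: eq_polyu (polyuM pF IHn) => u eta; rewrite exprS.
Qed.

Lemma polyu_mono_comp m (S : R -> state R V -> state R V) :
  (forall x, polyu 1 1 (fun u eta => coord (S u eta) x)) ->
  polyu (\sum_x m x) (\sum_x m x) (fun u eta => mono m (S u eta)).
Proof.
move=> pS; rewrite /mono /index_enum; elim: (Finite.enum V) => [|x s IHs].
  by rewrite big_nil; apply: eq_polyu (polyu_cst _ _ 1) => u eta; rewrite big_nil.
have := polyuM (polyuX (m x) (pS x)) IHs; rewrite muln1 big_cons.
by apply: eq_polyu => u eta; rewrite big_cons.
Qed.

Lemma polyk_comp k f (S : R -> state R V -> state R V) :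
  (forall x, polyu 1 1 (fun u eta => coord (S u eta) x)) ->
  polyk k f -> polyu k k (fun u eta => f (S u eta)).
Proof.
move=> pS [r rP rE].
suff : polyu k k (fun u eta => \sum_(t <- r) t.1.1 * mono t.2 (S u eta)).
  apply: eq_polyu => u eta; rewrite (rE 1) /polyu_eval.
  by apply: eq_bigr => t _; rewrite expr1n mulr1.
elim: r rP {rE} => [|t r IHr] /=.
  by move=> _; apply: eq_polyu (polyu_cst _ _ 0) => u eta; rewrite big_nil.
move=> /andP[/andP[_ h] /IHr H].
have pt := polyu_leq h h (polyuZ t.1.1 (polyu_mono_comp t.2 pS)).
by apply: eq_polyu (polyuD pt H) => u eta; rewrite big_cons.
Qed.

Lemma polyu_divX a b F : polyu a b F -> (forall eta, F 0 eta = 0) ->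
  exists2 G, polyu a b G & forall u eta, F u eta = u * G u eta.
Proof.
move=> [r rP rE] F0.
exists (polyu_eval [seq (t.1.1, t.1.2.-1, t.2) | t <- r & t.1.2 != 0%N]).
  exists [seq (t.1.1, t.1.2.-1, t.2) | t <- r & t.1.2 != 0%N] => //.
  rewrite all_map; elim: r rP {rE} => //= t r IHr /andP[/andP[h1 h2] /IHr H].
  by case: ifP => //= _; rewrite H (leq_trans (leq_pred _) h1) h2.
move=> u eta; have := F0 eta; rewrite !rE /polyu_eval => r0.
rewrite big_map big_filter mulr_sumr [RHS]big_mkcond /= -[LHS]subr0 -[X in _ - X = _]r0 -sumrB.
apply: eq_bigr => t _; case: ifPn => [|/negPn/eqP ->]; last by rewrite !expr0 subrr.
by case: t.1.2 => // n _; rewrite expr0n mulr0 mul0r subr0 exprS /=; ring.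
Qed.

Lemma polyu_gint a b F (al : R) : 0 < al -> polyu a b F ->
  exists Q : state R V -> {poly R}, [/\ forall eta u, (Q eta).[u] = F u eta,
    forall eta, (size (Q eta) <= a.+1)%N & polyk b (fun eta => gint al (Q eta))].
Proof.
move=> al0 [r rP rE].
exists (fun eta => \sum_(t <- r) (t.1.1 * mono t.2 eta) *: 'X^(t.1.2)); split.
- move=> eta u; rewrite horner_sum rE; apply: eq_bigr => t _.
  by rewrite hornerZ hornerXn mulrAC.
- move=> eta; elim: r rP {rE} => [|t r IHr] /=.
    by rewrite big_nil size_poly0.
  move=> /andP[/andP[h _] /IHr H]; rewrite big_cons.
  rewrite (leq_trans (size_polyD _ _))// geq_max H andbT.
  by rewrite (leq_trans (size_scale_leq _ _))// size_polyXn.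
- elim: r rP {rE} => [|t r IHr] /=.
    move=> _; apply: eq_polyu (polyu_cst _ _ 0) => u eta.
    by rewrite big_nil -polyC0 gintC.
  move=> /andP[/andP[_ h] /IHr H].
  have pt := polyu_leq (leqnn 0) h (polyuZ (t.1.1 * gint al 'X^(t.1.2)) (polyu_mono t.2)).
  apply: eq_polyu (polyuD pt H) => u eta; rewrite big_cons gintD// gintZ//.
  by rewrite mulrAC.
Qed.

Lemma polyfun_polyk f : polyfun f -> exists k, polyk k f.
Proof.
move=> [p ->].
pose mu (m : multinom #|V|) : V -> nat := fun x => m (enum_rank x).
have monoE (m : multinom #|V|) eta : \prod_i (tnth eta i) ^+ m i = mono (mu m) eta.
  rewrite /mono (reindex (@enum_rank V)) /=; last by apply: onW_bij; exact: enum_rank_bij.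
  by [].
exists (\max_(m <- msupp p) \sum_x mu m x)%N.
exists [seq (mcoeff m p, 0%N, mu m) | m : multinom #|V| <- msupp p].
  rewrite all_map; apply/allP => m mp /=.
  exact: (@leq_bigmax_seq _ _ xpredT (fun m : multinom #|V| => \sum_x mu m x)%N m).
move=> u eta; rewrite mevalE /polyu_eval [RHS]big_map; apply: eq_bigr => m _ /=.
by rewrite expr0 mulr1 monoE.
Qed.

End polynomial_functions.

(** * Moments of polynomials and symmetry of the generator *)

Section expectation.
Variables (R : realType) (V : finType) (alpha : V -> R).
Hypotheses (V_gt0 : (0 < #|V|)%N) (alpha_gt0 : forall x, 0 < alpha x).
Implicit Types (eta : state R V) (f g h : state R V -> R).
Local Notation P := (dirichlet alpha).
Local Notation E := (hp_mean alpha).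
Local Notation s := (\sum_x alpha x).

(** Boundedness is asked on the simplex only, which carries the law; polynomials are unbounded on
    the ambient space. *)
Definition bndO f := measurable_fun setT f /\
  exists C, forall eta, Omega eta -> `|f eta| <= C.

Lemma ae_Omega (Q : state R V -> Prop) :
  (forall eta, Omega eta -> Q eta) -> {ae P, forall eta, Q eta}.
Proof.
move=> H; exists (~` @Omega R V); split.
- by apply: measurableC; exact: measurable_Omega.
- exact: dirichlet_Omega.
- by move=> eta /= nQ O; apply: nQ; exact: H.
Qed.

Lemma bndO_integrable f : bndO f -> P.-integrable setT (EFin \o f).
Proof.
move=> [mf [C fC]]; apply/integrableP; split; first exact/measurable_EFinP.
apply: (@le_lt_trans _ _ (\int[P]_eta (cst `|C|%:E eta))%E).
  apply: ae_ge0_le_integral => //.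
  - by apply: measurableT_comp => //; exact/measurable_EFinP.
  - by move=> eta _ /=; rewrite lee_fin.
  - apply: ae_Omega => eta O _ /=; rewrite lee_fin (le_trans (fC _ O))//.
    exact: ler_norm.
by rewrite integral_cst//= probability_setT mule1 ltry.
Qed.

Lemma bndO_cst k : bndO (fun=> k).
Proof. by split => //; exists `|k|. Qed.

Lemma bndOD f g : bndO f -> bndO g -> bndO (fun eta => f eta + g eta).
Proof.
move=> [mf [C fC]] [mg [D gD]]; split; first exact: measurable_funD.
by exists (C + D) => eta O; rewrite (le_trans (ler_normD _ _))// lerD ?fC ?gD.
Qed.

Lemma bndOM f g : bndO f -> bndO g -> bndO (fun eta => f eta * g eta).
Proof.
move=> [mf [C fC]] [mg [D gD]]; split; first exact: measurable_funM.
by exists (C * D) => eta O; rewrite normrM ler_pM ?fC ?gD.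
Qed.

Lemma bndOZ k f : bndO f -> bndO (fun eta => k * f eta).
Proof. exact/bndOM/bndO_cst. Qed.

Lemma coord_le1 eta x : Omega eta -> 0 <= coord eta x <= 1.
Proof.
move=> [h0 h1]; rewrite h0/= -h1 (bigD1 x)//= lerDl sumr_ge0//.
Qed.

Lemma bndO_mono m : bndO (mono m).
Proof.
split; first exact: measurable_mono.
exists 1 => eta O; rewrite /mono normr_prod; apply: prodr_ile1 => x _.
have /andP[h0 h1] := coord_le1 x O.
by rewrite normr_ge0/= normrX exprn_ile1// ger0_norm.
Qed.

Lemma polyk_bndO k f : polyk k f -> bndO f.
Proof.
move=> [r _ rE]; have -> : f = polyu_eval r 0 by apply/funext => eta; rewrite -rE.
rewrite /polyu_eval; elim: r {rE} => [|t r [IH1 [C IH2]]].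
  by under eq_fun do rewrite big_nil; exact: bndO_cst.
under eq_fun do rewrite big_cons.
apply: bndOD; first by apply: bndOZ; exact: bndO_mono.
by split => //; exists C.
Qed.

Lemma eq_E f g : bndO f -> bndO g -> (forall eta, Omega eta -> f eta = g eta) ->
  E f = E g.
Proof.
move=> [mf _] [mg _] fg; rewrite /hp_mean /Rintegral; congr fine.
apply: ae_eq_integral => //; try exact/measurable_EFinP.
by apply: ae_Omega => eta O _; rewrite /= fg.
Qed.

Lemma E_D f g : bndO f -> bndO g -> E (fun eta => f eta + g eta) = E f + E g.
Proof.
by move=> bf bg; rewrite /hp_mean RintegralD//; exact: bndO_integrable.
Qed.

Lemma E_Z k f : bndO f -> E (fun eta => k * f eta) = k * E f.
Proof. by move=> bf; rewrite /hp_mean RintegralZl//; exact: bndO_integrable. Qed.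

Lemma E_B f g : bndO f -> bndO g -> E (fun eta => f eta - g eta) = E f - E g.
Proof.
move=> bf bg; rewrite -[- E g]mulN1r -E_Z// -E_D//; last exact: bndOZ.
by congr E; apply/funext => eta; rewrite mulN1r.
Qed.

Lemma E_cst k : E (fun=> k) = k.
Proof. by rewrite /hp_mean Rintegral_cst//= probability_setT/= mulr1. Qed.

Lemma E_ge0 f : bndO f -> (forall eta, Omega eta -> 0 <= f eta) -> 0 <= E f.
Proof.
move=> bf f0; have bn : bndO (fun eta => `|f eta|).
  case: bf => mf [C fC]; split; first exact: measurableT_comp.
  by exists C => eta /fC; rewrite normr_id.
rewrite (eq_E bf bn) => [|eta O]; last by rewrite ger0_norm// f0.
by apply: Rintegral_ge0 => eta _.
Qed.

Lemma le_E f g : bndO f -> bndO g -> (forall eta, Omega eta -> f eta <= g eta) ->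
  E f <= E g.
Proof.
move=> bf bg fg; rewrite -subr_ge0 -E_B//; apply: E_ge0.
  by rewrite -[bndO _]/(bndO (fun eta => g eta + - f eta)); apply: bndOD => //;
     under eq_fun do rewrite -mulN1r; exact: bndOZ.
by move=> eta O; rewrite subr_ge0 fg.
Qed.

Lemma bndO_sum (I : Type) (r : seq I) (F : I -> state R V -> R) :
  (forall i, bndO (F i)) -> bndO (fun eta => \sum_(i <- r) F i eta).
Proof.
move=> bF; elim: r => [|i r IHr].
  by under eq_fun do rewrite big_nil; exact: bndO_cst.
by under eq_fun do rewrite big_cons; exact: bndOD.
Qed.

Lemma E_sum (I : Type) (r : seq I) (F : I -> state R V -> R) :
  (forall i, bndO (F i)) -> E (fun eta => \sum_(i <- r) F i eta) = \sum_(i <- r) E (F i).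
Proof.
move=> bF; elim: r => [|i r IHr].
  by under eq_fun do rewrite big_nil; rewrite E_cst big_nil.
under eq_fun do rewrite big_cons.
by rewrite E_D ?IHr ?big_cons//; exact: bndO_sum.
Qed.

Lemma E_mono_incr m x : E (mono (fun y => m y + (y == x))%N) =
  (alpha x + (m x)%:R) / (s + (\sum_y m y)%:R) * E (mono m).
Proof.
have EM m' : E (mono m') =
    dir_mass V_gt0 (fun x => alpha x + (m' x)%:R) / dir_mass V_gt0 alpha.
  have bn : bndO (fun eta => `|mono m' eta|).
    have [mf [C fC]] := bndO_mono m'; split; first exact: measurableT_comp.
    by exists C => eta /fC; rewrite normr_id.
  rewrite (eq_E (bndO_mono m') bn) => [|eta [h0 _]]; last first.
    by rewrite ger0_norm// /mono prodr_ge0// => y _; rewrite exprn_ge0.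
  by rewrite /hp_mean /Rintegral (integral_dirichlet_mono V_gt0).
rewrite !EM mulrA; congr (_ / _).
have -> : dir_mass V_gt0 (fun x0 => alpha x0 + (m x0 + (x0 == x))%:R) =
    dir_mass V_gt0 (fun y => (alpha y + (m y)%:R) + (y == x)%:R).
  by apply: eq_dir_mass => y; rewrite natrD addrA.
rewrite dir_mass_incr => [|y]; last by rewrite ltr_wpDr.
by rewrite big_split/= natr_sum.
Qed.

Lemma s_gt0 : 0 < s.
Proof.
have [x _] : exists x : V, true by move/card_gt0P: V_gt0 => [x]; exists x.
rewrite (bigD1 x)//= ltr_wpDr// sumr_ge0// => y _; exact: ltW.
Qed.

Lemma E_mono_addn m x j : E (fun eta => coord eta x ^+ j * mono m eta) =
  rising (alpha x + (m x)%:R) j / rising (s + (\sum_y m y)%:R) j * E (mono m).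
Proof.
have s0 := s_gt0.
have -> : (fun eta => coord eta x ^+ j * mono m eta) =
    mono (fun y => m y + (y == x) * j)%N.
  apply/funext => eta; rewrite monoM mulrC; congr (_ * _).
  rewrite /mono (bigD1 x)//= eqxx mul1n big1 ?mulr1// => y yx.
  by rewrite (negPf yx) mul0n expr0.
elim: j => [|j IHj].
  rewrite /rising !big_ord0 divr1 mul1r; congr E; apply/funext => eta.
  by apply: eq_bigr => y _; rewrite muln0 addn0.
have -> : mono (R := R) (fun y => m y + (y == x) * j.+1)%N =
    mono (fun y => (m y + (y == x) * j) + (y == x))%N.
  by apply/funext => eta; apply: eq_bigr => y _; rewrite mulnS addnA addnAC.
rewrite E_mono_incr IHj eqxx mul1n !risingS.
have -> : (\sum_y (m y + (y == x) * j) = \sum_y m y + j)%N.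
  rewrite big_split/=; congr addn; rewrite (bigD1 x)//= eqxx mul1n big1 ?addn0// => y yx.
  by rewrite (negPf yx) mul0n.
have r0 : rising (s + (\sum_y m y)%:R) j != 0.
  by rewrite gt_eqF// rising_gt0// ltr_wpDr.
have S0 : s + (\sum_y m y)%:R + j%:R != 0 by rewrite gt_eqF// ltr_wpDr// ltr_wpDr.
rewrite !natrD !addrA; field.
by rewrite r0 S0.
Qed.

Lemma E_coord x : E (fun eta => coord eta x) = alpha x / s.
Proof.
have := E_mono_addn (fun=> 0%N) x 1.
have -> : (fun eta => coord eta x ^+ 1 * mono (fun=> 0%N) eta) = (fun eta => coord eta x).
  by apply/funext => eta; rewrite mono0 mulr1 expr1.
have -> : E (mono (fun=> 0%N)) = 1.
  by rewrite -[RHS]E_cst; congr E; apply/funext => eta; rewrite mono0.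
move=> ->; rewrite /rising !big_ord_recl !big_ord0 !mulr1 !addr0.
by rewrite sum_nat_const muln0 addr0.
Qed.

Lemma E_coord2 x y : E (fun eta => coord eta x * coord eta y) =
  alpha y * (alpha x + delta R x y) / (s * (s + 1)).
Proof.
have := E_mono_addn (fun z => z == y) x 1.
have -> : (fun eta => coord eta x ^+ 1 * mono (fun z => (z == y) : nat) eta) =
    (fun eta => coord eta x * coord eta y).
  by apply/funext => eta; rewrite mono_delta expr1.
have -> : mono (R := R) (fun z => (z == y) : nat) = fun eta => coord eta y.
  by apply/funext => eta; rewrite mono_delta.
rewrite E_coord => ->; rewrite /rising !big_ord_recl !big_ord0 !mulr1 !addr0.
have -> : (\sum_(z : V) (z == y) = 1)%N.
  by rewrite (bigD1 y)//= eqxx big1 => [|z zy]; rewrite ?(negPf zy).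
have s0 := s_gt0; rewrite /delta; field.
by rewrite !gt_eqF// addr_gt0.
Qed.

(* A jump from [x] to [y] removes a random mass from [x], leading to [thin x u eta],
   and adds it to [y]. *)
Definition addst (x : V) (d : R) eta : state R V :=
  mk_state (fun z => coord eta z + (z == x)%:R * d).

Definition thin (x : V) (u : R) eta : state R V :=
  mk_state (fun z => if z == x then u * coord eta x else coord eta z).

(** The kernel has infinite mass, so this is of use for [K] divisible by the removed mass, as in the
    lemmas below. *)
Definition Lam x (K : R -> state R V -> R) : R :=
  E (fun eta => wint (alpha x)
    (fun u => (1 - u)^-1 * K ((1 - u) * coord eta x) (thin x u eta))).

Lemma mono_thin m x u eta : mono m (thin x u eta) = u ^+ m x * mono m eta.
Proof.
rewrite /mono (bigD1 x)//= [in RHS](bigD1 x)//= coord_mk eqxx exprMn mulrA.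
by congr (_ * _); apply: eq_bigr => y yx; rewrite coord_mk (negPf yx).
Qed.

(* The law of (thinned configuration, removed mass) under the jump kernel at [x]
   does not depend on [x]. *)
Lemma Lam_rep x (K : R -> state R V -> R) r : K =2 polyu_eval r ->
  Lam x (fun d eta => d * K d eta) =
  \sum_(t <- r) t.1.1 * (t.1.2`!%:R / rising (s + (\sum_y t.2 y)%:R) t.1.2.+1 *
     E (mono t.2)).
Proof.
move=> rE; have s0 := s_gt0.
have b01 (m j : nat) : bounded01 (fun u : R => u ^+ m * (1 - u) ^+ j).
  apply: eq_bounded01 (bounded01_horner ('X^m * (1 - 'X) ^+ j)) => u _.
  by rewrite !hornerE.
transitivity (E (fun eta => \sum_(t <- r)
   (t.1.1 * (t.1.2`!%:R / rising (alpha x + (t.2 x)%:R) t.1.2.+1)) *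
     (coord eta x ^+ t.1.2.+1 * mono t.2 eta))).
  congr E; apply/funext => eta.
  transitivity (\sum_(t <- r) wint (alpha x) (fun u =>
     (t.1.1 * (coord eta x ^+ t.1.2.+1 * mono t.2 eta)) *
       (u ^+ t.2 x * (1 - u) ^+ t.1.2))).
    transitivity (wint (alpha x) (fun u => \sum_(t <- r)
        (t.1.1 * (coord eta x ^+ t.1.2.+1 * mono t.2 eta)) *
        (u ^+ t.2 x * (1 - u) ^+ t.1.2))).
      apply: eq_wint => u /andP[_ u1].
      rewrite !mulrA mulVf ?mul1r; last by rewrite subr_eq0 gt_eqF.
      rewrite rE /polyu_eval mulr_sumr; apply: eq_bigr => t _.
      by rewrite mono_thin exprMn exprS; ring.
    elim: (r) => [|t r' IHr].
      have w0 := wintZ 0 (alpha_gt0 x) (b01 0%N 0%N).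
      rewrite mul0r in w0; rewrite big_nil -[RHS]w0.
      by apply: eq_wint => u _; rewrite big_nil mul0r.
    rewrite big_cons -IHr -wintD//; last 2 first.
    - exact: bounded01Z.
    - elim: (r') => [|t' r'' IH].
        by apply: eq_bounded01 (bounded01_horner 0) => u _; rewrite big_nil horner0.
      by apply: eq_bounded01 (bounded01D (bounded01Z _ (b01 _ _)) IH) => u _; rewrite big_cons.
    by apply: eq_wint => u _; rewrite big_cons.
  apply: eq_bigr => t _; rewrite wintZ// wintX//; last first.
    exact: bounded01_onem.
  rewrite wint_onem ?ltr_wpDr//; ring.
rewrite E_sum; last first.
  move=> t; apply: bndOZ; apply: (@polyk_bndO (t.1.2.+1 + \sum_y t.2 y)).
  have := polyuM (polyuX t.1.2.+1 (polyu_coord R x)) (polyu_mono R t.2).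
  by rewrite muln0 muln1.
apply: eq_bigr => t _; rewrite E_Z; last first.
  apply: (@polyk_bndO (t.1.2.+1 + \sum_y t.2 y)).
  have := polyuM (polyuX t.1.2.+1 (polyu_coord R x)) (polyu_mono R t.2).
  by rewrite muln0 muln1.
(* The factor [rising (alpha x + m x)] in the denominator, from the integral over [u], cancels the
   one in the moment: this removes [x] from the formula. *)
rewrite E_mono_addn; field.
by rewrite !gt_eqF// rising_gt0// ltr_wpDr.
Qed.

Lemma Lam_indep a b x y K : polyu a b K ->
  Lam x (fun d eta => d * K d eta) = Lam y (fun d eta => d * K d eta).
Proof. by move=> [r _ rE]; rewrite !(Lam_rep _ rE). Qed.

Lemma LamD a b a' b' x K K' : polyu a b K -> polyu a' b' K' ->
  Lam x (fun d eta => d * (K d eta + K' d eta)) =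
  Lam x (fun d eta => d * K d eta) + Lam x (fun d eta => d * K' d eta).
Proof.
move=> [r _ rE] [r' _ rE']; rewrite (Lam_rep _ rE) (Lam_rep _ rE') -big_cat.
apply: (@Lam_rep _ (fun d eta => K d eta + K' d eta)) => d eta.
by rewrite rE rE' /polyu_eval big_cat.
Qed.

Definition gen x y g eta : R :=
  wint (alpha x) (fun u => (1 - u)^-1 * (g (jump x y u eta) - g eta)).

Lemma jump1 x y eta : jump x y 1 eta = eta.
Proof.
apply: state_eq => z; rewrite coord_mk subrr mul0r add0r mul1r.
by case: eqVneq => [->//|_]; case: eqVneq => [->|].
Qed.

Lemma polyu_jump x y z : polyu 1 1 (fun u eta => coord (jump x y u eta) z).
Proof.
have pu := polyu_leq (leqnn 1) (leq0n 1) (polyu_var R V).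
have pc (w : V) := polyu_leq (leq0n 1) (leqnn 1) (polyu_coord R w).
have pm : polyu 1 1 (fun (u : R) (eta : state R V) => u * coord eta x).
  exact: polyuM (polyu_var R V) (polyu_coord R x).
apply: (@eq_polyu _ _ 1 1 (fun u eta => if z == x then u * coord eta x
                     else if z == y then (1 - u) * coord eta x + coord eta y
                     else coord eta z)).
  by move=> u eta; rewrite coord_mk.
case: (z == x) => //; case: (z == y) => //; apply: polyuD => //.
by apply: eq_polyu (polyuB (pc x) pm) => u eta; rewrite mulrBl mul1r.
Qed.

Lemma gen_gint k g x y : polyk k g -> exists Q : state R V -> {poly R},
  [/\ forall eta u, (Q eta).[u] = g (jump x y u eta),
      forall eta, (size (Q eta) <= k.+1)%N,
      forall eta, gen x y g eta = gint (alpha x) (Q eta) & polyk k (gen x y g)].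
Proof.
move=> pg; have := polyk_comp (polyu_jump x y) pg.
move=> /(polyu_gint (alpha_gt0 x))[Q [QE Qs Qp]].
have gE eta : gen x y g eta = gint (alpha x) (Q eta).
  by apply: eq_wint => u _; rewrite !QE jump1.
by exists Q; split => //; rewrite /polyk; apply: eq_polyu Qp => u eta; rewrite gE.
Qed.

(** With [d] the removed mass and [w] the thinned state, the state is w + d e_x before the jump and
    w + d e_y after it. The increment of [g] vanishes at [d = 0], so [d] can be factored out and
    [Lam_indep] becomes applicable. *)
Lemma E_gen k l f g x y : x != y -> polyk k f -> polyk l g ->
  exists G, [/\ exists a b, polyu a b G,
   (forall d w, d * G d w = f (addst x d w) * (g (addst y d w) - g (addst x d w))) &
   E (fun eta => f eta * gen x y g eta) = Lam x (fun d w => d * G d w)].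
Proof.
move=> xy pf pg.
have pa z w : polyu 1 1 (fun d eta => coord (addst z d eta) w).
  have := polyuD (polyu_leq (leq0n 1) (leqnn 1) (polyu_coord R w))
     (polyu_leq (leqnn 1) (leq0n 1) (polyuZ (w == z)%:R (polyu_var R V))).
  by apply: eq_polyu => u eta; rewrite coord_mk.
have pK := polyuM (polyk_comp (pa x) pf)
  (polyu_leq (leq_maxl l l) (leq_maxl l l)
    (polyuB (polyk_comp (pa y) pg) (polyk_comp (pa x) pg))).
have add0 z eta : addst z 0 eta = eta.
  by apply: state_eq => w; rewrite coord_mk mulr0 addr0.
have [|G pG GE] := polyu_divX pK; first by move=> eta; rewrite !add0 subrr mulr0.
exists G; split; [by exists (k + maxn l l)%N, (k + maxn l l)%N|by []|].
have [Q [QE _ gE _]] := gen_gint x y pg.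
congr E; apply/funext => eta; rewrite gE /gint -wintZ//; last exact: bounded01_gint.
apply: eq_wint => u _; rewrite !QE jump1 -GE mulrCA; congr (_ * _).
have -> : addst x ((1 - u) * coord eta x) (thin x u eta) = eta.
  apply: state_eq => z; rewrite !coord_mk; case: eqVneq => [->|_].
    by rewrite mul1r; ring.
  by rewrite mul0r addr0.
suff -> : addst y ((1 - u) * coord eta x) (thin x u eta) = jump x y u eta by [].
apply: state_eq => z; rewrite !coord_mk; have [->|zx] := eqVneq z x.
  by rewrite (negPf xy) mul0r addr0.
by case: eqVneq => [->|_]; rewrite ?mul1r ?mul0r ?addr0// addrC.
Qed.

(** Once all terms are expressed by the same [Lam x], the two directions add up to - (f(w + d e_x) -
    f(w + d e_y)) (g(w + d e_x) - g(w + d e_y)), symmetric in [f] and [g]. *)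
Lemma E_gen_sym k l f g x y : x != y -> polyk k f -> polyk l g ->
  E (fun eta => f eta * gen x y g eta) + E (fun eta => f eta * gen y x g eta) =
  E (fun eta => g eta * gen x y f eta) + E (fun eta => g eta * gen y x f eta).
Proof.
move=> xy pf pg; have yx : y != x by rewrite eq_sym.
have [G1 [[a1 [b1 p1]] G1E ->]] := E_gen xy pf pg.
have [G2 [[a2 [b2 p2]] G2E ->]] := E_gen yx pf pg.
have [G3 [[a3 [b3 p3]] G3E ->]] := E_gen xy pg pf.
have [G4 [[a4 [b4 p4]] G4E ->]] := E_gen yx pg pf.
rewrite !(Lam_indep y x p2) !(Lam_indep y x p4) -(LamD x p1 p2) -(LamD x p3 p4).
congr Lam; apply/funext => d; apply/funext => w; rewrite !mulrDr G1E G2E G3E G4E.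
ring.
Qed.

Variable c : V -> V -> R.
Hypotheses (c_sym : forall x y, c x y = c y x) (c_diag : forall x, c x x = 0).

Definition Lgen g eta : R := \sum_x \sum_y c x y * gen x y g eta.

Lemma polyk_Lgen k g : polyk k g -> polyk k (Lgen g).
Proof.
move=> pg; apply: polyu_sum => x; apply: polyu_sum => y; apply: polyuZ.
by have [Q []] := gen_gint x y pg.
Qed.

Lemma hp_generatorE k g : polyk k g -> hp_generator c alpha g = Lgen g.
Proof.
move=> pg; apply/funext => eta; rewrite /hp_generator /Lgen pair_big /= big_mkcond.
apply: eq_bigr => -[x y] _ /=; have [->|_] := eqVneq x y; first by rewrite c_diag !mul0r.
congr (_ * _); have [Q [QE _ -> _]] := gen_gint x y pg.
rewrite -gintE//; apply: eq_Rintegral => u _; by rewrite !QE jump1.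
Qed.

Lemma E_Lgen k l f g : polyk k f -> polyk l g ->
  E (fun eta => f eta * Lgen g eta) =
  \sum_x \sum_y c x y * E (fun eta => f eta * gen x y g eta).
Proof.
move=> pf pg.
have bfg x y : bndO (fun eta => f eta * gen x y g eta).
  by have [Q [_ _ _ p]] := gen_gint x y pg; apply: polyk_bndO (polyuM pf p).
transitivity (E (fun eta => \sum_x \sum_y c x y * (f eta * gen x y g eta))).
  congr E; apply/funext => eta; rewrite mulr_sumr; apply: eq_bigr => x _.
  by rewrite mulr_sumr; apply: eq_bigr => y _; rewrite mulrCA.
rewrite E_sum => [|x]; last by apply: bndO_sum => y; apply: bndOZ.
apply: eq_bigr => x _; rewrite E_sum => [|y]; last exact: bndOZ.
by apply: eq_bigr => y _; rewrite E_Z.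
Qed.

(** As [c] is symmetric, only the sum over both directions of each edge enters, and [E_gen_sym]
    treats it. *)
Lemma Lgen_sym k l f g : polyk k f -> polyk l g ->
  E (fun eta => f eta * Lgen g eta) = E (fun eta => g eta * Lgen f eta).
Proof.
move=> pf pg; rewrite (E_Lgen pf pg) (E_Lgen pg pf).
have half (B B' : V -> V -> R) :
    (forall x y, x != y -> B x y + B y x = B' x y + B' y x) ->
    \sum_x \sum_y c x y * B x y = \sum_x \sum_y c x y * B' x y.
  move=> BB'; have two0 : (2 : R) != 0 by [].
  apply: (mulfI two0).
  have dbl (A : V -> V -> R) : 2 * (\sum_x \sum_y c x y * A x y) =
      \sum_x \sum_y c x y * (A x y + A y x).
    rewrite mulr_natl mulr2n {2}exchange_big -big_split; apply: eq_bigr => x _ /=.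
    by rewrite -big_split; apply: eq_bigr => y _ /=; rewrite (c_sym y x) mulrDr.
  rewrite !dbl; apply: eq_bigr => x _; apply: eq_bigr => y _.
  have [->|xy] := eqVneq x y; first by rewrite c_diag !mul0r.
  by rewrite BB'.
by apply: half => x y xy; exact: (E_gen_sym xy pf pg).
Qed.

Lemma LgenD k l f g : polyk k f -> polyk l g ->
  Lgen (fun eta => f eta + g eta) = fun eta => Lgen f eta + Lgen g eta.
Proof.
move=> pf pg; apply/funext => eta; rewrite /Lgen -big_split; apply: eq_bigr => x _ /=.
rewrite -big_split; apply: eq_bigr => y _ /=; rewrite -mulrDr; congr (_ * _).
have [Q [QE _ QG _]] := gen_gint x y pf; have [S [SE _ SG _]] := gen_gint x y pg.
rewrite QG SG -gintD//; apply: eq_wint => u _.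
by rewrite !hornerD !QE !SE jump1.
Qed.

Definition lin (b : V -> R) eta : R := \sum_x b x * coord eta x.

Lemma polyk_lin b : polyk 1 (lin b).
Proof. by apply: polyu_sum => x; apply: polyuZ; exact: polyu_coord. Qed.

Lemma lin_jump b x y u eta : x != y ->
  lin b (jump x y u eta) = lin b eta + (1 - u) * (coord eta x * (b y - b x)).
Proof.
move=> xy; have yx : y != x by rewrite eq_sym.
rewrite /lin (bigD1 x)//= [in RHS](bigD1 x)//= (bigD1 y yx)/=.
rewrite [in RHS](bigD1 y yx)/= !coord_mk !eqxx (negPf yx).
set A := \sum_(i | _) _; set B := \sum_(i | _) _; suff -> : A = B by ring.
apply: eq_bigr => z /andP[zx zy]; by rewrite coord_mk (negPf zx) (negPf zy).
Qed.

(** On linear functions the process acts as the random walk with rates c x y / alpha x. *)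
Lemma Lgen_lin b : Lgen (lin b) =
  lin (fun x => (\sum_y c x y * (b y - b x)) / alpha x).
Proof.
apply/funext => eta; apply: eq_bigr => x _.
rewrite !mulr_suml; apply: eq_bigr => y _.
have [->|xy] := eqVneq x y; first by rewrite c_diag !mul0r.
suff -> : gen x y (lin b) eta = coord eta x * (b y - b x) / alpha x by ring.
have b1 : bounded01 (fun=> 1 : R).
  by apply: eq_bounded01 (bounded01_horner 1) => u _; rewrite hornerC.
rewrite -wint_powR// -wintZ//; apply: eq_wint => u /andP[_ u1].
rewrite lin_jump// [X in _ * X]addrAC subrr add0r mulrA mulVf ?mul1r ?mulr1//.
by rewrite subr_eq0 gt_eqF.
Qed.

End expectation.

(** * Contraction of the Euler steps *)

Section chord_defect.
Variables (R : realType) (V : finType).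
Implicit Types (a b eta : state R V) (f g : state R V -> R) (t : R) (psi : V -> V -> R).

Definition mix t a b : state R V :=
  mk_state (fun z => (1 - t) * coord a z + t * coord b z).

Definition defect f a b t : R := (1 - t) * f a + t * f b - f (mix t a b).

Definition diff a b z : R := coord a z - coord b z.

Definition sqdist a b : R := \sum_z diff a b z ^+ 2.

Definition defect_le f psi := forall a b t, Omega a -> Omega b -> 0 <= t <= 1 ->
  `|defect f a b t| <= quad psi (diff a b).

Lemma Omega_mix t a b : Omega a -> Omega b -> 0 <= t <= 1 -> Omega (mix t a b).
Proof.
move=> [a0 a1] [b0 b1] /andP[t0 t1]; split.
  by move=> x; rewrite coord_mk addr_ge0// mulr_ge0// subr_ge0.
under eq_bigr do rewrite coord_mk.
by rewrite big_split/= -!mulr_sumr a1 b1 !mulr1 subrK.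
Qed.

Lemma sqdist_ge0 a b : 0 <= sqdist a b.
Proof. by rewrite sumr_ge0// => x _; exact: sqr_ge0. Qed.

Lemma sqdist_le2 a b : Omega a -> Omega b -> sqdist a b <= 2.
Proof.
move=> Oa Ob; have [_ a1] := Oa; have [_ b1] := Ob.
have -> : (2 : R) = \sum_z (coord a z + coord b z) by rewrite big_split/= a1 b1.
rewrite ler_sum// => z _; rewrite /diff.
have /andP[] := coord_le1 z Oa; have /andP[] := coord_le1 z Ob.
move: (coord a z) (coord b z) => p q *; nra.
Qed.

Lemma sum_diff a b : Omega a -> Omega b -> \sum_z diff a b z = 0.
Proof. by move=> [_ a1] [_ b1]; rewrite sumrB a1 b1 subrr. Qed.

(** A substitute for bounds on the derivatives up to order two: the Leibniz formula for the defect
    of a product uses all three bounds. The Lipschitz bound is squared to be comparable with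
    [sqdist]. *)
Definition C2_bound f (C : R) := forall a b t, Omega a -> Omega b -> 0 <= t <= 1 ->
  [/\ `|f a| <= C, (f a - f b) ^+ 2 <= C * sqdist a b &
      `|defect f a b t| <= C * sqdist a b].

Lemma C2_bound_le f C C' : C <= C' -> C2_bound f C -> C2_bound f C'.
Proof.
move=> CC' fC a b t Oa Ob t01; have [h1 h2 h3] := fC a b t Oa Ob t01.
have d0 := sqdist_ge0 a b; split; first exact: le_trans CC'.
  by rewrite (le_trans h2)// ler_wpM2r.
by rewrite (le_trans h3)// ler_wpM2r.
Qed.

Lemma C2_boundD f g C : 0 <= C -> C2_bound f C -> C2_bound g C ->
  C2_bound (fun eta => f eta + g eta) (4 * C).
Proof.
move=> C0 fC gC a b t Oa Ob t01; have [f1 f2 f3] := fC a b t Oa Ob t01.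
have [g1 g2 g3] := gC a b t Oa Ob t01; have d0 := sqdist_ge0 a b.
have Cd0 : 0 <= C * sqdist a b by rewrite mulr_ge0.
split.
- by rewrite (le_trans (ler_normD _ _))//; lra.
- have h : 0 <= ((f a - f b) - (g a - g b)) ^+ 2 by exact: sqr_ge0.
  have -> : f a + g a - (f b + g b) = (f a - f b) + (g a - g b) by ring.
  move: (f a - f b) (g a - g b) f2 g2 h => p q; nra.
- have -> : defect (fun eta => f eta + g eta) a b t = defect f a b t + defect g a b t.
    by rewrite /defect; ring.
  by rewrite (le_trans (ler_normD _ _))//; lra.
Qed.

Lemma C2_boundM f g C : 0 <= C -> C2_bound f C -> C2_bound g C ->
  C2_bound (fun eta => f eta * g eta) (C + 4 * C ^+ 2 + 4 * C ^+ 3).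
Proof.
move=> C0 fC gC a b t Oa Ob t01; have [f1 f2 f3] := fC a b t Oa Ob t01.
have [g1 g2 g3] := gC a b t Oa Ob t01; have d0 := sqdist_ge0 a b.
have [fb _ _] := fC b a t Ob Oa t01; have [gb _ _] := gC b a t Ob Oa t01.
have [fm _ _] := fC _ b t (Omega_mix Oa Ob t01) Ob t01.
have Cd0 : 0 <= C * sqdist a b by rewrite mulr_ge0.
have C2d0 : 0 <= C ^+ 2 * sqdist a b by rewrite mulr_ge0// exprn_ge0.
have C3d0 : 0 <= C ^+ 3 * sqdist a b by rewrite mulr_ge0// exprn_ge0.
have [C20 C30] : 0 <= C ^+ 2 /\ 0 <= C ^+ 3 by split; exact: exprn_ge0.
split.
- rewrite normrM (@le_trans _ _ (C * C))// ?ler_pM//.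
  by rewrite -expr2; lra.
- have sq x : `|x| <= C -> x ^+ 2 <= C ^+ 2.
    by move=> xC; rewrite -real_normK ?num_real// lerXn2r// ?nnegrE.
  have -> : f a * g a - f b * g b = (f a - f b) * g a + f b * (g a - g b) by ring.
  have h1 : ((f a - f b) * g a) ^+ 2 <= C ^+ 3 * sqdist a b.
    rewrite exprMn; have -> : C ^+ 3 * sqdist a b = C * sqdist a b * C ^+ 2 by ring.
    by rewrite ler_pM ?sqr_ge0 ?sq.
  have h2 : (f b * (g a - g b)) ^+ 2 <= C ^+ 3 * sqdist a b.
    rewrite exprMn; have -> : C ^+ 3 * sqdist a b = C ^+ 2 * (C * sqdist a b) by ring.
    by rewrite ler_pM ?sqr_ge0 ?sq.
  move: ((f a - f b) * g a) (f b * (g a - g b)) h1 h2 => p q h1 h2.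
  have h : 0 <= (p - q) ^+ 2 by exact: sqr_ge0.
  nra.
(* Leibniz rule for chord defects; the first term is the cross term. *)
- have -> : defect (fun eta => f eta * g eta) a b t =
      t * (1 - t) * ((f a - f b) * (g a - g b)) +
      (defect f a b t * ((1 - t) * g a + t * g b) + f (mix t a b) * defect g a b t).
    by rewrite /defect; ring.
  move: t01 => /andP[t0 t1].
  have h1 : `|t * (1 - t) * ((f a - f b) * (g a - g b))| <= C * sqdist a b.
    have hfg : `|(f a - f b) * (g a - g b)| <= C * sqdist a b.
      rewrite ler_norml; move: (f a - f b) (g a - g b) f2 g2 => p q h1 h2.
      have h : 0 <= (p - q) ^+ 2 by exact: sqr_ge0.
      have h' : 0 <= (p + q) ^+ 2 by exact: sqr_ge0.
      by apply/andP; split; nra.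
    have tt : 0 <= t * (1 - t) <= 1 by apply/andP; split; nra.
    move: tt => /andP[tt0 tt1].
    rewrite normrM (ger0_norm tt0) -[leRHS]mul1r ler_pM//.
  have hg : `|(1 - t) * g a + t * g b| <= C.
    rewrite (le_trans (ler_normD _ _))// !normrM (ger0_norm t0) ger0_norm ?subr_ge0//.
    nra.
  have h2 : `|defect f a b t * ((1 - t) * g a + t * g b)| <= C ^+ 2 * sqdist a b.
    rewrite normrM; have -> : C ^+ 2 * sqdist a b = C * sqdist a b * C by ring.
    by rewrite ler_pM.
  have h3 : `|f (mix t a b) * defect g a b t| <= C ^+ 2 * sqdist a b.
    rewrite normrM; have -> : C ^+ 2 * sqdist a b = C * (C * sqdist a b) by ring.
    by rewrite ler_pM.
  rewrite (le_trans (ler_normD _ _))// (le_trans (lerD (lexx _) (ler_normD _ _)))//.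
  lra.
Qed.

Lemma C2_bound_cst k : C2_bound (fun=> k) `|k|.
Proof.
move=> a b t Oa Ob t01; have d0 := sqdist_ge0 a b; split => //.
  by rewrite subrr expr0n mulr_ge0.
have -> : defect (fun=> k) a b t = 0 by rewrite /defect; ring.
by rewrite normr0 mulr_ge0.
Qed.

Lemma C2_bound_coord x : C2_bound (fun eta => coord eta x) 1.
Proof.
move=> a b t Oa Ob t01; have d0 := sqdist_ge0 a b; split.
- by have /andP[h0 h1] := coord_le1 x Oa; rewrite ger0_norm.
- rewrite mul1r /sqdist (bigD1 x)//= lerDl sumr_ge0// => y _; exact: sqr_ge0.
- have -> : defect (fun eta => coord eta x) a b t = 0.
    by rewrite /defect coord_mk; ring.
  by rewrite normr0 mul1r.
Qed.

Definition C2fun f := exists2 C, 0 <= C & C2_bound f C.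

Lemma C2_bound_ex2 f g : C2fun f -> C2fun g ->
  exists C, [/\ 0 <= C, C2_bound f C & C2_bound g C].
Proof.
move=> [C C0 fC] [D D0 gD]; exists (C + D); rewrite addr_ge0//; split => //.
  by apply: C2_bound_le fC; rewrite lerDl.
by apply: C2_bound_le gD; rewrite lerDr.
Qed.

Lemma C2funD f g : C2fun f -> C2fun g -> C2fun (fun eta => f eta + g eta).
Proof.
move=> hf hg; have [C [C0 fC gC]] := C2_bound_ex2 hf hg.
by exists (4 * C); [rewrite mulr_ge0|exact: C2_boundD].
Qed.

Lemma C2funM f g : C2fun f -> C2fun g -> C2fun (fun eta => f eta * g eta).
Proof.
move=> hf hg; have [C [C0 fC gC]] := C2_bound_ex2 hf hg.
exists (C + 4 * C ^+ 2 + 4 * C ^+ 3); last exact: C2_boundM.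
by rewrite !addr_ge0// mulr_ge0// exprn_ge0.
Qed.

Lemma polyk_C2fun k f : polyk k f -> C2fun f.
Proof.
move=> [r _ rE]; have -> : f = polyu_eval r 0 by apply/funext => eta; rewrite -rE.
have cst (q : R) : C2fun (fun=> q).
  by exists `|q| => //; exact: C2_bound_cst.
rewrite /polyu_eval; elim: r {rE} => [|t r IH].
  by under eq_fun do rewrite big_nil.
under eq_fun do rewrite big_cons; apply: C2funD => //; apply: C2funM => //.
rewrite /mono; elim: (index_enum V) => [|x s IHs].
  by under eq_fun do rewrite big_nil.
under eq_fun do rewrite big_cons; apply: C2funM => //.
elim: (t.2 x) => [|n IHn]; first by under eq_fun do rewrite expr0.
under eq_fun do rewrite exprS; apply: C2funM => //.
by exists 1 => //; exact: C2_bound_coord.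
Qed.

Lemma quad_scale_delta (C : R) (xi : V -> R) :
  quad (fun x y => C * delta R x y) xi = C * \sum_z xi z ^+ 2.
Proof.
rewrite quad_scalem; congr (_ * _); apply: eq_bigr => x _.
transitivity (\sum_y (xi x * xi y) * delta R x y); first by apply: eq_bigr => y _; ring.
by rewrite sum_delta expr2.
Qed.

Lemma polyk_defect_le k f : polyk k f ->
  exists psi, [/\ symm psi, psdT psi & defect_le f psi].
Proof.
move=> /polyk_C2fun[C C0 fC]; exists (fun x y => C * delta R x y); split.
- by move=> x y; rewrite /delta eq_sym.
- move=> xi _; rewrite quad_scale_delta mulr_ge0// sumr_ge0// => z _.
  exact: sqr_ge0.
- by move=> a b t Oa Ob t01; rewrite quad_scale_delta; have [] := fC a b t Oa Ob t01.
Qed.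

Definition corner x : state R V := mk_state (delta R x).

Lemma Omega_corner x : Omega (corner x).
Proof.
split; first by move=> z; rewrite coord_mk.
under eq_bigr do rewrite coord_mk.
by rewrite -[RHS](sum_delta x (fun=> 1)); apply: eq_bigr => z _; rewrite mul1r.
Qed.

(* Splitting off one corner at a time. *)
Lemma interpolation f (Y : R) : (forall a b t, Omega a -> Omega b -> 0 <= t <= 1 ->
    `|defect f a b t| <= Y) ->
  forall eta, Omega eta -> `|f eta - lin (f \o corner) eta| <= #|V|%:R * Y.
Proof.
move=> fY.
have Y0 (x : V) : 0 <= Y.
  have h : 0 <= (0 : R) <= 1 by rewrite lexx ler01.
  exact: le_trans (fY _ _ _ (Omega_corner x) (Omega_corner x) h).
suff H (s : seq V) eta : Omega eta -> (forall x, x \notin s -> coord eta x = 0) ->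
    `|f eta - lin (f \o corner) eta| <= (size s)%:R * Y.
  move=> eta O; rewrite cardE; apply: H => // x; by rewrite mem_enum.
elim: s eta => [|x s IHs] eta [e0 e1] es.
  have := e1; rewrite big1 => [/eqP|z _]; last by rewrite es.
  by rewrite eq_sym oner_eq0.
have O : Omega eta by [].
have Yx := Y0 x; have /andP[_] := coord_le1 x O.
rewrite le_eqVlt => /predU1P[ex|ex].
  have -> : eta = corner x.
    apply: state_eq => z; rewrite coord_mk /delta; case: eqVneq => [<-//|zx].
    apply/eqP; rewrite eq_le e0 andbT; move: e1; rewrite (bigD1 x)//= ex.
    rewrite (bigD1 z) 1?eq_sym//= addrA => h.
    have : 0 <= \sum_(i | (i != x) && (i != z)) coord eta i by rewrite sumr_ge0.
    move: h; move: (coord eta z) (\sum_(i | _) _) => p q h q0.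
    by clear -h q0; lra.
  have -> : lin (f \o corner) (corner x) = f (corner x).
    rewrite /lin; under eq_bigr do rewrite coord_mk /=.
    exact: (sum_delta x (fun z => f (corner z))).
  by rewrite subrr normr0 mulr_ge0.
have x1 : 1 - coord eta x != 0 by rewrite subr_eq0 eq_sym lt_eqF.
(* The rest of [eta] after removal of its mass at [x], renormalized: [eta] lies on the chord from
   the corner [x] to [eta']. *)
pose eta' : state R V := mk_state (fun z =>
  (coord eta z - coord eta x * delta R x z) / (1 - coord eta x)).
have s1 : \sum_z delta R x z = 1.
  by rewrite -[RHS](sum_delta x (fun=> 1)); apply: eq_bigr => z _; rewrite mul1r.
have O' : Omega eta'.
  split.
    move=> z; rewrite coord_mk divr_ge0 ?subr_ge0//; last exact: ltW.
    rewrite /delta; case: eqVneq => [<-|_]; first by rewrite mulr1.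
    by rewrite mulr0.
  under eq_bigr do rewrite coord_mk.
  by rewrite -mulr_suml sumrB e1 -mulr_sumr s1 mulr1 divff.
have mE : mix (1 - coord eta x) (corner x) eta' = eta.
  apply: state_eq => z; rewrite !coord_mk /delta; field.
  exact: x1.
have t01 : 0 <= 1 - coord eta x <= 1 by rewrite subr_ge0 (ltW ex)/= lerBlDr lerDl.
have hd := fY _ _ _ (Omega_corner x) O' t01.
have IH : `|f eta' - lin (f \o corner) eta'| <= (size s)%:R * Y.
  apply: IHs => // z zs; rewrite coord_mk /delta; case: eqVneq => [<-|xz].
    by rewrite mulr1 subrr mul0r.
  by rewrite mulr0 subr0 es ?mul0r// inE negb_or eq_sym xz.
have lE : lin (f \o corner) eta =
    coord eta x * f (corner x) + (1 - coord eta x) * lin (f \o corner) eta'.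
  rewrite /lin -(sum_delta x (fun z => coord eta z * f (corner z))) mulr_sumr -big_split.
  apply: eq_bigr => z _ /=; rewrite coord_mk /delta.
  by case: eqVneq => [<-|_]; rewrite ?mulr1 ?mulr0; field.
have -> : f eta - lin (f \o corner) eta =
    - defect f (corner x) eta' (1 - coord eta x) +
    (1 - coord eta x) * (f eta' - lin (f \o corner) eta').
  by rewrite lE /defect mE; ring.
apply: (le_trans (ler_normD _ _)); rewrite normrN.
rewrite -[size (x :: s)]/((size s).+1) -natr1 [leRHS]mulrDl mul1r [leRHS]addrC lerD//.
move: t01 => /andP[t0 t1]; rewrite normrM ger0_norm// (le_trans _ IH)//.
by rewrite ler_piMl.
Qed.

End chord_defect.

(** * Domination of one Euler step by a quadratic form *)

Section contraction.
Variables (R : realType) (V : finType) (c : V -> V -> R) (alpha : V -> R).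
Hypotheses (V_gt0 : (0 < #|V|)%N) (alpha_gt0 : forall x, 0 < alpha x).
Hypotheses (c_sym : forall x y, c x y = c y x) (c_ge0 : forall x y, 0 <= c x y).
Hypothesis (c_diag : forall x, c x x = 0).
Implicit Types (a b eta : state R V) (f g : state R V -> R) (t h : R).
Implicit Types (psi : V -> V -> R) (xi : V -> R).
Local Notation s := (\sum_x alpha x).
Local Notation E := (hp_mean alpha).
Local Notation L := (Lgen alpha c).

(** The linear action of a jump on differences of states ([diff_jump]). *)
Definition move (x y : V) (u : R) xi z : R :=
  xi z + ((1 - u) * xi x) * (delta R y z + -1 * delta R x z).

Lemma sum_move x y u xi : \sum_z move x y u xi z = \sum_z xi z.
Proof.
have s1 w : \sum_z delta R w z = 1.
  by rewrite -[RHS](sum_delta w (fun=> 1)); apply: eq_bigr => z _; rewrite mul1r.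
by rewrite big_split/= -mulr_sumr big_split/= -mulr_sumr !s1 mulN1r subrr mulr0 addr0.
Qed.

(** With p, q the entries at [x], [y], the changed entries contribute at most p^2 and 2 p^2 + 2 q^2,
    whence the 3. *)
Lemma sqr_move_le x y u xi : x != y -> 0 <= u <= 1 ->
  \sum_z move x y u xi z ^+ 2 <= 3 * \sum_z xi z ^+ 2.
Proof.
move=> xy /andP[u0 u1]; have yx : y != x by rewrite eq_sym.
rewrite (bigD1 x)//= [in leRHS](bigD1 x)//= (bigD1 y yx)/=.
rewrite [in leRHS](bigD1 y yx)/= /move /delta !eqxx (negPf xy) (negPf yx).
set A := \sum_(i | _) _; set B := \sum_(i | _) _.
have -> : A = B.
  apply: eq_bigr => z /andP[zx zy]; rewrite eq_sym (negPf zy) eq_sym (negPf zx).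
  by congr (_ ^+ _); ring.
have B0 : 0 <= B by rewrite sumr_ge0// => z _; exact: sqr_ge0.
move: (xi x) (xi y) => p q.
have h1 : (p + (1 - u) * p * (0 + -1 * 1)) ^+ 2 <= p ^+ 2.
  have -> : (p + (1 - u) * p * (0 + -1 * 1)) ^+ 2 = u ^+ 2 * p ^+ 2 by ring.
  by rewrite ler_piMl ?sqr_ge0// exprn_ile1.
have h2 : (q + (1 - u) * p * (1 + -1 * 0)) ^+ 2 <= 2 * p ^+ 2 + 2 * q ^+ 2.
  have h3 : 0 <= (q - (1 - u) * p) ^+ 2 by exact: sqr_ge0.
  have h4 : ((1 - u) * p) ^+ 2 <= p ^+ 2.
    by rewrite exprMn ler_piMl ?sqr_ge0// exprn_ile1// ?subr_ge0// lerBlDr lerDl.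
  nra.
have q0 := sqr_ge0 q.
rewrite mulr1n mulr0n; lra.
Qed.

Lemma diff_jump x y u a b : x != y ->
  diff (jump x y u a) (jump x y u b) =1 move x y u (diff a b).
Proof.
move=> xy z; rewrite /diff /move /diff !coord_mk /delta.
have yx : (y == x) = false by rewrite eq_sym (negPf xy).
have [->|zx] := eqVneq z x; first by rewrite yx /=; ring.
by case: eqVneq => [->|_] /=; ring.
Qed.

Lemma Omega_jump x y u eta : x != y -> Omega eta -> 0 <= u <= 1 -> Omega (jump x y u eta).
Proof.
move=> xy [e0 e1] /andP[u0 u1]; split.
  move=> z; rewrite coord_mk; case: ifP => _; first by rewrite mulr_ge0.
  by case: ifP => // _; rewrite addr_ge0// mulr_ge0// subr_ge0.
have := lin_jump (fun=> 1) u eta xy; rewrite /lin subrr !mulr0 addr0.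
under eq_bigr do rewrite mul1r.
by under [X in _ = X -> _]eq_bigr do rewrite mul1r; rewrite e1.
Qed.

Lemma jump_mix x y u t a b : jump x y u (mix t a b) = mix t (jump x y u a) (jump x y u b).
Proof.
apply: state_eq => z; rewrite !coord_mk.
by case: (z == x); case: (z == y); rewrite ?coord_mk //; ring.
Qed.

(** The form at the moved vector as a polynomial in [u] ([horner_qpoly]), written in powers of 1 - u
    so that [gint] can be read off. *)
Definition qpoly psi xi x y : {poly R} :=
  (quad psi xi)%:P + (2 * xi x * (\sum_z xi z * (psi z y - psi z x))) *: (1 - 'X) +
  (xi x ^+ 2 * dd psi x y) *: (1 - 'X) ^+ 2.

Lemma horner_qpoly psi xi x y u : symm psi ->
  (qpoly psi xi x y).[u] = quad psi (move x y u xi).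
Proof.
have X1 : (1 - 'X : {poly R}).[u] = 1 - u by rewrite !hornerE.
move=> sp; rewrite /qpoly [LHS]hornerD [X in X + _]hornerD !hornerZ hornerC horner_exp X1.
rewrite /move quadD// quadZ// -dd_quad// bilZl bilDl bilZl.
rewrite !bil_deltal.
have -> : dd psi y x = dd psi x y by rewrite /dd; ring.
have -> : \sum_z psi y z * xi z + -1 * (\sum_z psi x z * xi z) =
    \sum_z xi z * (psi z y - psi z x).
  rewrite mulN1r -sumrB; apply: eq_bigr => z _; rewrite (sp z y) (sp z x); ring.
ring.
Qed.

Lemma size_qpoly psi xi x y : (size (qpoly psi xi x y) <= 3)%N.
Proof.
have s2 : (size ((1 - 'X)%R : {poly R}) <= 2)%N.
  by rewrite (leq_trans (size_polyD _ _))// size_poly1 size_polyN size_polyX.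
rewrite (leq_trans (size_polyD _ _))// geq_max; apply/andP; split.
  rewrite (leq_trans (size_polyD _ _))// geq_max; apply/andP; split.
    by rewrite (leq_trans (size_polyC_leq1 _)).
  by rewrite (leq_trans (size_scale_leq _ _))// (leq_trans s2).
rewrite (leq_trans (size_scale_leq _ _))// expr2 (leq_trans (size_polyMleq _ _))//.
by move: s2; case: (size _) => [|[|[|]]].
Qed.

Lemma gint_qpoly al psi xi x y : 0 < al -> gint al (qpoly psi xi x y) =
  2 * xi x * (\sum_z xi z * (psi z y - psi z x)) / al +
  xi x ^+ 2 * dd psi x y / (al * (al + 1)).
Proof.
move=> a0; rewrite !gintD// gintC// add0r !gintZ//.
have e1 : gint al (1 - 'X) = al^-1.
  rewrite -wint_powR//; apply: eq_wint => u /andP[_ u1].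
  by rewrite !hornerE subrr subr0 mulVf// subr_eq0 gt_eqF.
have e2 : gint al ((1 - 'X) ^+ 2) = (al * (al + 1))^-1.
  transitivity (wint al (fun u => (1 - u) ^+ 1)).
    apply: eq_wint => u /andP[_ u1].
    rewrite !hornerE subrr expr0n /= subr0 expr2 mulrA mulVf ?mul1r//.
    by rewrite subr_eq0 gt_eqF.
  by rewrite wint_onem// /rising !big_ord_recl big_ord0 addr0 mulr1 mul1r.
by rewrite e1 e2.
Qed.

Definition jump_rate : R := \sum_x \sum_y c x y / alpha x.

(** The Euler step of [psi] plus a multiple of the Euclidean form, which absorbs the error of
    cutting the kernel. *)
Definition gen_psi (C h : R) psi x y : R :=
  (psi x y + h * gen_quad c alpha psi x y) + h * C * ell alpha psi * delta R x y.

Lemma quad_gen_psi C h psi xi : quad (gen_psi C h psi) xi =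
  quad psi xi + h * quad (gen_quad c alpha psi) xi +
  h * C * ell alpha psi * \sum_z xi z ^+ 2.
Proof. rewrite -quad_scale_delta -quad_scalem -!quad_addm.
by []. Qed.

(* [D x y] stands for a function of the state after a jump from [x] to [y], which is
   dominated by [psi]; the remainder of size [1 / m] comes from cutting the singularity
   of the jump kernel, so that the total jump rate becomes at most [m * jump_rate]. *)
Lemma quad_step K : exists2 C : R, 0 <= C & forall psi xi h m (D : V -> V -> {poly R}) d,
  symm psi -> psdT psi -> \sum_z xi z = 0 -> 0 <= h -> h * (m.+1%:R * jump_rate) <= 1 ->
  `|d| <= quad psi xi ->
  (forall x y, x != y -> [/\ (size (D x y) <= K)%N, (D x y).[1] = d &
     forall u, 0 <= u <= 1 -> `|(D x y).[u]| <= quad psi (move x y u xi)]) ->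
  d + h * \sum_x \sum_y c x y * gint (alpha x) (D x y) <=
    quad (gen_psi (C / m.+1%:R) h psi) xi.
Proof.
have [C0 C00 C0P] := @gint_ge R (maxn K 3).
have [Cq Cq0 CqP] := quad_le_ell alpha_gt0 (s_gt0 V_gt0 alpha_gt0).
pose tc : R := \sum_x \sum_y c x y.
have tc0 : 0 <= tc by rewrite sumr_ge0// => x _; rewrite sumr_ge0.
exists (C0 * (6 * Cq) * tc); first by rewrite !mulr_ge0.
move=> psi xi h m D d sp p xi0 h0 hm dq DP.
have el0 : 0 <= ell alpha psi by apply: ell_ge0 => //; exact: s_gt0.
set S := \sum_z xi z ^+ 2.
have S0 : 0 <= S by rewrite sumr_ge0// => z _; exact: sqr_ge0.
(* [B] bounds the polynomial [F] below, the form minus [D]: it is at most twice the form at the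
   moved vector, whose squared norm is at most [3 * S]. *)
pose B := 6 * Cq * ell alpha psi * S.
have B0 : 0 <= B by rewrite /B !mulr_ge0.
set G := quad psi xi - d.
have G0 : 0 <= G by rewrite subr_ge0 (le_trans (ler_norm _)).
have m0 : 0 < m.+1%:R :> R by [].
have key x y : x != y -> - (C0 * B / m.+1%:R + m.+1%:R * G / alpha x) <=
    2 * xi x * (\sum_z xi z * (psi z y - psi z x)) / alpha x +
    xi x ^+ 2 * dd psi x y / (alpha x * (alpha x + 1)) - gint (alpha x) (D x y).
  move=> xy; have [Ds D1 DB] := DP x y xy.
  rewrite -(gint_qpoly psi)// -[- gint _ _]mulN1r -gintZ// -gintD//.
  set F : {poly R} := qpoly _ _ _ _ + _.
  have F1 : F.[1] = G.
    rewrite /F hornerD hornerZ mulN1r D1 horner_qpoly//; congr (quad psi _ - _).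
    by apply/funext => z; rewrite /move subrr !mul0r addr0.
  (* [F] is nonnegative because the form dominates [D], and its value at 1 is the current slack
     [G]. *)
  have := C0P (alpha x) m.+1 F B (alpha_gt0 x).
  rewrite F1 => H; apply: (le_trans _ (H _ _)).
  - rewrite lerN2 lerD2r ler_wpM2l ?mulr_ge0//.
    by rewrite lef_pV2 ?posrE ?addr_gt0// lerDr ltW.
  - rewrite (leq_trans (size_polyD _ _))// geq_max leq_max size_qpoly orbT/=.
    by rewrite (leq_trans (size_scale_leq _ _))// leq_max Ds.
  - move=> u u01; rewrite /F hornerD hornerZ mulN1r horner_qpoly//.
    have := DB u u01; rewrite ler_norml => /andP[l1 l2].
    rewrite subr_ge0 l2/=.
    have : quad psi (move x y u xi) <= 3 * Cq * ell alpha psi * S.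
      apply: le_trans (CqP _ _ sp p _) _; first by rewrite sum_move.
      have := sqr_move_le xi xy u01; rewrite -/S => hs.
      have -> : 3 * Cq * ell alpha psi * S = Cq * ell alpha psi * (3 * S) by ring.
      by rewrite ler_wpM2l// mulr_ge0.
    rewrite /B; lra.
have sumkey : - (C0 * B / m.+1%:R * tc + m.+1%:R * G * jump_rate) <=
    quad (gen_quad c alpha psi) xi - \sum_x \sum_y c x y * gint (alpha x) (D x y).
  rewrite quad_gen_quad// /tc /jump_rate !mulr_sumr -big_split -sumrN -sumrB ler_sum// => x _.
  rewrite !mulr_sumr -big_split -sumrN -sumrB ler_sum// => y _ /=.
  have [->|xy] := eqVneq x y; first by rewrite c_diag !(mul0r, mulr0, addr0, subr0, oppr0).
  rewrite -mulrBr; apply: (le_trans _ (ler_wpM2l (c_ge0 x y) (key x y xy))).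
  by rewrite le_eqVlt; apply/orP; left; apply/eqP; ring.
have := ler_wpM2l h0 sumkey.
(* The step-size condition: what the cut kernel takes away is at most the slack available before the
   step. *)
have hG : h * (m.+1%:R * jump_rate) * G <= G by rewrite ler_piMl.
rewrite quad_gen_psi -/S.
set Z := \sum_x \sum_y _; set W := quad (gen_quad _ _ _) _.
have -> : h * (C0 * (6 * Cq) * tc / m.+1%:R) * ell alpha psi * S =
    h * (C0 * B / m.+1%:R * tc) by rewrite /B; ring.
have -> : h * - (C0 * B / m.+1%:R * tc + m.+1%:R * G * jump_rate) =
    - (h * (C0 * B / m.+1%:R * tc)) - h * (m.+1%:R * jump_rate) * G by ring.
move: hG; rewrite /G; move: (h * (C0 * B / m.+1%:R * tc)) (h * (m.+1%:R * jump_rate) * _) => A1 A2.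
rewrite mulrBr; lra.
Qed.

End contraction.

(** * The spectral gap inequality for polynomials *)

Section poly_gap.
Variables (R : realType) (V : finType) (c : V -> V -> R) (alpha : V -> R).
Hypotheses (V_gt0 : (0 < #|V|)%N) (alpha_gt0 : forall x, 0 < alpha x).
Hypotheses (c_sym : forall x y, c x y = c y x) (c_ge0 : forall x y, 0 <= c x y).
Hypothesis (c_diag : forall x, c x x = 0).
Implicit Types (a b eta : state R V) (f g p q : state R V -> R) (t h : R).
Implicit Types (psi : V -> V -> R) (xi : V -> R).
Local Notation s := (\sum_x alpha x).
Local Notation E := (hp_mean alpha).
Local Notation L := (Lgen alpha c).
Local Notation rate := (jump_rate c alpha).

Definition euler h f eta : R := f eta + h * L f eta.

Lemma polyk_euler k h f : polyk k f -> polyk k (euler h f).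
Proof. by move=> pf; exact: (polyuD pf (polyuZ h (polyk_Lgen alpha_gt0 c pf))). Qed.

Lemma ell_addm psi psi' : ell alpha (fun x y => psi x y + psi' x y) =
  ell alpha psi + ell alpha psi'.
Proof.
rewrite /ell; have -> : \sum_x alpha x * (psi x x + psi' x x) =
    \sum_x alpha x * psi x x + \sum_x alpha x * psi' x x.
  by rewrite -big_split; apply: eq_bigr => x _; rewrite mulrDr.
have -> : \sum_x \sum_y alpha x * alpha y * (psi x y + psi' x y) =
    \sum_x \sum_y alpha x * alpha y * psi x y + \sum_x \sum_y alpha x * alpha y * psi' x y.
  rewrite -big_split; apply: eq_bigr => x _; rewrite -big_split.
  by apply: eq_bigr => y _; rewrite mulrDr.
by rewrite mulrDl; ring.
Qed.

Lemma ell_scalem k psi : ell alpha (fun x y => k * psi x y) = k * ell alpha psi.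
Proof.
rewrite /ell mulrBr mulrA !mulr_sumr; congr (_ - _ / _).
  by apply: eq_bigr => x _; rewrite mulrCA.
apply: eq_bigr => x _; rewrite mulr_sumr; apply: eq_bigr => y _.
by rewrite mulrCA.
Qed.

Lemma ell_delta_le : ell alpha (delta R (V := V)) <= s.
Proof.
rewrite /ell; have -> : \sum_x alpha x * delta R x x = s.
  by apply: eq_bigr => x _; rewrite /delta eqxx mulr1.
rewrite lerBlDr lerDl divr_ge0 ?(ltW (s_gt0 V_gt0 alpha_gt0))//.
by apply: sumr_ge0 => x _; apply: sumr_ge0 => y _; rewrite !mulr_ge0// ltW.
Qed.

Lemma defect_step k : exists2 C : R, 0 <= C & forall f psi h m,
  polyk k f -> symm psi -> psdT psi -> 0 <= h -> h * (m.+1%:R * rate) <= 1 ->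
  defect_le f psi -> exists psi', [/\ symm psi', psdT psi', defect_le (euler h f) psi' &
    ell alpha psi' <=
      ell alpha psi + h * ell alpha (gen_quad c alpha psi) + h * C / m.+1%:R * ell alpha psi].
Proof.
have s0 := s_gt0 V_gt0 alpha_gt0.
have [C C0 CP] := quad_step V_gt0 alpha_gt0 c_ge0 c_diag k.+1.
exists (C * s); first by rewrite mulr_ge0// ltW.
move=> f psi h m pf sp p h0 hm df; have el0 : 0 <= ell alpha psi by apply: ell_ge0.
exists (gen_psi c alpha (C / m.+1%:R) h psi); split.
- move=> x y; rewrite /gen_psi (sp x y) (symm_gen_quad c alpha psi x y) /delta.
  by rewrite eq_sym.
- move=> xi xi0.
  have := CP psi xi h m (fun _ _ => 0) 0 sp p xi0 h0 hm.
  rewrite normr0 => H; apply: (le_trans _ (H (p _ xi0) _)).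
    rewrite add0r big1 ?mulr0// => x _; rewrite big1// => y _.
    by rewrite -polyC0 gintC// mulr0.
  move=> x y xy; split; [by rewrite size_poly0|by rewrite horner0|move=> u u01].
  by rewrite horner0 normr0; apply: p; rewrite sum_move.
- move=> a b t Oa Ob t01.
  pose Q x y := projT1 (cid (gen_gint alpha_gt0 x y pf)).
  have QP x y : [/\ forall eta u, (Q x y eta).[u] = f (jump x y u eta),
      forall eta, (size (Q x y eta) <= k.+1)%N,
      forall eta, gen alpha x y f eta = gint (alpha x) (Q x y eta) &
      polyk k (gen alpha x y f)] by exact: projT2 (cid (gen_gint alpha_gt0 x y pf)).
  (* Since jumps commute with [mix], this is the defect of [f] between the two jumped states, as a
     polynomial in [u]. *)
  pose D x y : {poly R} := (1 - t) *: Q x y a + t *: Q x y b + (-1) *: Q x y (mix t a b).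
  have DE x y u : (D x y).[u] = defect f (jump x y u a) (jump x y u b) t.
    have [QE _ _ _] := QP x y; rewrite /D [LHS]hornerD [X in X + _]hornerD.
    by rewrite !hornerZ !QE /defect jump_mix mulN1r.
  have Ds x y : (size (D x y) <= k.+1)%N.
    have [_ Qs _ _] := QP x y.
    rewrite (leq_trans (size_polyD _ _))// geq_max; apply/andP; split.
      rewrite (leq_trans (size_polyD _ _))// geq_max; apply/andP; split;
      by rewrite (leq_trans (size_scale_leq _ _)).
    by rewrite (leq_trans (size_scale_leq _ _)).
  have gD x y : gint (alpha x) (D x y) = defect (gen alpha x y f) a b t.
    have [_ _ QG _] := QP x y; rewrite /D !gintD// !gintZ// /defect !QG.
    by rewrite mulN1r.
  have eE : defect (euler h f) a b t = defect f a b t +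
      h * \sum_x \sum_y c x y * gint (alpha x) (D x y).
    have -> : \sum_x \sum_y c x y * gint (alpha x) (D x y) = defect (L f) a b t.
      rewrite /defect /Lgen !mulr_sumr -big_split -sumrB; apply: eq_bigr => x _ /=.
      rewrite !mulr_sumr -big_split -sumrB; apply: eq_bigr => y _ /=.
      by rewrite gD /defect; ring.
    by rewrite /defect /euler; ring.
  have dom x y u : x != y -> 0 <= u <= 1 -> `|(D x y).[u]| <= quad psi (move x y u (diff a b)).
    move=> xy u01; rewrite DE -(eq_quad _ (diff_jump u a b xy)).
    by apply: df => //; exact: Omega_jump.
  have D1 x y : (D x y).[1] = defect f a b t by rewrite DE !jump1.
  rewrite eE ler_norml; apply/andP; split; last first.
    apply: CP => //; [exact: sum_diff|exact: df|].
    by move=> x y xy; split => // u u01; exact: dom.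
  rewrite lerNl opprD -mulrN.
  have -> : - (\sum_x \sum_y c x y * gint (alpha x) (D x y)) =
      \sum_x \sum_y c x y * gint (alpha x) ((-1) *: D x y).
    rewrite -sumrN; apply: eq_bigr => x _; rewrite -sumrN; apply: eq_bigr => y _.
    by rewrite gintZ//; ring.
  apply: CP => //; [exact: sum_diff|by rewrite normrN; exact: df|].
  move=> x y xy; split; first by rewrite (leq_trans (size_scale_leq _ _)).
    by rewrite hornerZ D1 mulN1r.
  by move=> u u01; rewrite hornerZ mulN1r normrN; exact: dom.
- have -> : ell alpha (gen_psi c alpha (C / m.+1%:R) h psi) =
     ell alpha psi + h * ell alpha (gen_quad c alpha psi) +
     h * (C / m.+1%:R) * ell alpha psi * ell alpha (delta R (V := V)).
    etransitivity; first exact: (ell_addm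
      (fun x y => psi x y + h * gen_quad c alpha psi x y)
      (fun x y => h * (C / m.+1%:R) * ell alpha psi * delta R x y)).
    by rewrite (ell_addm psi (fun x y => h * gen_quad c alpha psi x y)) !ell_scalem.
  rewrite lerD2l.
  have -> : h * (C * s) / m.+1%:R * ell alpha psi = h * (C / m.+1%:R) * ell alpha psi * s.
    by ring.
  by rewrite ler_wpM2l ?ell_delta_le// !mulr_ge0// divr_ge0.
Qed.

Lemma E_lin (b : V -> R) : E (lin b) = (\sum_x alpha x * b x) / s.
Proof.
rewrite /lin (E_sum V_gt0 alpha_gt0) => [|x]; last by apply: bndOZ; exact: polyk_bndO (polyu_coord R x).
rewrite mulr_suml; apply: eq_bigr => x _.
rewrite E_Z//; last exact: polyk_bndO (polyu_coord R x).
by rewrite E_coord//; ring.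
Qed.

Lemma E_mul_lin k q (b : V -> R) : polyk k q ->
  E (fun eta => q eta * lin b eta) = \sum_x b x * E (fun eta => q eta * coord eta x).
Proof.
move=> pq; have bq x : bndO (fun eta => q eta * coord eta x).
  exact: polyk_bndO (polyuM pq (polyu_coord R x)).
transitivity (E (fun eta => \sum_x b x * (q eta * coord eta x))).
  congr E; apply/funext => eta; rewrite /lin mulr_sumr; apply: eq_bigr => x _.
  by rewrite mulrCA.
rewrite (E_sum V_gt0 alpha_gt0) => [|x]; last exact: bndOZ.
by apply: eq_bigr => x _; rewrite E_Z.
Qed.

Lemma E_lin_coord (b : V -> R) y : E (fun eta => lin b eta * coord eta y) =
  alpha y * (\sum_x alpha x * b x + b y) / (s * (s + 1)).
Proof.
have -> : (fun eta => lin b eta * coord eta y) = (fun eta => coord eta y * lin b eta).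
  by apply/funext => eta; rewrite mulrC.
rewrite (E_mul_lin b (polyu_coord R y)).
transitivity (\sum_x (alpha y * (alpha x * b x) / (s * (s + 1)) +
   (alpha y * b x) / (s * (s + 1)) * delta R y x)).
  apply: eq_bigr => x _; rewrite E_coord2// /delta; case: eqVneq => [->|_] /=; ring.
by rewrite big_split/= sum_delta -mulr_suml -mulr_sumr; ring.
Qed.

Lemma E_lin2 (b b' : V -> R) : E (fun eta => lin b eta * lin b' eta) =
  ((\sum_x alpha x * b x) * (\sum_x alpha x * b' x) + \sum_x alpha x * b x * b' x) /
    (s * (s + 1)).
Proof.
rewrite (E_mul_lin b' (polyk_lin b)).
under eq_bigr do rewrite E_lin_coord.
transitivity (\sum_x ((\sum_x alpha x * b x) * (alpha x * b' x) + alpha x * b x * b' x) /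
    (s * (s + 1))).
  by apply: eq_bigr => x _; ring.
by rewrite -mulr_suml big_split/= -mulr_sumr.
Qed.

Lemma E_mul_le k l f g : polyk k f -> polyk l g ->
  E (fun eta => f eta * g eta) ^+ 2 <=
  E (fun eta => f eta * f eta) * E (fun eta => g eta * g eta).
Proof.
move=> pf pg.
have bfg := polyk_bndO (polyuM pf pg); have bff := polyk_bndO (polyuM pf pf).
have bgg := polyk_bndO (polyuM pg pg).
set A := E (fun eta => f eta * f eta); set B := E (fun eta => g eta * g eta).
set M := E (fun eta => f eta * g eta).
have H u : 0 <= A + 2 * u * M + u ^+ 2 * B.
  have -> : A + 2 * u * M + u ^+ 2 * B = E (fun eta => (f eta + u * g eta) ^+ 2).
    rewrite /A /M /B -!E_Z// -!E_D//; first by congr E; apply/funext => eta; ring.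
    - by apply: bndOD => //; exact: bndOZ.
    - exact: bndOZ.
    - exact: bndOZ.
  apply: (E_ge0 V_gt0 alpha_gt0) => [|eta _]; last exact: sqr_ge0.
  apply: (@polyk_bndO _ _ (2 * maxn k l)%N).
  have := polyuX 2 (polyuD (polyu_leq (leqnn 0) (leq_maxl k l) pf)
    (polyuZ u (polyu_leq (leqnn 0) (leq_maxr k l) pg))).
  by rewrite muln0.
have B0 : 0 <= B by apply: (E_ge0 V_gt0 alpha_gt0) => // eta _; rewrite -expr2 sqr_ge0.
have := B0; rewrite le_eqVlt => /predU1P[B00|Bp].
  have [->|M0] := eqVneq M 0; first by rewrite expr0n -B00 mulr0.
  have := H (- (A + 1) / (2 * M)); rewrite -B00 mulr0 addr0.
  have -> : A + 2 * (- (A + 1) / (2 * M)) * M = -1 by field.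
  by rewrite lerNr oppr0 ler10.
have := H (- M / B).
have -> : A + 2 * (- M / B) * M + (- M / B) ^+ 2 * B = (A * B - M ^+ 2) / B.
  by field; rewrite gt_eqF.
by rewrite pmulr_lge0 ?invr_gt0// subr_ge0.
Qed.

Lemma energy_lin (b : V -> R) :
  - E (fun eta => lin b eta * L (lin b) eta) = energy c b / (s * (s + 1)).
Proof.
have an0 x : alpha x != 0 by rewrite gt_eqF.
rewrite (Lgen_lin alpha_gt0 c_diag) E_lin2 -mulNr; congr (_ / _).
have anti (f : V -> V -> R) : (forall x y, f x y = - f y x) -> \sum_x \sum_y f x y = 0.
  move=> fa; have e : \sum_x \sum_y f x y = - \sum_x \sum_y f x y.
    rewrite [LHS]exchange_big -sumrN; apply: eq_bigr => x _; rewrite -sumrN.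
    by apply: eq_bigr => y _.
  by apply/eqP; rewrite -[_ == _](@mulrn_eq0 _ _ 2) mulr2n {2}e subrr.
have -> : \sum_x alpha x * ((\sum_y c x y * (b y - b x)) / alpha x) = 0.
  rewrite -[RHS](anti (fun x y => c x y * (b y - b x))) => [|x y].
    by apply: eq_bigr => x _; field.
  by rewrite (c_sym x y); ring.
rewrite mulr0 add0r /energy.
transitivity (- \sum_x \sum_y c x y * (b x * (b y - b x))).
  congr (- _); apply: eq_bigr => x _.
  transitivity (b x * \sum_y c x y * (b y - b x)); first by field.
  by rewrite mulr_sumr; apply: eq_bigr => y _; ring.
have : \sum_x \sum_y c x y * (b y ^+ 2 - b x ^+ 2) = 0.
  by apply: anti => x y; rewrite (c_sym x y); ring.
have -> : \sum_x \sum_y c x y * (b y ^+ 2 - b x ^+ 2) =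
   \sum_x \sum_y c x y * (b x - b y) ^+ 2 + 2 * \sum_x \sum_y c x y * (b x * (b y - b x)).
  rewrite mulr_sumr -big_split; apply: eq_bigr => x _ /=.
  by rewrite mulr_sumr -big_split; apply: eq_bigr => y _ /=; ring.
set X := \sum_x \sum_y c x y * (b x - b y) ^+ 2; set Y := \sum_x \sum_y _ * (b x * _).
move=> h; have -> : X = - (2 * Y) by apply/eqP; rewrite -subr_eq0 opprK h.
by field.
Qed.

Lemma var_lin (b : V -> R) :
  E (fun eta => lin b eta * lin b eta) - E (lin b) ^+ 2 = var_alpha alpha b / (s * (s + 1)).
Proof.
have s0 := s_gt0 V_gt0 alpha_gt0.
rewrite E_lin2 E_lin /var_alpha.
have -> : \sum_x alpha x * b x * b x = \sum_x alpha x * b x ^+ 2.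
  by apply: eq_bigr => x _; ring.
by field; rewrite !gt_eqF// addr_gt0.
Qed.

Variables (g gm : R).
Hypothesis (gP : forall phi, g * var_alpha alpha phi <= energy c phi).
Hypothesis (gmP : forall x y, 0 < c x y ->
     gm <= alpha x / (alpha x + 1) + alpha y / (alpha y + 1)).
Hypotheses (g0 : 0 <= g) (gm0 : 0 <= gm).

Let kappa := (1 + s^-1) * gm * g.

Let kappa0 : 0 <= kappa.
Proof.
by rewrite /kappa !mulr_ge0// addr_ge0// invr_ge0 ltW// (s_gt0 V_gt0 alpha_gt0).
Qed.

Lemma defect_iter k : exists2 C : R, 0 <= C & forall f psi h m N,
  polyk k f -> symm psi -> psdT psi -> 0 <= h -> h * (m.+1%:R * rate) <= 1 ->
  0 <= 1 - h * kappa + h * C / m.+1%:R ->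
  defect_le f psi -> exists psi', [/\ symm psi', psdT psi',
    defect_le (iter N (euler h) f) psi' &
    ell alpha psi' <= (1 - h * kappa + h * C / m.+1%:R) ^+ N * ell alpha psi].
Proof.
have [C C0 CP] := defect_step k; exists C => // f psi h m N pf sp p h0 hm r0 df.
have s0 := s_gt0 V_gt0 alpha_gt0.
have pi : polyk k (iter N (euler h) f).
  by elim: N => //= N IHN; exact: polyk_euler.
elim: N pi => [|N IHN] pi; first by exists psi; rewrite expr0 mul1r.
have piN : polyk k (iter N (euler h) f).
  by elim: (N) => //= n IHn; exact: polyk_euler.
have [psi1 [sp1 p1 d1 e1]] := IHN piN.
have [psi2 [sp2 p2 d2 e2]] := CP _ _ _ _ piN sp1 p1 h0 hm d1.
exists psi2; split => //; rewrite exprS -mulrA.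
apply: le_trans (ler_wpM2l r0 e1); apply: (le_trans e2).
have := ell_gen_quad_le c_sym c_ge0 alpha_gt0 s0 sp1 p1 gm0 gP gmP.
rewrite -/kappa => /(ler_wpM2l h0).
move: (ell _ psi1) (ell _ (gen_quad _ _ _)) (h * C / _) (kappa) => X Y Z ka.
by rewrite !mulrDl mul1r !mulNr mulrN mulrA; lra.
Qed.

Lemma E_euler_sym k h f f' : polyk k f -> polyk k f' ->
  E (fun eta => euler h f eta * f' eta) = E (fun eta => f eta * euler h f' eta).
Proof.
move=> pf pf'; have bff' := polyk_bndO (polyuM pf pf').
have pL := polyk_Lgen alpha_gt0 c pf; have pL' := polyk_Lgen alpha_gt0 c pf'.
have b1 := polyk_bndO (polyuM pf' pL); have b2 := polyk_bndO (polyuM pf pL').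
transitivity (E (fun eta => f eta * f' eta + h * (f' eta * L f eta))).
  by congr E; apply/funext => eta; rewrite /euler; ring.
rewrite E_D//; last exact: bndOZ.
rewrite E_Z// (Lgen_sym V_gt0 alpha_gt0 c_sym c_diag pf' pf) -E_Z// -E_D//; last exact: bndOZ.
by congr E; apply/funext => eta; rewrite /euler; ring.
Qed.

Lemma E_iter_euler k h f i : polyk k f ->
  E (fun eta => iter i (euler h) f eta * iter i (euler h) f eta) =
  E (fun eta => f eta * iter (i + i) (euler h) f eta).
Proof.
move=> pf; have pi j : polyk k (iter j (euler h) f).
  by elim: j => //= j IHj; exact: polyk_euler.
suff H j n : E (fun eta => iter j (euler h) f eta * iter n (euler h) f eta) =
    E (fun eta => f eta * iter (j + n) (euler h) f eta) by exact: H.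
elim: j n => [//|j IHj] n; rewrite iterS (E_euler_sym h (pi j) (pi n)).
by rewrite -iterS IHj addSnnS.
Qed.

(* The powers of two of the symmetric operator [euler h] are compared with
   [defect_iter] by Cauchy-Schwarz, so that no spectral theorem is needed. *)
Lemma power_method k h q (rho C : R) : polyk k q -> 0 < rho ->
  (forall N, E (fun eta => q eta * iter N (euler h) q eta) <= C * rho ^+ N) ->
  E (fun eta => q eta * euler h q eta) <= rho * E (fun eta => q eta * q eta).
Proof.
move=> pq r0 aC; have pi j : polyk k (iter j (euler h) q).
  by elim: j => //= j IHj; exact: polyk_euler.
pose A N := E (fun eta => q eta * iter N (euler h) q eta).
have A2 i : A i ^+ 2 <= A 0%N * A (i + i)%N.
  by rewrite /A -(E_iter_euler h i pq); exact: (E_mul_le pq (pi i)).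
have A0 : 0 <= A 0%N.
  apply: (E_ge0 V_gt0 alpha_gt0); first exact: polyk_bndO (polyuM pq pq).
  by move=> eta _; rewrite /= -expr2 sqr_ge0.
rewrite -[leLHS]/(A 1%N) -[X in _ * X]/(A 0%N) leNgt; apply/negP => A1.
move: (A0); rewrite le_eqVlt => /predU1P[A00|A0p].
  by have := A2 1%N; rewrite -A00 mul0r => h1; have := A1; rewrite -A00 mulr0; nra.
(* If the Rayleigh quotient [r] exceeded [rho], the inequality [A2] would propagate it along powers
   of two and force the growth r^(2^j), against the bound in rho^(2^j). *)
pose r := A 1%N / A 0%N.
have rr : rho < r by rewrite ltr_pdivlMr.
have rp : 0 < r by apply: lt_trans rr.
have Aj j : A 0%N * r ^+ (2 ^ j) <= A (2 ^ j)%N.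
  elim: j => [|j IHj]; first by rewrite expn0 expr1 mulrC divfK ?gt_eqF.
  rewrite expnS mul2n -addnn -(ler_pM2l A0p); apply: le_trans (A2 _).
  have -> : A 0%N * (A 0%N * r ^+ (2 ^ j + 2 ^ j)) = (A 0%N * r ^+ (2 ^ j)) ^+ 2.
    by rewrite exprD; ring.
  by rewrite lerXn2r// nnegrE ?mulr_ge0 ?exprn_ge0 ?(ltW rp)//;
     apply: le_trans IHj; rewrite mulr_ge0// exprn_ge0// ltW.
have rr1 : 0 < r / rho - 1 by rewrite subr_gt0 ltr_pdivlMr// mul1r.
(* Bernoulli's inequality: the ratio of the two bounds grows at least linearly. *)
have bern (n : nat) : n%:R * (r / rho - 1) <= (r / rho) ^+ n.
  elim: n => [|n IHn]; first by rewrite mul0r exprn_ge0// divr_ge0// ltW.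
  have e1 : 1 <= (r / rho) ^+ n by rewrite exprn_ege1// -subr_ge0 ltW.
  rewrite exprS -natr1.
  have -> : r / rho * (r / rho) ^+ n = (r / rho) ^+ n + (r / rho - 1) * (r / rho) ^+ n by ring.
  rewrite mulrDl mul1r lerD// ler_peMr//; exact: ltW.
have Cr j : (2 ^ j)%:R * (r / rho - 1) <= C / A 0%N.
  apply: (le_trans (bern _)); rewrite ler_pdivlMr// mulrC expr_div_n mulrA.
  by rewrite ler_pdivrMr ?exprn_gt0// (le_trans (Aj j))// aC.
pose n := Num.truncn (C / A 0%N / (r / rho - 1)).
have := Cr n.+1; rewrite -ler_pdivlMr//; apply/negP; rewrite -ltNge.
apply: (lt_le_trans (truncnS_gt _)); rewrite ler_nat.
exact/ltnW/ltn_expl.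
Qed.

(** For each cutoff [m] one step [h] suffices: the bound on [euler h] is affine in [h], so dividing
    by [h] loses nothing, and the remaining error C / m vanishes as [m] grows. *)
Lemma gap_orth k q : polyk k q -> (forall x, E (fun eta => q eta * coord eta x) = 0) ->
  kappa * E (fun eta => q eta * q eta) <= - E (fun eta => q eta * L q eta).
Proof.
move=> pq q0; have [C C0 CP] := defect_iter k.
have [psi [sp p dq]] := polyk_defect_le pq.
have s0 := s_gt0 V_gt0 alpha_gt0.
have [Cq Cq0 CqP] := quad_le_ell alpha_gt0 s0.
have bq := polyk_bndO pq; have bqq := polyk_bndO (polyuM pq pq).
have pL := polyk_Lgen alpha_gt0 c pq; have bqL := polyk_bndO (polyuM pq pL).
have [_ [Cb qb]] := bq.
have rate0 : 0 <= rate.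
  by rewrite /jump_rate sumr_ge0// => x _; rewrite sumr_ge0// => y _; rewrite divr_ge0// ltW.
have A0 : 0 <= E (fun eta => q eta * q eta).
  by apply: (E_ge0 V_gt0 alpha_gt0) => // eta _; rewrite -expr2 sqr_ge0.
have Hm (m : nat) : (kappa - C / m.+1%:R) * E (fun eta => q eta * q eta) <=
    - E (fun eta => q eta * L q eta).
  have Sp : 0 < 1 + m.+1%:R * rate + kappa.
    by rewrite ltr_wpDr// ltr_wpDr// mulr_ge0.
  (* This meets the step-size condition and also makes the contraction factor positive. *)
  pose h := (1 + m.+1%:R * rate + kappa)^-1.
  have hp : 0 < h by rewrite invr_gt0.
  have hm : h * (m.+1%:R * rate) <= 1.
    by rewrite mulrC ler_pdivrMr// mul1r -addrA addrCA lerDl addr_ge0.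
  have hk : h * kappa < 1.
    by rewrite mulrC ltr_pdivrMr// mul1r ltrDr ltr_wpDr// mulr_ge0.
  have r0 : 0 < 1 - h * kappa + h * C / m.+1%:R.
    by rewrite ltr_wpDr ?subr_gt0// divr_ge0// mulr_ge0// ltW.
  set rho := 1 - h * kappa + h * C / m.+1%:R in r0.
  (* The constant combines the bound of [q] on the simplex, the number of corners used in
     [interpolation], and the squared diameter 2 of the simplex. *)
  have := @power_method k h q rho (`|Cb| * (#|V|%:R * (2 * Cq * ell alpha psi))) pq r0.
  move=> PM; have {PM} : E (fun eta => q eta * euler h q eta) <=
      rho * E (fun eta => q eta * q eta).
    apply: PM => N.
    have [psi' [sp' p' d' e']] := CP q psi h m N pq sp p (ltW hp) hm (ltW r0) dq.
    set f := iter N (euler h) q in d' *.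
    have pf : polyk k f by rewrite /f; elim: (N) => //= n IHn; exact: polyk_euler.
    have el' := ell_ge0 alpha_gt0 s0 sp' p'.
    have Y a b t : Omega a -> Omega b -> 0 <= t <= 1 ->
        `|defect f a b t| <= 2 * Cq * ell alpha psi'.
      move=> Oa Ob t01; apply: (le_trans (d' _ _ _ Oa Ob t01)).
      apply: (le_trans (CqP _ _ sp' p' (sum_diff Oa Ob))).
      have -> : 2 * Cq * ell alpha psi' = Cq * ell alpha psi' * 2 by ring.
      by rewrite ler_wpM2l ?mulr_ge0//; exact: sqdist_le2.
    have fl := interpolation Y.
    have pl := polyk_lin (f \o corner R (V := V)).
    have bql := polyk_bndO (polyuM pq pl); have bqf := polyk_bndO (polyuM pq pf).
    have ql0 : E (fun eta => q eta * lin (f \o corner R (V := V)) eta) = 0.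
      by rewrite (E_mul_lin _ pq) big1// => x _; rewrite q0 mulr0.
    (* By orthogonality the affine interpolant of the iterate can be subtracted, which leaves a
       quantity controlled by the defect. *)
    rewrite -[leLHS]subr0 -ql0 -E_B//.
    set K := `|Cb| * _.
    rewrite -[leRHS](E_cst alpha); apply: (le_E V_gt0 alpha_gt0).
    - have := bndOD bqf (bndOZ (-1) bql).
      by under eq_fun do rewrite mulN1r.
    - exact: bndO_cst.
    - move=> eta O; rewrite -mulrBr (le_trans (ler_norm _))// normrM.
      rewrite /K -!mulrA ler_pM// ?(le_trans (qb _ O)) ?ler_norm//.
      apply: (le_trans (fl _ O)); rewrite ler_wpM2l// -!mulrA ler_wpM2l// ler_wpM2l//.
      by rewrite mulrC.
  have -> : E (fun eta => q eta * euler h q eta) = E (fun eta => q eta * q eta) +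
      h * E (fun eta => q eta * L q eta).
    rewrite -E_Z// -E_D//; last exact: bndOZ.
    by congr E; apply/funext => eta; rewrite /euler; ring.
  set A := E _; set B := E _; move=> H.
  have {}H : h * ((kappa - C / m.+1%:R) * A) <= h * - B.
    have -> : h * ((kappa - C / m.+1%:R) * A) = A - rho * A by rewrite /rho; ring.
    by rewrite lerBlDr mulrN [leRHS]addrC lerBrDr.
  by move: H; rewrite ler_pM2l.
move: (E _) A0 Hm => A A0; move: (- E _) => B Hm.
rewrite leNgt; apply/negP => BA; have d0 : 0 < kappa * A - B by rewrite subr_gt0.
(* A cutoff so large that the error C / m is smaller than the supposed deficit. *)
pose n := Num.truncn (C * A / (kappa * A - B)).
have := Hm n; rewrite mulrBl lerBlDr -lerBlDl [leRHS]mulrAC ler_pdivlMr//.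
apply/negP; rewrite -ltNge [ltRHS]mulrC -ltr_pdivrMr//; exact: truncnS_gt.
Qed.

Lemma sum_coord_E k q : polyk k q ->
  \sum_x E (fun eta => q eta * coord eta x) = E q.
Proof.
move=> pq; have bq x := polyk_bndO (polyuM pq (polyu_coord R x)).
rewrite -(E_sum V_gt0 alpha_gt0) => [|x]; last exact: bq.
apply: (eq_E V_gt0 alpha_gt0); [exact: bndO_sum|exact: polyk_bndO pq|].
by move=> eta [_ e1]; rewrite -mulr_sumr e1 mulr1.
Qed.

(** [r <= 1] serves the affine part of [p], and the bound of [r] by [(1 + s^-1) * gm] the orthogonal
    part, through [gap_orth]. *)
Lemma poly_gap k r p : polyk k p -> 0 <= r -> r <= 1 -> r <= (1 + s^-1) * gm ->
  r * g * (E (fun eta => p eta * p eta) - E p ^+ 2) <= - E (fun eta => p eta * L p eta).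
Proof.
move=> pp r0 r1 rgm; have s0 := s_gt0 V_gt0 alpha_gt0.
have sn0 : s != 0 by rewrite gt_eqF.
have s1n0 : s + 1 != 0 by rewrite gt_eqF// addr_gt0.
have an0 x : alpha x != 0 by rewrite gt_eqF.
(* The solution of the normal equations given by [E_lin_coord], for which the sum of alpha_x b_x
   must be s E(p). No constant term is added: on the simplex constants are linear. *)
pose b x := s * (s + 1) * E (fun eta => p eta * coord eta x) / alpha x - s * E p.
have ab : \sum_x alpha x * b x = s * E p.
  transitivity (\sum_x (s * (s + 1) * E (fun eta => p eta * coord eta x) - alpha x * (s * E p))).
    by apply: eq_bigr => x _; rewrite /b; field.
  by rewrite sumrB -mulr_sumr (sum_coord_E pp) -mulr_suml; ring.
pose n := (k + 1)%N.
have pb : polyk n (lin b) by apply: polyu_leq (polyk_lin b); rewrite // leq_addl.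
have pn : polyk n p by apply: polyu_leq pp; rewrite // leq_addr.
pose q eta := p eta + (-1) * lin b eta.
have pq : polyk n q by exact: polyuD pn (polyuZ (-1) pb).
have pE : p = fun eta => lin b eta + q eta.
  by apply/funext => eta; rewrite /q; ring.
have qx x : E (fun eta => q eta * coord eta x) = 0.
  transitivity (E (fun eta => p eta * coord eta x + (-1) * (lin b eta * coord eta x))).
    by congr E; apply/funext => eta; rewrite /q; ring.
  have bpx := polyk_bndO (polyuM pn (polyu_coord R x)).
  have bbx := polyk_bndO (polyuM pb (polyu_coord R x)).
  rewrite E_D//; last exact: bndOZ.
  rewrite E_Z// E_lin_coord ab /b.
  by field; rewrite sn0 s1n0 an0.
have Eq0 : E q = 0 by rewrite -(sum_coord_E pq) big1.
have qlin d : E (fun eta => q eta * lin d eta) = 0.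
  by rewrite (E_mul_lin d pq) big1// => x _; rewrite qx mulr0.
have bbq := polyk_bndO (polyuM pb pq); have bqb := polyk_bndO (polyuM pq pb).
have bbb := polyk_bndO (polyuM pb pb); have bqq := polyk_bndO (polyuM pq pq).
have Ep : E p = E (lin b).
  by rewrite pE E_D ?Eq0 ?addr0//; [exact: polyk_bndO pb|exact: polyk_bndO pq].
have pLq := polyk_Lgen alpha_gt0 c pq; have pLb := polyk_Lgen alpha_gt0 c pb.
have Epp : E (fun eta => p eta * p eta) =
    E (fun eta => lin b eta * lin b eta) + E (fun eta => q eta * q eta).
  transitivity (E (fun eta => (lin b eta * lin b eta + q eta * q eta) +
      2 * (q eta * lin b eta))).
    by congr E; apply/funext => eta; rewrite {1 2}pE; ring.
  rewrite E_D//; [|exact: bndOD|exact: bndOZ].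
  by rewrite E_D// E_Z// qlin mulr0 addr0.
have ELp : E (fun eta => p eta * L p eta) =
    E (fun eta => lin b eta * L (lin b) eta) + E (fun eta => q eta * L q eta).
  have bq1 := polyk_bndO (polyuM pq pLb); have bq2 := polyk_bndO (polyuM pb pLq).
  have bq3 := polyk_bndO (polyuM pb pLb); have bq4 := polyk_bndO (polyuM pq pLq).
  transitivity (E (fun eta => (lin b eta * L (lin b) eta + q eta * L q eta) +
      (q eta * L (lin b) eta + lin b eta * L q eta))).
    congr E; apply/funext => eta; rewrite {1 2}pE (LgenD alpha_gt0 c pb pq); ring.
  rewrite E_D//; [|exact: bndOD|exact: bndOD].
  rewrite [in X in _ + X]E_D// (Lgen_sym V_gt0 alpha_gt0 c_sym c_diag pb pq).
  have -> : E (fun eta => q eta * L (lin b) eta) = 0 by rewrite Lgen_lin// qlin.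
  by rewrite !addr0 E_D.
have Elin := energy_lin b.
have Vlin := var_lin b.
have hq := gap_orth pq qx.
have s2 : 0 < s * (s + 1) by rewrite mulr_gt0// addr_gt0.
have Eqq : 0 <= E (fun eta => q eta * q eta).
  by apply: (E_ge0 V_gt0 alpha_gt0) => // eta _; rewrite -expr2 sqr_ge0.
have V0 : 0 <= var_alpha alpha b / (s * (s + 1)).
  rewrite -Vlin.
  have -> : E (fun eta => lin b eta * lin b eta) - E (lin b) ^+ 2 =
      E (fun eta => (lin b eta - E (lin b)) ^+ 2).
    have bl := polyk_bndO pb.
    transitivity (E (fun eta => (lin b eta * lin b eta +
        - 2 * E (lin b) * lin b eta) + E (lin b) ^+ 2)); last first.
      by congr E; apply/funext => eta; ring.
    rewrite E_D//; [|by apply: bndOD => //; exact: bndOZ|exact: bndO_cst].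
    by rewrite E_D//; [rewrite E_Z// E_cst//; ring|exact: bndOZ].
  have pc : polyk n (fun eta => lin b eta - E (lin b)).
    exact: polyuB pb (polyu_cst V 0 n (E (lin b))).
  apply: (E_ge0 V_gt0 alpha_gt0) => [|eta _]; last exact: sqr_ge0.
  exact: polyk_bndO (polyuX 2 pc).
rewrite Epp Ep ELp opprD Elin addrAC Vlin; clear Epp Ep ELp Elin.
rewrite mulrDr; apply: lerD.
  rewrite -mulrA (le_trans (ler_piMl _ r1))//; first by rewrite mulr_ge0.
  by rewrite mulrA ler_pM2r ?invr_gt0.
by apply: le_trans hq; rewrite ler_wpM2r// /kappa ler_wpM2r.
Qed.

End poly_gap.

(** * Passage to the closure *)

Section square_integrable.
Context d (T : measurableType d) (R : realType) (P : probability T R).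
Implicit Types (f g u v : T -> R).

Definition sqint f := measurable_fun setT f /\
  P.-integrable setT (EFin \o (fun x => f x ^+ 2)).

Lemma sqint_mul f g : sqint f -> sqint g ->
  P.-integrable setT (EFin \o (fun x => f x * g x)).
Proof.
move=> [mf f2] [mg g2]; apply: le_integrable (integrableD measurableT f2 g2) => //.
  by apply/measurable_EFinP; exact: measurable_funM.
move=> x _ /=; rewrite lee_fin normrM [leRHS]ger0_norm ?addr_ge0 ?sqr_ge0//.
rewrite -(real_normK (num_real (f x))) -(real_normK (num_real (g x))).
have := normr_ge0 (f x); have := normr_ge0 (g x).
have := sqr_ge0 (`|f x| - `|g x|); nra.
Qed.

Lemma sqintD f g : sqint f -> sqint g -> sqint (fun x => f x + g x).
Proof.
move=> [mf f2] [mg g2]; split; first exact: measurable_funD.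
have := integrableD measurableT (integrableZl measurableT 2 f2) (integrableZl measurableT 2 g2).
apply: le_integrable => //.
  by apply/measurable_EFinP; apply: measurable_funX; exact: measurable_funD.
move=> x _ /=; rewrite lee_fin ger0_norm ?sqr_ge0// [leRHS]ger0_norm; last first.
  by rewrite addr_ge0// mulr_ge0// sqr_ge0.
have := sqr_ge0 (f x - g x); nra.
Qed.

Lemma sqint_cst k : sqint (fun=> k).
Proof.
split => //; have := finite_measure_integrable_cst P (k ^+ 2) measurableT.
by apply: eq_integrable.
Qed.

Lemma sqintZ k f : sqint f -> sqint (fun x => k * f x).
Proof.
move=> [mf f2]; split; first exact: measurable_funM.
have := integrableZl measurableT (k ^+ 2) f2; apply: eq_integrable => // x _ /=.
by rewrite -EFinM exprMn.
Qed.

Lemma sqintB f g : sqint f -> sqint g -> sqint (fun x => f x - g x).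
Proof.
move=> hf hg; have := sqintD hf (sqintZ (-1) hg).
by under eq_fun do rewrite mulN1r.
Qed.

Definition ip f g : R := \int[P]_x (f x * g x).

Lemma ipC f g : ip f g = ip g f.
Proof. by apply: eq_Rintegral => x _; rewrite mulrC. Qed.

Lemma ipDl f g u : sqint f -> sqint g -> sqint u ->
  ip (fun x => f x + g x) u = ip f u + ip g u.
Proof.
move=> hf hg hu; rewrite /ip -RintegralD//; try exact: sqint_mul.
by apply: eq_Rintegral => x _; rewrite mulrDl.
Qed.

Lemma ipZl k f u : sqint f -> sqint u -> ip (fun x => k * f x) u = k * ip f u.
Proof.
move=> hf hu; rewrite /ip -RintegralZl//; last exact: sqint_mul.
by apply: eq_Rintegral => x _; rewrite mulrA.
Qed.

Lemma ipBl f g u : sqint f -> sqint g -> sqint u ->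
  ip (fun x => f x - g x) u = ip f u - ip g u.
Proof.
move=> hf hg hu; rewrite -mulN1r -ipZl// -ipDl//; last exact: sqintZ.
by congr ip; apply/funext => x; rewrite mulN1r.
Qed.

Lemma ip_ge0 f : 0 <= ip f f.
Proof. by apply: Rintegral_ge0 => x _; rewrite -expr2 sqr_ge0. Qed.

Lemma ip_cauchy_schwarz f g : sqint f -> sqint g ->
  `|ip f g| <= Num.sqrt (ip f f) * Num.sqrt (ip g g).
Proof.
move=> hf hg; rewrite -sqrtrM ?ip_ge0// -sqrtr_sqr ler_wsqrtr//.
have H t : 0 <= ip f f + 2 * t * ip f g + t ^+ 2 * ip g g.
  have -> : ip f f + 2 * t * ip f g + t ^+ 2 * ip g g =
      ip (fun x => f x + t * g x) (fun x => f x + t * g x).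
    have tg := sqintZ t hg; have ftg := sqintD hf tg.
    rewrite ipDl// ipZl// (ipC f (fun x => _ + _)) (ipC g (fun x => _ + _)).
    by rewrite !ipDl// !ipZl// (ipC g f); ring.
  exact: ip_ge0.
move: H (ip_ge0 g); move: (ip f f) (ip f g) (ip g g) => A M B H.
rewrite le_eqVlt => /predU1P[B0|B0].
  have [->|M0] := eqVneq M 0; first by rewrite expr0n -B0 mulr0.
  have := H (- (A + 1) / (2 * M)); rewrite -B0 mulr0 addr0.
  have -> : A + 2 * (- (A + 1) / (2 * M)) * M = -1 by field.
  by rewrite lerNr oppr0 ler10.
have := H (- M / B).
have -> : A + 2 * (- M / B) * M + (- M / B) ^+ 2 * B = (A * B - M ^+ 2) / B.
  by field; rewrite gt_eqF.
by rewrite pmulr_lge0 ?invr_gt0// subr_ge0.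
Qed.

Lemma Lnorm2E f : sqint f -> 'N[P]_2%:E[EFin \o f]%E = (Num.sqrt (ip f f))%:E.
Proof.
move=> hf; rewrite unlock /Lnorm.
have -> : (\int[P]_x `|(EFin \o f) x| `^ 2)%E = (ip f f)%:E.
  rewrite /ip /Rintegral fineK; last exact: integrable_fin_num (sqint_mul hf hf).
  by apply: eq_integral => x _ /=; rewrite powR_mulrn// real_normK ?num_real// expr2.
by rewrite poweR_EFin powR12_sqrt// ip_ge0.
Qed.

Lemma sqint_Lfun f : sqint f -> f \in Lfun P 2%:E.
Proof.
move=> hf; rewrite inE/=; apply/andP; split; first by rewrite inE; case: hf.
by rewrite inE/= /finite_norm Lnorm2E// ltry.
Qed.

Lemma Lfun_sqint f : f \in Lfun P 2%:E -> sqint f.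
Proof.
move=> /[dup] lf; rewrite inE/= => /andP[/[!inE]/= mf _]; split => //.
exact: Lfun2_integrable_sqr.
Qed.

(** The difference of the inner products is expanded bilinearly around the limits, and
    Cauchy-Schwarz bounds each term by the two norms that tend to 0. *)
Lemma cvg_ip (u v : nat -> T -> R) f g :
  (forall k, sqint (u k)) -> (forall k, sqint (v k)) -> sqint f -> sqint g ->
  (fun k => 'N[P]_2%:E[EFin \o (u k \- f)%R])%E @ \oo --> 0%E ->
  (fun k => 'N[P]_2%:E[EFin \o (v k \- g)%R])%E @ \oo --> 0%E ->
  (fun k => ip (u k) (v k)) @ \oo --> ip f g.
Proof.
move=> hu hv hf hg uf vg.
pose a k := Num.sqrt (ip (u k \- f) (u k \- f)); pose b k := Num.sqrt (ip (v k \- g) (v k \- g)).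
have duf k : sqint (u k \- f) by exact: sqintB.
have dvg k : sqint (v k \- g) by exact: sqintB.
have a0 : a @ \oo --> (0 : R).
  rewrite (_ : a = fine \o (fun k => 'N[P]_2%:E[EFin \o (u k \- f)%R]%E)).
    by have /fine_cvgP[] := uf.
  by apply/funext => k; rewrite /= Lnorm2E.
have b0 : b @ \oo --> (0 : R).
  rewrite (_ : b = fine \o (fun k => 'N[P]_2%:E[EFin \o (v k \- g)%R]%E)).
    by have /fine_cvgP[] := vg.
  by apply/funext => k; rewrite /= Lnorm2E.
have key k : `|ip (u k) (v k) - ip f g| <= a k * b k + a k * Num.sqrt (ip g g) +
    Num.sqrt (ip f f) * b k.
  have -> : ip (u k) (v k) - ip f g = ip (u k \- f) (v k \- g) + ip (u k \- f) g +
      ip f (v k \- g).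
    rewrite !(ipC _ (v k \- g)) !ipBl// !(ipC _ (u k \- f)) !ipBl//.
    rewrite (ipC g) (ipC f) (ipC (v k)); ring.
  rewrite (le_trans (ler_normD _ _))// lerD ?ip_cauchy_schwarz//.
  by rewrite (le_trans (ler_normD _ _))// lerD ?ip_cauchy_schwarz.
have bnd0 : (fun k => a k * b k + a k * Num.sqrt (ip g g) + Num.sqrt (ip f f) * b k)
    @ \oo --> (0 : R).
  have -> : (0 : R) = 0 * 0 + 0 * Num.sqrt (ip g g) + Num.sqrt (ip f f) * 0.
    by rewrite !mul0r mulr0 !addr0.
  apply: cvgD; [apply: cvgD; [exact: cvgM|apply: cvgM => //; exact: cvg_cst]|].
  by apply: cvgM => //; exact: cvg_cst.
apply/subr_cvg0/norm_cvg0P; apply: (squeeze_cvgr _ (cvg_cst 0) bnd0).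
by apply: nearW => k; rewrite normr_ge0 key.
Qed.

End square_integrable.

(** * The closed generator and the two infima *)

Section spectral_gap.
Variables (R : realType) (V : finType) (c : V -> V -> R) (alpha : V -> R).
Hypothesis V_gt0 : (0 < #|V|)%N.
Hypotheses (c_sym : forall x y, c x y = c y x) (c_ge0 : forall x y, 0 <= c x y).
Hypotheses (c_diag : forall x, c x x = 0) (alpha_gt0 : forall x, 0 < alpha x).
Implicit Types (eta : state R V) (f g : state R V -> R) (phi b : V -> R).
Local Notation P := (dirichlet alpha).
Local Notation s := (\sum_x alpha x).
Local Notation E := (hp_mean alpha).
Local Notation L := (Lgen alpha c).

Lemma bndO_sqint f : bndO f -> sqint P f.
Proof.
move=> bf; split; first by case: bf.
have := bndO_integrable V_gt0 alpha_gt0 (bndOM bf bf).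
by apply: eq_integrable.
Qed.

Lemma var_ip f : sqint P f ->
  ip P (fun eta => f eta - E f) (fun eta => f eta - E f) =
  ip P f f - ip P f (fun=> 1) ^+ 2.
Proof.
move=> hf; have h1 := sqint_cst P 1; have hm := sqint_cst P (E f).
have hd := sqintB hf hm.
have Ef : E f = ip P f (fun=> 1) by apply: eq_Rintegral => eta _; rewrite mulr1.
have mE u : sqint P u -> ip P (fun=> E f) u = E f * ip P u (fun=> 1).
  move=> hu; rewrite (_ : (fun=> E f) = fun eta : state R V => E f * 1).
    by rewrite ipZl//; congr (_ * _); exact: ipC.
  by apply/funext => eta; rewrite mulr1.
have i11 : ip P (fun=> 1) (fun=> 1) = 1.
  by rewrite -[RHS](E_cst alpha); apply: eq_Rintegral => eta _; rewrite mulr1.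
rewrite ipBl// (mE _ hd) (ipC P f) !ipBl// (mE _ hf) (mE _ h1) i11 -Ef; ring.
Qed.

Lemma closure_gap (rho : R) f g :
  (forall k p, polyk k p -> rho * (E (fun eta => p eta * p eta) - E p ^+ 2) <=
     - E (fun eta => p eta * L p eta)) ->
  hp_closure c alpha f g -> 'N[P]_2%:E[EFin \o (fun eta => f eta - E f)%R]%E = 1%E ->
  rho <= \int[P]_eta (f eta * - g eta).
Proof.
move=> H [/Lfun_sqint hf /Lfun_sqint hg [p [pp pf pg]]].
have h1 := sqint_cst P 1.
have pk k : exists n, polyk n (p k) by exact: polyfun_polyk.
have hp k : sqint P (p k) by have [n pn] := pk k; exact/bndO_sqint/polyk_bndO/pn.
have LpE k : hp_generator c alpha (p k) = L (p k).
  by have [n pn] := pk k; exact: (hp_generatorE alpha_gt0 c_diag pn).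
have hLp k : sqint P (L (p k)).
  by have [n pn] := pk k; apply: bndO_sqint; exact: polyk_bndO (polyk_Lgen alpha_gt0 c pn).
have {}pg : (fun k => 'N[P]_2%:E[EFin \o (L (p k) \- g)%R])%E @ \oo --> 0%E.
  by have : (fun k => 'N[P]_2%:E[EFin \o (hp_generator c alpha (p k) \- g)%R])%E
       @ \oo --> 0%E := pg; under eq_fun do rewrite LpE.
(* The mean is the inner product with 1, treated as the limit of a constant sequence. *)
have p1 : (fun k : nat => 'N[P]_2%:E[EFin \o ((fun=> 1) \- (fun=> 1))%R])%E @ \oo --> 0%E.
  have -> : 'N[P]_2%:E[EFin \o ((fun=> 1) \- (fun=> 1))%R]%E = 0%E; last exact: cvg_cst.
  rewrite Lnorm2E; last exact: sqintB.
  by rewrite /ip /Rintegral integral0_eq ?sqrtr0// => eta _ /=; rewrite subrr mul0r.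
have cpp := cvg_ip hp hp hf hf pf pf.
have cp1 := cvg_ip hp (fun=> h1) hf h1 pf p1.
have cpL := cvg_ip hp hLp hf hg pf pg.
rewrite Lnorm2E; last by apply: sqintB => //; exact: sqint_cst.
move=> [sq1].
have v1 : ip P f f - ip P f (fun=> 1) ^+ 2 = 1.
  by rewrite -var_ip// -[LHS]sqr_sqrtr ?ip_ge0// sq1 expr1n.
have -> : \int[P]_eta (f eta * - g eta) = - ip P f g.
  rewrite -mulN1r -[in RHS](ipC P g) -ipZl// ipC.
  by apply: eq_Rintegral => eta _; rewrite mulN1r.
rewrite -[leLHS]mulr1 -v1.
have c1 : (fun k => rho * (ip P (p k) (p k) - ip P (p k) (fun=> 1) ^+ 2)) @ \oo -->
    rho * (ip P f f - ip P f (fun=> 1) ^+ 2).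
  apply: cvgM; first exact: cvg_cst.
  by apply: cvgB => //; exact: cvgM.
have c2 : (fun k => - ip P (p k) (L (p k))) @ \oo --> - ip P f g by exact: cvgN.
apply: (ler_cvg_to c1 c2); apply: nearW => k.
have [n pn] := pk k; have := H n _ pn.
suff -> : E (p k) = ip P (p k) (fun=> 1) by [].
by apply: eq_Rintegral => eta _; rewrite mulr1.
Qed.

Lemma polyfun1_lin b : polyfun1 (lin b).
Proof.
pose p : mpoly #|V| R := \sum_x b x *: mpolyX R (mnm1 (enum_rank x)).
exists p.
  rewrite /p; apply: (big_ind (fun q : mpoly #|V| R => (mmeasure mdeg q <= 2)%N)) => [|q q' hq hq'|x _].
  - by rewrite mmeasure0.
  - by rewrite (leq_trans (mmeasureD_le _ _ _))// geq_max hq.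
  - by apply: (leq_trans (mmeasureZ_le _ _ _)); rewrite mmeasureX ltnS eq_leq//; exact: mdeg1.
apply/funext => eta; rewrite /p raddf_sum; apply: eq_bigr => x _ /=.
by rewrite mevalZ mevalXU.
Qed.

Lemma polyfun_lin b : polyfun (lin b).
Proof. by have [p _ ->] := polyfun1_lin b; exists p. Qed.

Lemma closure_lin b : hp_closure c alpha (lin b) (L (lin b)).
Proof.
have pb := polyk_lin b; have hb := bndO_sqint (polyk_bndO pb).
have hL := bndO_sqint (polyk_bndO (polyk_Lgen alpha_gt0 c pb)).
have n0 (f : state R V -> R) : 'N[P]_2%:E[EFin \o (f \- f)%R]%E = 0%E.
  have -> : f \- f = fun=> 0 by apply/funext => eta; rewrite /= subrr.
  rewrite Lnorm2E; last exact: sqint_cst.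
  by rewrite /ip /Rintegral integral0_eq ?sqrtr0// => eta _ /=; rewrite mul0r.
split; [exact: sqint_Lfun|exact: sqint_Lfun|].
exists (fun=> lin b); rewrite (hp_generatorE alpha_gt0 c_diag pb) !n0.
by split => [_||]; [exact: polyfun_lin|exact: cvg_cst|exact: cvg_cst].
Qed.

(** The test function is [lin phi], rescaled to variance 1; the factor s (s + 1) cancels in the
    quotient. *)
Lemma gap1_le phi : 0 < var_alpha alpha phi ->
  (gap1 c alpha <= (energy c phi / var_alpha alpha phi)%:E)%E.
Proof.
move=> v0; have s0 := s_gt0 V_gt0 alpha_gt0.
set N := s * (s + 1); have N0 : 0 < N by rewrite mulr_gt0// addr_gt0.
pose w := var_alpha alpha phi / N; have w0 : 0 < w by rewrite divr_gt0.
pose k := (Num.sqrt w)^-1; pose b x := k * phi x.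
have k2 : k ^+ 2 = w^-1 by rewrite exprVn sqr_sqrtr// ltW.
have vb : var_alpha alpha b = k ^+ 2 * var_alpha alpha phi.
  rewrite /var_alpha mulrBr; congr (_ - _).
    by rewrite mulr_sumr; apply: eq_bigr => x _; rewrite /b; ring.
  have -> : \sum_x alpha x * b x = k * \sum_x alpha x * phi x.
    by rewrite mulr_sumr; apply: eq_bigr => x _; rewrite /b; ring.
  by rewrite exprMn -mulrA.
have eb : energy c b = k ^+ 2 * energy c phi.
  rewrite /energy mulrA; congr (_ / _); rewrite mulr_sumr; apply: eq_bigr => x _.
  by rewrite mulr_sumr; apply: eq_bigr => y _; rewrite /b; ring.
apply: ereal_inf_lbound; exists (lin b), (L (lin b)); split.
- exact: polyfun1_lin.
- exact: closure_lin.
- have hb := bndO_sqint (polyk_bndO (polyk_lin b)).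
  rewrite Lnorm2E; last by apply: sqintB => //; exact: sqint_cst.
  rewrite var_ip//.
  have -> : ip P (lin b) (fun=> 1) = E (lin b).
    by apply: eq_Rintegral => eta _; rewrite mulr1.
  rewrite (var_lin V_gt0 alpha_gt0) vb k2 -/N -mulrA -/w mulVf ?gt_eqF// sqrtr1 //.
- have hb := polyk_bndO (polyuM (polyk_lin b) (polyk_Lgen alpha_gt0 c (polyk_lin b))).
  congr EFin; transitivity (- E (fun eta => lin b eta * L (lin b) eta)); last first.
    rewrite -mulN1r -(E_Z V_gt0 alpha_gt0)//; apply: eq_Rintegral => eta _.
    by rewrite mulN1r mulrN.
  rewrite (energy_lin V_gt0 alpha_gt0 c_sym c_diag) eb k2 /w -/N invf_div.
  by field; rewrite !gt_eqF.
Qed.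

Lemma energy_ge0 phi : 0 <= energy c phi.
Proof.
rewrite divr_ge0// sumr_ge0// => x _; rewrite sumr_ge0// => y _.
by rewrite mulr_ge0// sqr_ge0.
Qed.

(** Nonnegativity of the Dirichlet form, as the case [g = gm = r = 0] of [poly_gap]. It comes first
    because applying [poly_gap] with the value of [gap1] presupposes that this value is
    nonnegative. *)
Lemma gap1_ge0 : (0 <= gap1 c alpha)%E.
Proof.
apply: le_ereal_inf_tmp => _ [f [g [_ fg nf ->]]]; rewrite lee_fin.
apply: closure_gap fg nf => k p pp; rewrite mul0r.
have := @poly_gap R V c alpha V_gt0 alpha_gt0 c_sym c_ge0 c_diag 0 0 _ _ _ _ k 0 p pp.
rewrite !mul0r mulr0; apply => // [phi|x y _].
  by rewrite mul0r energy_ge0.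
by rewrite addr_ge0// divr_ge0 ?addr_ge0// ltW.
Qed.

End spectral_gap.

Theorem theorem1p2 (R : realType) (V : finType)
    (c : V -> V -> R) (alpha : V -> R)
    (V_ge2 : (2 <= #|V|)%N)
    (c_sym : forall x y, c x y = c y x)
    (c_ge0 : forall x y, 0 <= c x y)
    (c_diag : forall x, c x x = 0)
    (c_conn : forall x y, connect [rel a b | 0 < c a b] x y)
    (alpha_gt0 : forall x, 0 < alpha x) :
  (mine 1 (gamma_hp c alpha) * gap1 c alpha <= gap c alpha)%E /\
  (gap c alpha <= gap1 c alpha)%E.
Proof.
have V_gt0 : (0 < #|V|)%N by exact: leq_trans V_ge2.
have s0 := s_gt0 V_gt0 alpha_gt0; set s := \sum_x alpha x in s0.
split; last first.
  apply: ereal_inf_le_tmp => r [f [g [_ fg nf rE]]]; by exists f, g.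
have [x [y xy]] : exists x y : V, x != y.
  by have /card_gt1P[x [y [_ _ xy]]] := V_ge2; exists x, y.
pose F (e : V * V) : R := alpha e.1 / (alpha e.1 + 1) + alpha e.2 / (alpha e.2 + 1).
have F0 e : 0 <= F e by rewrite /F addr_ge0// divr_ge0 ?addr_ge0// ltW.
(* Connectedness with two distinct vertices provides an edge, so the minimum differs from its
   default value [+oo] and is a real number [gm]. *)
have [e0 e0P] : exists e : V * V, (e.1 != e.2) && (0 < c e.1 e.2).
  have /connectP[[|z p]] := c_conn x y; first by move=> _ /= yx; rewrite yx eqxx in xy.
  move=> /= /andP[cxz _] _; exists (x, z); rewrite /= cxz andbT.
  by apply: contraTneq cxz => ->; rewrite c_diag ltxx.
have [gm gm0 gmE] : exists2 gm : R, 0 <= gm & (\big[mine/+oo]_(e : V * V | (e.1 != e.2) && (0 < c e.1 e.2)%R)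
    (F e)%:E = gm%:E)%E.
  have b0 : (0 <= \big[mine/+oo]_(e : V * V | (e.1 != e.2) && (0 < c e.1 e.2)%R) (F e)%:E)%E.
    by apply/bigmin_geP; split => // e _; rewrite lee_fin.
  have := @bigmin_le_cond _ _ _ +oo%E e0 (fun e => (e.1 != e.2) && (0 < c e.1 e.2))
    (fun e => (F e)%:E) e0P.
  by move: b0; case: (\big[_/_]_(_ | _) _) => // r r0 _; exists r.
have gmP u v : 0 < c u v -> gm <= alpha u / (alpha u + 1) + alpha v / (alpha v + 1).
  move=> cuv; rewrite -lee_fin -gmE.
  apply: (@bigmin_le_cond _ _ _ +oo%E (u, v) (fun e => (e.1 != e.2) && (0 < c e.1 e.2))
    (fun e => (F e)%:E)).
  by rewrite /= cuv andbT; apply: contraTneq cuv => ->; rewrite c_diag ltxx.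
have -> : gamma_hp c alpha = (gm * (1 + s^-1))%:E by rewrite /gamma_hp gmE.
have g1 := gap1_ge0 V_gt0 c_sym c_ge0 c_diag alpha_gt0.
(* A nonconstant linear function, available because alpha_x < s when there is a second vertex; it
   shows that [gap1] is finite. *)
have var_delta : 0 < var_alpha alpha (delta R x).
  have dE (h : V -> R) : \sum_z h z * delta R x z = h x by exact: sum_delta.
  rewrite /var_alpha (eq_bigr (fun z => alpha z * delta R x z)); last first.
    by move=> z _; rewrite /delta; case: eqP; rewrite ?expr1n// expr0n.
  rewrite !dE subr_gt0 ltr_pdivrMr// expr2 ltr_pM2l// (bigD1 x)//= ltrDl.
  by rewrite (bigD1 y) 1?eq_sym//= ltr_wpDr// sumr_ge0// => z _; exact: ltW.
have [g gE] : exists g : R, gap1 c alpha = g%:E.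
  have := gap1_le V_gt0 c_sym c_diag alpha_gt0 var_delta.
  by move: g1; case: (gap1 c alpha) => // r _ _; exists r.
have g0 : 0 <= g by rewrite -lee_fin -gE.
have gP phi : g * var_alpha alpha phi <= energy c phi.
  (* [gap1_le] needs positive variance to normalize; otherwise the left side is at most 0. *)
  have [v0|v0] := ltP 0 (var_alpha alpha phi).
    by rewrite -ler_pdivlMr// -lee_fin -gE; exact: gap1_le.
  apply: le_trans (energy_ge0 c_ge0 phi); exact: mulr_ge0_le0.
rewrite gE; apply: le_ereal_inf_tmp => _ [f [h [_ fh nf ->]]].
pose r := Num.min 1 (gm * (1 + s^-1)).
have gs0 : 0 <= gm * (1 + s^-1) by rewrite mulr_ge0// addr_ge0// invr_ge0 ltW.
have r0 : 0 <= r by rewrite le_min ler01.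
have -> : (mine 1 (gm * (1 + s^-1))%:E * g%:E)%E = (r * g)%:E by rewrite -EFin_min.
rewrite lee_fin; apply: (closure_gap V_gt0 c_diag alpha_gt0) fh nf => k p pp.
apply: (poly_gap V_gt0 alpha_gt0 c_sym c_ge0 c_diag gP gmP g0 gm0 pp r0).
  by rewrite ge_min lexx.
by rewrite [leRHS]mulrC ge_min lexx orbT.
Qed.
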